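(* Let $S$ be an infinite supernatural number. The smooth Bunce-Deddens-Toeplitz algebra $A_S^\infty$ is closed under the smooth functional calculus of self-adjoint elements: if $a\in A_S^\infty$ is self-adjoint and $f$ is a smooth function defined on an open neighborhood of the spectrum $\sigma(a)$ of $a$ in $\mathbb{R}$, then $f(a)\in A_S^\infty$.
   Context: A supernatural number is a formal product $S=\prod_{p\text{ prime}}p^{\varepsilon_p}$ with $\varepsilon_p\in\{0,1,\dots,\infty\}$; it is infinite if $\sum_p\varepsilon_p=\infty$. A positive integer $l$ divides $S$ (written $l|S$) if for every prime $p$ the exponent of $p$ in $l$ is at most $\varepsilon_p$. Define $\mathbb{Z}/S\mathbb{Z}=\prod_p\mathbb{Z}/p^{\varepsilon_p}\mathbb{Z}$ with the product topology, where $\mathbb{Z}/p^\infty\mathbb{Z}$ means the $p$-adic integers $\mathbb{Z}_p$; $\mathbb{Z}$ is a dense subgroup via $k\mapsto(k\bmod p^{\varepsilon_p})_p$, so $f(k)$ makes sense for $f\in C(\mathbb{Z}/S\mathbb{Z})$ and $k\in\mathbb{Z}$. Let $H=\ell^2(\mathbb{Z})$, $H_+=\ell^2(\mathbb{Z}_{\ge0})$ with canonical bases $\{E_l\}_{l\in\mathbb{Z}}$, $\{E_k^+\}_{k\ge0}$. For $f\in C(\mathbb{Z}/S\mathbb{Z})$ let $m_fE_l=f(l)E_l$ on $H$ and $M_fE_k^+=f(k)E_k^+$ on $H_+$; let $VE_l=E_{l+1}$ and $UE_k^+=E_{k+1}^+$. Put $B_S=C^*\{V,m_f\}\subseteq B(H)$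 (Bunce-Deddens algebra) and $A_S=C^*\{U,M_f\}\subseteq B(H_+)$ (Bunce-Deddens-Toeplitz algebra), with $f$ ranging over $C(\mathbb{Z}/S\mathbb{Z})$. RD means rapidly decaying, i.e. decaying faster than any inverse polynomial in the indices. The smooth Bunce-Deddens algebra is $$B_S^\infty=\Big\{b=\sum_{n\in\mathbb{Z}}V^nm_{f_n}: f_n\in C(\mathbb{Z}/S\mathbb{Z}),\ \{\|f_n\|_\infty\}\text{ is RD, and there is } l|S \text{ with } V^lbV^{-l}=b\Big\}\subseteq B_S.$$ Smooth compact operators: $\mathcal{K}^\infty$ is the set of operators $c=\sum_{k,s\ge0}c_{ks}P_{ks}$ on $H_+$ with $\{c_{ks}\}$ RD (i.e. $\sup_{k,s}(1+k)^M(1+s)^N|c_{ks}|<\infty$ for all $M,N\ge0$), where $P_{ks}E_r^+=\delta_{sr}E_k^+$. Toeplitz map: $T:B(H)\to B(H_+)$, $T(b)=P_{\ge0}bs$, where $s:H_+\to H$, $sE_k^+=E_k$, and $P_{\ge0}:H\to H_+$, $P_{\ge0}E_k=E_k^+$ for $k\ge0$ and $P_{\ge0}E_k=0$ for $k<0$. The smooth Bunce-Deddens-Toeplitz algebra is $A_S^\infty=\{T(b)+c: b\in B_S^\infty,\ c\in\mathcal{K}^\infty\}\subseteq A_S$; it is a $*$-subalgebra of $A_S$. Here $f(a)$ is defined by the continuous functional calculus in $A_S$. *)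

(* Defs.v *)
From HB Require Import structures.
From mathcomp Require Import all_boot all_order all_algebra.
From mathcomp Require Import all_classical all_reals all_analysis.
From mathcomp.real_closed Require Import complex.
From mathcomp Require Import ring lra zify.

Set Implicit Arguments.
Unset Strict Implicit.
Unset Printing Implicit Defensive.

Import Order.TTheory GRing.Theory Num.Theory.
Import numFieldNormedType.Exports.
Import Normc.

Local Open Scope classical_set_scope.
Local Open Scope complex_scope.
Local Open Scope ring_scope.

Definition prime_number := {p : nat | prime p}.

(* The exponent [None] stands for infinity. *)
Definition supernatural := prime_number -> option nat.

Definition exponent_ereal (R : realType) (e : option nat) : \bar R :=
  if e is Some n then n%:R%:E else +oo%E.

Definition infinite_supernatural (R : realType) (S : supernatural) :=
  (\esum_(p in [set: prime_number]) exponent_ereal R (S p) = +oo)%E.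

Definition dvd_supernatural (l : nat) (S : supernatural) :=
  (0 < l)%N /\
  forall (p : prime_number) (e : nat), S p = Some e -> (logn (val p) l <= e)%N.

(* The p-adic integers as the inverse limit of the Z/p^kZ: [x k] is the
   residue modulo p^k in [0, p^k).  The topology is that induced by the product
   of the discrete topologies on [nat]. *)
Definition padic_set (p : prime_number) : set {ptws nat -> nat} :=
  [set x | forall k, (x k < val p ^ k)%N /\ x k.+1 = x k %[mod val p ^ k]].

Definition padic_int (p : prime_number) : topologicalType :=
  set_type (padic_set p).

Definition Zmod_pe (p : prime_number) (e : option nat) : topologicalType :=
  if e is Some n then discrete_topology 'I_(val p ^ n) else padic_int p.

Definition ZmodS (S : supernatural) : topologicalType :=
  prod_topology (fun p : prime_number => Zmod_pe p (S p)).

Definition residue (p : prime_number) (n : nat) (k : int) : nat :=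
  `|(k %% (val p ^ n)%N%:Z)%Z|%N.

Lemma residue_lt p n k : (residue p n k < val p ^ n)%N.
Proof.
have p0 : (0 < val p ^ n)%N by rewrite expn_gt0 prime_gt0// (valP p).
rewrite /residue -ltz_nat gez0_abs; first by rewrite ltz_pmod.
by rewrite modz_ge0// eqz_nat -lt0n.
Qed.

Lemma residue_padic p k : padic_set p (fun n => residue p n k).
Proof.
move=> n; split; first exact: residue_lt.
have p0 m : (val p ^ m)%N%:Z != 0 by rewrite eqz_nat -lt0n expn_gt0 prime_gt0// (valP p).
have E m : (residue p m k)%:Z = (k %% (val p ^ m)%N%:Z)%Z.
  by rewrite gez0_abs// modz_ge0.
have : ((residue p n.+1 k)%:Z = (residue p n k)%:Z %[mod (val p ^ n)%N%:Z])%Z.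
  rewrite !E; apply/eqP; rewrite eqz_mod_dvd.
  apply/dvdzP; exists ((k %/ (val p ^ n)%N%:Z)%Z -
    (k %/ (val p ^ n.+1)%N%:Z)%Z * (val p)%:Z).
  rewrite /modz mulrBl -mulrA -PoszM -expnS; lia.
by rewrite !modz_nat => -[].
Qed.

Definition int_ZmodS (S : supernatural) (k : int) : ZmodS S :=
  fun p => match S p as e return Zmod_pe p e with
           | Some n => Ordinal (residue_lt p n k)
           | None =>
             exist (fun x => x \in padic_set p) _ (mem_set (residue_padic p k))
           end.

Section L2.
Context {R : realType} {I : choiceType}.

Definition square_summable (x : I -> R[i]^o) : bool :=
  (\esum_(i in [set: I]) ((normc (x i)) ^+ 2)%:E < +oo)%E.

Lemma esum_lty_scale (a b : I -> R) (c : R) :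
  0 <= c -> (forall i, 0 <= b i) -> (forall i, a i <= c * b i) ->
  (\esum_(i in [set: I]) (b i)%:E < +oo)%E ->
  (\esum_(i in [set: I]) (a i)%:E < +oo)%E.
Proof.
move=> c0 b0 ab bfin.
have bge : (0 <= \esum_(i in [set: I]) (b i)%:E)%E.
  by apply: esum_ge0 => i _; rewrite lee_fin.
apply: (@le_lt_trans _ _ (c%:E * \esum_(i in [set: I]) (b i)%:E)%E); last first.
  by rewrite lte_mul_pinfty// ?lee_fin// fin_numElt.
apply: ge_ereal_sup => _ [X [finX _] <-].
apply: (@le_trans _ _ (\sum_(i \in X) (c%:E * (b i)%:E))%E).
  by apply: lee_fsum => // i _; rewrite -EFinM lee_fin.
rewrite -ge0_mule_fsumr; last by move=> i; rewrite lee_fin.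
rewrite lee_wpmul2l ?lee_fin//; apply: ereal_sup_ubound.
by exists X.
Qed.

Lemma sqnormcD (x y : R[i]) :
  normc (x + y) ^+ 2 <= 2 * (normc x ^+ 2 + normc y ^+ 2).
Proof.
have xy : normc (x + y) <= normc x + normc y := le_normcD x y.
have n0 (z : R[i]) : 0 <= normc z by case: z => a b; exact: sqrtr_ge0.
apply: (@le_trans _ _ ((normc x + normc y) ^+ 2)); first by rewrite lerXn2r ?nnegrE ?addr_ge0.
rewrite -subr_ge0.
have -> : 2 * (normc x ^+ 2 + normc y ^+ 2) - (normc x + normc y) ^+ 2 =
   (normc x - normc y) ^+ 2.
  by rewrite sqrrD sqrrB mulr_natl mulr2n opprD; lra.
exact: sqr_ge0.
Qed.

Fact square_summable_submod : submod_closed square_summable.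
Proof.
split=> [|c x y].
  rewrite /in_mem/= /square_summable esum1// => i _.
  by rewrite normc0 expr0n.
rewrite /in_mem/= /square_summable => xs ys.
have cxs : (\esum_(i in [set: I]) ((normc (c * x i)) ^+ 2)%:E < +oo)%E.
  apply: (@esum_lty_scale _ (fun i => normc (x i) ^+ 2) (normc c ^+ 2)) => //.
  - exact: sqr_ge0.
  - by move=> i; exact: sqr_ge0.
  - by move=> i; rewrite normcM exprMn.
apply: (@esum_lty_scale _
  (fun i => normc (c * x i) ^+ 2 + normc (y i) ^+ 2) 2) => //.
- by move=> i; rewrite addr_ge0// sqr_ge0.
- by move=> i; exact: sqnormcD.
- under eq_esum do rewrite EFinD.
  rewrite esumD.
  + by rewrite lte_add_pinfty.
  + by move=> i _; rewrite lee_fin sqr_ge0.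
  + by move=> i _; rewrite lee_fin sqr_ge0.
Qed.

HB.instance Definition _ :=
  GRing.isSubmodClosed.Build _ _ square_summable square_summable_submod.

Record l2 := L2 { l2_coord :> I -> R[i]^o; _ : square_summable l2_coord }.

HB.instance Definition _ := [isSub for l2_coord].
HB.instance Definition _ := [Choice of l2 by <:].
HB.instance Definition _ := [SubChoice_isSubLmodule of l2 by <:].

End L2.
Arguments l2 : clear implicits.

Section HilbertSpace.
Context {R : realType} {I : choiceType}.

Definition l2norm (x : l2 R I) : R :=
  Num.sqrt (fine (\esum_(i in [set: I]) ((normc (x i)) ^+ 2)%:E)%E).

(* Sum of an absolutely summable real, resp. complex, family. *)
Definition rsum (f : I -> R) : R :=
  fine (\esum_(i in [set: I]) (EFin \o f)^\+ i -
        \esum_(i in [set: I]) (EFin \o f)^\- i)%E.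

Definition csum (f : I -> R[i]) : R[i] :=
  rsum (fun i => complex.Re (f i)) +i* rsum (fun i => complex.Im (f i)).

Definition l2dot (x y : l2 R I) : R[i] := csum (fun i => x i * (y i)^*).

Fact basis_square_summable (k : I) :
  square_summable (fun i => (i == k)%:R : R[i]^o).
Proof.
rewrite /square_summable.
apply: (@le_lt_trans _ _ (\esum_(i in [set k]) 1%:E)%E).
  rewrite [leRHS]esum_mkcond; apply: le_esum => i _.
  have [->|ik] := eqVneq i k; first by rewrite mem_set// normc1 expr1n.
  rewrite memNset ?normc0 ?expr0n//=; exact/eqP.
by rewrite esum_set1 ?lee_fin// ltry.
Qed.

Definition basis (k : I) : l2 R I := L2 (basis_square_summable k).

End HilbertSpace.

(* Transport of a square-summable family along a partial injection of the
   index sets, with the value 0 where it is undefined. *)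
Section PartialInjection.
Context {R : realType} {I J : choiceType} (g : J -> option I)
  (g_inj : forall j j' i, g j = Some i -> g j' = Some i -> j = j').

Lemma pull_square_summable (x : l2 R I) :
  square_summable (fun j => if g j is Some i then x i else 0 : R[i]^o).
Proof.
case: x => x xs; rewrite /square_summable /=.
apply: le_lt_trans xs.
apply: (@le_trans _ _
   (\esum_(j in [set j | g j])
     (if g j is Some i then ((normc (x i)) ^+ 2)%:E else 0))%E).
  rewrite [leRHS]esum_mkcond; apply: le_esum => j _.
  case E: (g j) => [i|]; last by rewrite normc0 expr0n /=; case: ifP.
  by rewrite mem_set//= E.
have [[j0 [i0 _]]|nog] := pselect (exists j i, g j = Some i); last first.
  rewrite esum1; first by apply: esum_ge0 => i _; rewrite lee_fin sqr_ge0.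
  by move=> j /=; case E: (g j) => [i|//] _; case: nog; exists j, i.
pose e j := odflt i0 (g j).
rewrite (@eq_esum _ _ _ _ (fun j => ((normc (x (e j))) ^+ 2)%:E)); last first.
  by move=> j /=; rewrite /e; case: (g j).
rewrite -(@esum_image _ _ _ [set j | g j] e (fun i => ((normc (x i)) ^+ 2)%:E)); last first.
  move=> j j' /set_mem /= gj /set_mem /= gj'; rewrite /e.
  case E: (g j) gj => [i|//] _; case E': (g j') gj' => [i'|//] _ /= ii'.
  by apply: (g_inj E); rewrite ii'.
rewrite [leLHS]esum_mkcond; apply: le_esum => i _.
by case: ifP => // _; rewrite lee_fin sqr_ge0.
Qed.

End PartialInjection.

Section Operators.
Context {R : realType} {I J : choiceType}.
Implicit Types T : l2 R I -> l2 R J.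

Definition opnorm_le T (M : R) := forall x, l2norm (T x) <= M * l2norm x.

Definition bounded_op T := linear T /\ exists M, opnorm_le T M.

Definition op_cvg (T_ : nat -> l2 R I -> l2 R J) T :=
  forall e : R, 0 < e -> \forall n \near \oo, opnorm_le (T_ n - T) e.

Definition is_adjoint T (T' : l2 R J -> l2 R I) :=
  forall x y, l2dot (T x) y = l2dot x (T' y).

End Operators.

Definition self_adjoint {R : realType} {I : choiceType}
  (T : l2 R I -> l2 R I) := is_adjoint T T.

Section CstarAlgebra.
Context {R : realType} {I : choiceType}.
Notation op := (l2 R I -> l2 R I).

Definition Cstar_subalgebra (A : set op) :=
  [/\ A `<=` bounded_op,
      A 0 /\ (forall S T, A S -> A T -> A (S + T)),
      (forall (c : R[i]) T, A T -> A (c *: T)) /\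
        (forall S T, A S -> A T -> A (S \o T)),
      forall T T', A T -> bounded_op T' -> is_adjoint T T' -> A T' &
      forall (T_ : nat -> op) T, (forall n, A (T_ n)) -> bounded_op T ->
        op_cvg T_ T -> A T].

Definition Cstar_generated (G : set op) : set op := smallest Cstar_subalgebra G.

Definition spectrum (A : set op) (a : op) : set R[i] :=
  [set z | ~ exists b : op,
    [/\ A b, (a - z *: id) \o b = id & b \o (a - z *: id) = id]].

Definition poly_op (p : {poly R[i]}) (a : op) : op :=
  \sum_(n < size p) p`_n *: iter n a.

(* [is_cfc A a f b]: b = f(a) for the continuous functional calculus in A of
   the self-adjoint element a, i.e. b is the norm limit of p_n(a) for
   polynomials p_n converging to f uniformly on the spectrum of a. *)
Definition is_cfc (A : set op) (a : op) (f : R -> R[i]) (b : op) :=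
  A b /\ forall e : R, 0 < e -> exists p : {poly R[i]},
    (forall r : R, spectrum A a r%:C -> normc (f r - p.[r%:C]) <= e) /\
    opnorm_le (b - poly_op p a) e.

End CstarAlgebra.

Definition smooth_on {R : realType} (U : set R) (f : R -> R[i]) :=
  forall (n : nat) (x : R), U x ->
    derivable (derive1n n (fun t => complex.Re (f t))) x 1 /\
    derivable (derive1n n (fun t => complex.Im (f t))) x 1.

Section BunceDeddens.
Context {R : realType}.
Local Notation H := (l2 R int).
Local Notation Hp := (l2 R nat).

Fact bilateral_inj (n : int) (j j' i : int) :
  Some (j - n) = Some i -> Some (j' - n) = Some i -> j = j'.
Proof. by move=> [<-] []; lia. Qed.

Definition Vpow (n : int) (x : H) : H :=
  L2 (pull_square_summable (@bilateral_inj n) x).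

Lemma Vpow_basis (n l : int) : Vpow n (basis l) = basis (l + n).
Proof. by apply/val_inj/funext => j /=; rewrite subr_eq. Qed.

Definition unilateral_map (k : nat) : option nat :=
  if k is k'.+1 then Some k' else None.

Fact unilateral_inj (j j' i : nat) :
  unilateral_map j = Some i -> unilateral_map j' = Some i -> j = j'.
Proof. by case: j => // j; case: j' => // j' [->] [->]. Qed.

Definition U_op (x : Hp) : Hp := L2 (pull_square_summable unilateral_inj x).

Lemma U_op_basis (k : nat) : U_op (basis k) = basis k.+1.
Proof. by apply/val_inj/funext => -[]. Qed.

Definition nonneg_map (l : int) : option nat :=
  if l is Posz k then Some k else None.

Fact nonneg_inj (j j' : int) (i : nat) :
  nonneg_map j = Some i -> nonneg_map j' = Some i -> j = j'.
Proof. by case: j => // j; case: j' => // j' [->] [->]. Qed.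

Definition incl_s (x : Hp) : H := L2 (pull_square_summable nonneg_inj x).

Fact proj_inj (j j' : nat) (i : int) :
  Some (Posz j) = Some i -> Some (Posz j') = Some i -> j = j'.
Proof. by move=> [<-] [->]. Qed.

Definition proj_ge0 (x : H) : Hp := L2 (pull_square_summable proj_inj x).

Definition toeplitz (b : H -> H) : Hp -> Hp := proj_ge0 \o b \o incl_s.

(* Pointwise multiplication by g.  The product is square-summable, hence the
   default value 0 of [insubd] is not used, when g is bounded; this is the case
   for the restriction to Z of a continuous function on the compact Z/SZ. *)
Definition mul_op {I : choiceType} (g : I -> R[i]) (x : l2 R I) : l2 R I :=
  insubd (0 : l2 R I) (fun i => g i * x i : R[i]^o).

Lemma mul_opE (I : choiceType) (g : I -> R[i]) (M : R) (x : l2 R I) (i : I) :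
  (forall j, normc (g j) <= M) -> mul_op g x i = g i * x i.
Proof.
move=> gM; rewrite /mul_op.
have sP : square_summable (fun i => g i * x i : R[i]^o).
  case: x => x xs; apply: (@esum_lty_scale _ _ _ (fun i => normc (x i) ^+ 2) (M ^+ 2)) => //.
  - exact: sqr_ge0.
  - by move=> j; exact: sqr_ge0.
  - move=> j /=; rewrite normcM exprMn ler_wpM2r ?sqr_ge0//.
    have g0 : 0 <= normc (g j) by case: (g j) => a b; exact: sqrtr_ge0.
    by rewrite lerXn2r ?nnegrE// (le_trans g0).
by have /= -> := insubdK (0 : l2 R I) sP.
Qed.

Lemma mul_op_basis (I : choiceType) (g : I -> R[i]) (M : R) (k : I) :
  (forall j, normc (g j) <= M) -> mul_op g (basis k) = g k *: basis k.
Proof.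
move=> gM; apply/val_inj/funext => j.
rewrite [LHS](mul_opE _ _ gM) -[RHS]/(g k * (j == k)%:R) /=.
by have [->//|_] := eqVneq j k; rewrite !mulr0.
Qed.

Context (S : supernatural).

Definition m_op (f : ZmodS S -> R[i]) : H -> H :=
  mul_op (fun l => f (int_ZmodS S l)).

Definition M_op (f : ZmodS S -> R[i]) : Hp -> Hp :=
  mul_op (fun k => f (int_ZmodS S k%:Z)).

Definition continuous_ZmodS (f : ZmodS S -> R[i]) : Prop :=
  continuous (f : ZmodS S -> R[i]^o).

Definition BDT_algebra : set (Hp -> Hp) :=
  Cstar_generated
    ([set U_op] `|` [set M_op f | f in continuous_ZmodS]).

Definition supnorm (f : ZmodS S -> R[i]) : R := sup (range (fun x => normc (f x))).

Definition RD_int (u : int -> R) :=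
  forall N : nat, exists K : R, forall n, (1 + `|n|%:~R) ^+ N * u n <= K.

Definition RD_matrix (c : nat -> nat -> R[i]) :=
  forall M N : nat, exists K : R, forall k s,
    (1 + k%:R) ^+ M * (1 + s%:R) ^+ N * normc (c k s) <= K.

(* The partial sums over |n| <= N of sum_n V^n m_(F n). *)
Definition BD_partial_sum (F : int -> ZmodS S -> R[i]) (N : nat) : H -> H :=
  \sum_(0 <= j < N.*2.+1) (Vpow (j%:Z - N%:Z) \o m_op (F (j%:Z - N%:Z))).

Definition BD_smooth : set (H -> H) :=
  [set b | [/\ bounded_op b,
    exists F : int -> ZmodS S -> R[i],
      [/\ forall n, continuous_ZmodS (F n), RD_int (fun n => supnorm (F n)) &
          op_cvg (BD_partial_sum F) b] &
    exists l : nat, dvd_supernatural l S /\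
      Vpow l%:Z \o b \o Vpow (- l%:Z) = b]].

Definition matrix_unit (k s : nat) (x : Hp) : Hp := x s *: basis k.

Definition K_smooth : set (Hp -> Hp) :=
  [set c | bounded_op c /\ exists2 c_ : nat -> nat -> R[i], RD_matrix c_ &
    op_cvg (fun n => \sum_(k < n) \sum_(s < n) c_ k s *: matrix_unit k s) c].

Definition BDT_smooth : set (Hp -> Hp) :=
  [set toeplitz b + c | b in BD_smooth & c in K_smooth].

End BunceDeddens.

(* Main.v *)
Require Import Defs.
From HB Require Import structures.
From mathcomp Require Import all_boot all_order all_algebra.
From mathcomp Require Import all_classical all_reals all_analysis.
From mathcomp.real_closed Require Import complex.
From mathcomp Require Import ring lra zify.

(** The smooth algebra is recognized by its matrices. A bounded operator [x] has
    the form [T(b) + c], with [b] in the smooth Bunce-Deddens algebra and [c]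
    smooth compact, if and only if

    - the entries of [x] decay rapidly away from the diagonal ([off_diag_RD]), and
    - for some divisor [l] of [S] all entries of the commutator of [U^l] and [x]
      decay rapidly ([entries_RD]).

    One direction is [BDT_smooth_entries]. For the other,
    [BDT_smooth_of_entries], the second condition makes the entries converge
    down each diagonal in steps of [l]; the limits are the values of [l]-periodic
    symbols, that is of locally constant functions on Z/SZ, and what remains of
    [x] decays rapidly.

    Both conditions concern derivations of the operator algebra. By Schur's test
    the first one says that the iterated commutators of [x] with the number
    operator are bounded, and the second one that the derivation by [U^l] takes
    [x] into the ideal of smooth compact operators. A smooth functional calculus
    therefore follows from an expansion of [f] in polynomials whose values at [x]
    grow only polynomially under such derivations, with coefficients that decay
    faster than any power. Chebyshev polynomials of the second kind serve this
    purpose. If [delta] is a derivation, then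

      [delta (U_n(x)) = \sum_(m < n) U_(n - m - 1)(x) (2 delta x) U_m(x)]

    by [chebU_derivation], a sum of only [n] products; and if the spectrum of [x]
    lies in the half interval from -1/2 to 1/2, where the values of [U_n] are at
    most 2, then [|U_n(x)| <= 2]. By induction every weighted norm of [U_n(x)] is
    of polynomial growth ([comm_norm_chebU], [smoothing_norm_chebU]), and a
    convergent Chebyshev series with rapidly decaying coefficients inherits the two
    conditions from [x] ([chebyshev_limit_RD]).

    The expansion of [f] is obtained from [g], the product of [f] with a cutoff
    function, by interpolating [g (cos t) sin t] with sine polynomials; the
    coefficients decay because they are discrete sine transforms of a
    differentiable periodic function ([chebyshev_approximation]). Only one rate of
    decay is needed at a time, so that a cutoff of finite differentiability, built
    from powers, is sufficient; the Chebyshev sum may depend on the rate, since in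
    the end only the operator [f(x)] matters.

    That [f(x)] exists, is unique and is the norm limit of these sums is the
    spectral theory of a self-adjoint element in a C*-algebra of operators: the
    norm of [p(x)] is the maximum of [|p|] on the spectrum ([norm_attained]), and a
    function that polynomials approximate uniformly on the spectrum has a value at
    [x] ([functional_calculus]). Finally the smooth elements belong to the Toeplitz
    algebra ([BDT_smooth_sub_algebra]), because monomials in the generators
    approximate Toeplitz operators and matrix units are polynomials in the shift
    and its adjoint. *)

Set Implicit Arguments.
Unset Strict Implicit.
Unset Printing Implicit Defensive.

Import Order.TTheory GRing.Theory Num.Theory.
Import numFieldNormedType.Exports.
Import Normc.

Local Open Scope classical_set_scope.
Local Open Scope complex_scope.
Local Open Scope ring_scope.

Local Notation basis := Defs.basis.

(** * The Hilbert space of square-summable families *)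

Section ComplexNorm.
Context {R : realType}.
Implicit Types z w : R[i].

Lemma normc_ge0 z : 0 <= normc z.
Proof. by case: z => a b; exact: sqrtr_ge0. Qed.

Lemma normcNr z : normc (- z) = normc z.
Proof. exact: (@normrN _ (Rcomplex R)). Qed.

Lemma normcBr z w : normc (z - w) = normc (w - z).
Proof. by rewrite -opprB normcNr. Qed.

Lemma normc_triangle z w : normc (z + w) <= normc z + normc w.
Proof. exact: le_normcD. Qed.

Lemma normc_eq0 z : (normc z == 0) = (z == 0).
Proof. by apply/eqP/eqP => [/eq0_normc|->] //; rewrite normc0. Qed.

Lemma normc_sqrE z : normc z ^+ 2 = complex.Re z ^+ 2 + complex.Im z ^+ 2.
Proof. by case: z => a b /=; rewrite sqr_sqrtr// addr_ge0 ?sqr_ge0. Qed.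

Lemma normc_real (r : R) : normc r%:C = `|r|.
Proof. by rewrite /= expr0n addr0 sqrtr_sqr. Qed.

Lemma conj_real (r : R) : (r%:C : R[i])^* = r%:C.
Proof. exact: conjc_real. Qed.

Lemma normc_conj z : normc z^* = normc z.
Proof. by case: z => a b; rewrite /= sqrrN. Qed.

Lemma mulc_conj z : z * z^* = (normc z ^+ 2)%:C.
Proof.
rewrite normc_sqrE; case: z => a b; apply/eqP; rewrite eq_complex /=; apply/andP.
by split; apply/eqP; ring.
Qed.

Lemma normc_sum (T : Type) (s : seq T) (P : pred T) (F : T -> R[i]) :
  normc (\sum_(i <- s | P i) F i) <= \sum_(i <- s | P i) normc (F i).
Proof.
elim/big_ind2 : _ => //; first by rewrite normc0.
by move=> z r w t zr wt; rewrite (le_trans (normc_triangle _ _))// lerD.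
Qed.

Lemma ler_Re_normc z : `|complex.Re z| <= normc z.
Proof.
rewrite -(@ler_pXn2r _ 2) ?nnegrE ?normc_ge0// normc_sqrE real_normK ?num_real//.
by rewrite lerDl sqr_ge0.
Qed.

Lemma ler_Im_normc z : `|complex.Im z| <= normc z.
Proof.
rewrite -(@ler_pXn2r _ 2) ?nnegrE ?normc_ge0// normc_sqrE real_normK ?num_real//.
by rewrite lerDr sqr_ge0.
Qed.

Lemma normc_le_ReIm z : normc z <= `|complex.Re z| + `|complex.Im z|.
Proof.
rewrite -(@ler_pXn2r _ 2) ?nnegrE ?normc_ge0 ?addr_ge0// normc_sqrE sqrrD.
rewrite !real_normK ?num_real//.
have := mulr_ge0 (normr_ge0 (complex.Re z)) (normr_ge0 (complex.Im z)); lra.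
Qed.

(** Limits are always produced in this quantitative form: the same [eps] that
    controls the Cauchy differences controls the distance to the limit, which lets
    errors pass unchanged from scalars to vectors and from vectors to operators. *)
Lemma complex_cauchy_limit (z : nat -> R[i]) (eps : nat -> R) :
  (forall m n, (m <= n)%N -> normc (z n - z m) <= eps m) ->
  (forall e : R, 0 < e -> exists m, eps m <= e) ->
  exists w, forall m, normc (w - z m) <= eps m.
Proof.
move=> zeps eps0.
have real_lim (r : nat -> R) :
    (forall m n, (m <= n)%N -> `|r n - r m| <= eps m) ->
    exists l, forall m, `|l - r m| <= eps m.
  move=> reps.
  have low m n : r m - eps m <= r n + eps n.
    have := reps _ _ (leq_maxl m n); have := reps _ _ (leq_maxr m n).
    by rewrite !ler_distl => /andP[_ h1] /andP[h2 _]; lra.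
  pose E := [set x | exists m, x = r m - eps m].
  have hE : has_sup E.
    split; first by exists (r 0%N - eps 0%N); exists 0%N.
    by exists (r 0%N + eps 0%N) => _ [m ->].
  exists (sup E) => m; rewrite ler_distl; apply/andP; split.
    by apply: ub_le_sup; [case: hE | exists m].
  by apply: ge_sup; [case: hE | move=> _ [n ->]].
have [a Ha] : exists l, forall m, `|l - complex.Re (z m)| <= eps m.
  apply: real_lim => m n mn; apply: le_trans (zeps m n mn).
  by apply: le_trans (ler_Re_normc _); case: (z n); case: (z m).
have [b Hb] : exists l, forall m, `|l - complex.Im (z m)| <= eps m.
  apply: real_lim => m n mn; apply: le_trans (zeps m n mn).
  by apply: le_trans (ler_Im_normc _); case: (z n); case: (z m).
exists (a +i* b) => m; apply/ler_addgt0Pr => e e0.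
have [n en] := eps0 (e / 3) (divr_gt0 e0 (ltr0n _ 3)).
have le2 : normc (a +i* b - z n) <= eps n + eps n.
  apply: le_trans (normc_le_ReIm _) _.
  by apply: lerD; [have := Ha n|have := Hb n]; case: (z n).
have := zeps _ _ (leq_maxl n m); have := zeps _ _ (leq_maxr n m).
set q := maxn n m => h1 h2.
have -> : a +i* b - z m = (a +i* b - z n) + ((z n - z q) + (z q - z m)).
  by rewrite !addrA !subrK.
have t1 := normc_triangle (a +i* b - z n) ((z n - z q) + (z q - z m)).
have t2 := normc_triangle (z n - z q) (z q - z m).
rewrite normcBr in h2; lra.
Qed.

End ComplexNorm.

Section FiniteSums.
Context {R : realType} {I : choiceType}.
Implicit Types (x y z : l2 R I) (a : I -> R).

Lemma esum_le_finite a (M : R) : (forall i, 0 <= a i) ->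
  (forall s : seq I, uniq s -> \sum_(i <- s) a i <= M) ->
  (\esum_(i in [set: I]) (a i)%:E <= M%:E)%E.
Proof.
move=> a0 aM; apply: ge_ereal_sup => _ [X [/finite_seqP[s sX] _] <-].
have -> : X = [set` undup s].
  by rewrite sX; apply/seteqP; split=> i /=; rewrite mem_undup.
by rewrite -fsbig_seq ?undup_uniq// sumEFin lee_fin aM ?undup_uniq.
Qed.

Lemma finite_le_esum a (s : seq I) : uniq s ->
  ((\sum_(i <- s) a i)%:E <= \esum_(i in [set: I]) (a i)%:E)%E.
Proof.
move=> us; rewrite -sumEFin fsbig_seq//.
by apply: ereal_sup_ubound; exists [set` s].
Qed.

Lemma square_summable_finite (f : I -> R[i]^o) (M : R) :
  (forall s : seq I, uniq s -> \sum_(i <- s) normc (f i) ^+ 2 <= M) ->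
  square_summable f.
Proof.
move=> fM; apply: le_lt_trans (ltry M).
by apply: (esum_le_finite (a := fun i => normc (f i) ^+ 2)) => // i; exact: sqr_ge0.
Qed.

Lemma l2_sumE x : (\esum_(i in [set: I]) ((normc (x i)) ^+ 2)%:E)%E \is a fin_num.
Proof.
rewrite ge0_fin_numE; first by case: x => x.
by apply: esum_ge0 => i _; rewrite lee_fin sqr_ge0.
Qed.

Lemma l2norm_ge0 x : 0 <= l2norm x.
Proof. exact: sqrtr_ge0. Qed.

Lemma l2norm_sqr x :
  (l2norm x ^+ 2)%:E = (\esum_(i in [set: I]) ((normc (x i)) ^+ 2)%:E)%E.
Proof.
rewrite sqr_sqrtr ?fineK ?l2_sumE// fine_ge0//.
by apply: esum_ge0 => i _; rewrite lee_fin sqr_ge0.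
Qed.

Lemma finite_le_l2norm x (s : seq I) : uniq s ->
  \sum_(i <- s) normc (x i) ^+ 2 <= l2norm x ^+ 2.
Proof.
move=> us; rewrite -lee_fin l2norm_sqr.
exact: (finite_le_esum (fun i => normc (x i) ^+ 2)).
Qed.

Lemma l2norm_sqr_le x (M : R) :
  (forall s : seq I, uniq s -> \sum_(i <- s) normc (x i) ^+ 2 <= M) ->
  l2norm x ^+ 2 <= M.
Proof.
move=> xM; rewrite -lee_fin l2norm_sqr.
by apply: (esum_le_finite (a := fun i => normc (x i) ^+ 2)) => // i; exact: sqr_ge0.
Qed.

Lemma l2norm_le x (M : R) : 0 <= M ->
  (forall s : seq I, uniq s -> \sum_(i <- s) normc (x i) ^+ 2 <= M ^+ 2) ->
  l2norm x <= M.
Proof.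
move=> M0 xM; rewrite -(@ler_pXn2r _ 2) ?nnegrE ?l2norm_ge0//.
exact: l2norm_sqr_le.
Qed.

Lemma coord_le_l2norm x i : normc (x i) <= l2norm x.
Proof.
rewrite -(@ler_pXn2r _ 2) ?nnegrE ?l2norm_ge0 ?normc_ge0//.
by have := @finite_le_l2norm x [:: i] isT; rewrite big_seq1.
Qed.

Lemma l2P x y : (forall i, x i = y i) -> x = y.
Proof. by move=> xy; apply/val_inj/funext. Qed.

Lemma l2norm0 : l2norm (0 : l2 R I) = 0.
Proof.
apply/eqP; rewrite eq_le l2norm_ge0 andbT; apply: l2norm_le => // s us.
by rewrite big1 ?expr0n// => i _; rewrite normc0 expr0n.
Qed.

Lemma l2norm_eq0 x : l2norm x = 0 -> x = 0.
Proof.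
move=> x0; apply: l2P => i; apply: eq0_normc; apply/eqP.
by rewrite eq_le normc_ge0 andbT -x0 coord_le_l2norm.
Qed.

Lemma l2norm_basis k : l2norm (basis k : l2 R I) = 1.
Proof.
apply/eqP; rewrite eq_le; apply/andP; split.
  apply: l2norm_le => // s us.
  rewrite expr1n (bigID (pred1 k)) /= [X in _ + X]big1 ?addr0; last first.
    by move=> i /negbTE ik; rewrite ik normc0 expr0n.
  apply: le_trans (_ : \sum_(i <- s | i == k) 1 <= _).
    by apply: ler_sum => i ->; rewrite normc1 expr1n.
  by rewrite big_const_seq iter_addr_0 count_uniq_mem//; case: (k \in s).
by have := coord_le_l2norm (basis k) k; rewrite /= eqxx normc1.
Qed.

Lemma l2norm_coordP x y : (forall i, normc (x i) <= normc (y i)) ->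
  l2norm x <= l2norm y.
Proof.
move=> xy; apply: l2norm_le (l2norm_ge0 y) _ => s us.
apply: le_trans (finite_le_l2norm y us).
by apply: ler_sum => i _; rewrite lerXn2r ?nnegrE ?normc_ge0.
Qed.

End FiniteSums.

Section InnerProduct.
Context {R : realType} {I : choiceType}.
Implicit Types (x y z : l2 R I) (f g : I -> R).

(** Absolute summability, for which [rsum] is the sum. *)
Definition asummable f := (\esum_(i in [set: I]) (`|f i|)%:E < +oo)%E.

Lemma asummable_le f (a : I -> R) (M : R) : (forall i, `|f i| <= a i) ->
  (forall s : seq I, uniq s -> \sum_(i <- s) a i <= M) -> asummable f.
Proof.
move=> fa aM; apply: le_lt_trans (ltry M); apply: esum_le_finite => // s us.
by apply: le_trans (aM s us); apply: ler_sum.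
Qed.

Lemma asummableD f g : asummable f -> asummable g ->
  asummable (fun i => f i + g i).
Proof.
move=> sf sg; rewrite /asummable.
apply: (@le_lt_trans _ _ (\esum_(i in [set: I]) ((`|f i|)%:E + (`|g i|)%:E))%E).
  by apply: le_esum => i _; rewrite -EFinD lee_fin ler_normD.
by rewrite esumD ?lte_add_pinfty// => i _; rewrite lee_fin.
Qed.

Lemma asummable_ge (f g : I -> R) : (forall i, `|f i| <= `|g i|) ->
  asummable g -> asummable f.
Proof. by move=> fg; apply: le_lt_trans; apply: le_esum => i _; rewrite lee_fin. Qed.

Lemma asummable_esum p : (forall i, 0 <= p i) -> asummable p ->
  (\esum_(i in [set: I]) (p i)%:E)%E \is a fin_num.
Proof.
move=> p0 sp; rewrite ge0_fin_numE; last by apply: esum_ge0 => i _; rewrite lee_fin.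
by apply: le_lt_trans sp; apply: le_esum => i _; rewrite lee_fin ler_norm.
Qed.

Lemma asummableZ (c : R) f : asummable f -> asummable (fun i => c * f i).
Proof.
move=> sf; apply: (@esum_lty_scale _ _ _ (fun i => `|f i|) `|c|) => //.
by move=> i; rewrite normrM.
Qed.

(** The linearity of [rsum] is reduced by this splitting to that of sums of
    nonnegative families. *)
Lemma asummable_split f : asummable f -> exists p q : I -> R,
  [/\ forall i, 0 <= p i, forall i, 0 <= q i, asummable p, asummable q &
      f = (fun i => p i - q i)].
Proof.
move=> sf; exists (fun i => Num.max (f i) 0), (fun i => Num.max (- f i) 0); split.
- by move=> i; rewrite le_max lexx orbT.
- by move=> i; rewrite le_max lexx orbT.
- apply: asummable_ge sf => i; rewrite ger0_norm ?le_max ?lexx ?orbT//.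
  by rewrite ge_max normr_ge0 ler_norm.
- apply: asummable_ge sf => i; rewrite ger0_norm ?le_max ?lexx ?orbT//.
  by rewrite ge_max normr_ge0 -normrN ler_norm.
- by apply/funext => i; case: (leP (f i) 0); case: (leP (- f i) 0); lra.
Qed.

Lemma rsum_sub (p q : I -> R) : (forall i, 0 <= p i) -> (forall i, 0 <= q i) ->
  asummable p -> asummable q ->
  rsum (fun i => p i - q i) = fine (\esum_(i in [set: I]) (p i)%:E)%E -
                              fine (\esum_(i in [set: I]) (q i)%:E)%E.
Proof.
move=> p0 q0 sp sq; rewrite /rsum.
have -> : EFin \o (fun i => p i - q i) = ((EFin \o p) \- (EFin \o q))%E by [].
rewrite esumB//; try by move=> i _; rewrite lee_fin.
by rewrite fineB ?asummable_esum.
Qed.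

Lemma rsumD f g : asummable f -> asummable g ->
  rsum (fun i => f i + g i) = rsum f + rsum g.
Proof.
move=> /asummable_split[p [q [p0 q0 sp sq ->]]].
move=> /asummable_split[p' [q' [p'0 q'0 sp' sq' ->]]].
have -> : (fun i => p i - q i + (p' i - q' i)) =
    (fun i => (p i + p' i) - (q i + q' i)) by apply/funext => i; lra.
have ED (u v : I -> R) : (forall i, 0 <= u i) -> (forall i, 0 <= v i) ->
    asummable u -> asummable v ->
    fine (\esum_(i in [set: I]) (u i + v i)%:E)%E =
    fine (\esum_(i in [set: I]) (u i)%:E)%E +
    fine (\esum_(i in [set: I]) (v i)%:E)%E.
  move=> u0 v0 su sv; under eq_esum do rewrite EFinD.
  rewrite esumD; try by move=> i _; rewrite lee_fin.
  by rewrite fineD// asummable_esum.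
have [pp' qq'] : (forall i, 0 <= p i + p' i) /\ (forall i, 0 <= q i + q' i).
  by split=> i; rewrite addr_ge0.
rewrite (rsum_sub pp' qq' (asummableD sp sp') (asummableD sq sq')).
rewrite (ED _ _ p0 p'0 sp sp') (ED _ _ q0 q'0 sq sq').
by rewrite (rsum_sub p0 q0 sp sq) (rsum_sub p'0 q'0 sp' sq') opprD addrACA.
Qed.

Lemma fine_esumZ (c : R) (p : I -> R) : 0 <= c -> (forall i, 0 <= p i) ->
  asummable p -> fine (\esum_(i in [set: I]) (c * p i)%:E)%E =
    c * fine (\esum_(i in [set: I]) (p i)%:E)%E.
Proof.
have le_ (d : R) q : 0 <= d -> (forall i, 0 <= q i) -> asummable q ->
    fine (\esum_(i in [set: I]) (d * q i)%:E)%E <=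
    d * fine (\esum_(i in [set: I]) (q i)%:E)%E.
  move=> d0 q0 sq; have fq := asummable_esum q0 sq.
  have dq0 i : 0 <= d * q i by rewrite mulr_ge0.
  have fdq := asummable_esum dq0 (asummableZ d sq).
  rewrite -lee_fin fineK//; apply: esum_le_finite => // s us.
  rewrite -mulr_sumr ler_wpM2l// -lee_fin fineK//.
  exact: finite_le_esum.
rewrite le_eqVlt => /orP[/eqP <- p0 sp|c0 p0 sp].
  by rewrite mul0r esum1// => i _; rewrite mul0r.
apply/eqP; rewrite eq_le le_ ?(ltW c0)//=.
rewrite -ler_pdivlMl//.
have := le_ c^-1 (fun i => c * p i) _ _ (asummableZ c sp).
under eq_esum do rewrite mulrA mulVf ?gt_eqF// mul1r.
apply; first by rewrite invr_ge0 ltW.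
by move=> i; rewrite mulr_ge0// ltW.
Qed.

Lemma rsum_ge0 p : (forall i, 0 <= p i) -> asummable p ->
  rsum p = fine (\esum_(i in [set: I]) (p i)%:E)%E.
Proof.
move=> p0 sp.
have s0 : asummable (fun=> 0 : R).
  by rewrite /asummable esum1// => i _; rewrite normr0.
have -> : p = (fun i => p i - 0) by apply/funext => i; rewrite subr0.
by rewrite rsum_sub// [X in _ - fine X]esum1//= subr0; congr fine; apply: eq_esum => i _; rewrite subr0.
Qed.

Lemma rsumZ (c : R) f : asummable f -> rsum (fun i => c * f i) = c * rsum f.
Proof.
move=> /asummable_split[p [q [p0 q0 sp sq ->]]].
rewrite (rsum_sub p0 q0 sp sq).
have [c0|c0] := leP 0 c.
  have -> : (fun i => c * (p i - q i)) = (fun i => c * p i - c * q i).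
    by apply/funext => i; rewrite mulrBr.
  have [cp cq] : (forall i, 0 <= c * p i) /\ (forall i, 0 <= c * q i).
    by split=> i; rewrite mulr_ge0.
  rewrite (rsum_sub cp cq (asummableZ c sp) (asummableZ c sq)).
  by rewrite (fine_esumZ c0 p0 sp) (fine_esumZ c0 q0 sq) mulrBr.
have d0 : 0 <= - c by rewrite oppr_ge0 ltW.
have -> : (fun i => c * (p i - q i)) = (fun i => - c * q i - - c * p i).
  by apply/funext => i; lra.
have [dp dq] : (forall i, 0 <= - c * p i) /\ (forall i, 0 <= - c * q i).
  by split=> i; rewrite mulr_ge0.
rewrite (rsum_sub dq dp (asummableZ (- c) sq) (asummableZ (- c) sp)).
by rewrite (fine_esumZ d0 p0 sp) (fine_esumZ d0 q0 sq); ring.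
Qed.

Lemma rsumN f : asummable f -> rsum (fun i => - f i) = - rsum f.
Proof.
move=> sf; rewrite -mulN1r -rsumZ//; congr rsum.
by apply/funext => i; rewrite mulN1r.
Qed.

Definition csummable (u : I -> R[i]) := asummable (fun i => normc (u i)).

Lemma csummable_Re u : csummable u -> asummable (fun i => complex.Re (u i)).
Proof.
by apply: asummable_ge => i; rewrite (ger0_norm (normc_ge0 _)) ler_Re_normc.
Qed.

Lemma csummable_Im u : csummable u -> asummable (fun i => complex.Im (u i)).
Proof.
by apply: asummable_ge => i; rewrite (ger0_norm (normc_ge0 _)) ler_Im_normc.
Qed.

Lemma csumD u v : csummable u -> csummable v ->
  csum (fun i => u i + v i) = csum u + csum v.
Proof.
move=> su sv; rewrite /csum; apply/eqP; rewrite eq_complex /=.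
rewrite -(rsumD (csummable_Re su) (csummable_Re sv)).
rewrite -(rsumD (csummable_Im su) (csummable_Im sv)).
apply/andP; split; apply/eqP; congr rsum; apply/funext => i;
  by case: (u i); case: (v i).
Qed.

Lemma csumZ (c : R[i]) u : csummable u ->
  csum (fun i => c * u i) = c * csum u.
Proof.
move=> su; have sR := csummable_Re su; have sI := csummable_Im su.
case: c => a b; rewrite /csum; apply/eqP; rewrite eq_complex /=.
rewrite -(rsumZ a sR) -(rsumZ b sI) -(rsumZ a sI) -(rsumZ b sR).
rewrite -(rsumN (asummableZ b sI)) -(rsumD (asummableZ a sR)); last first.
  by apply: asummable_ge (asummableZ b sI) => i; rewrite normrN.
rewrite -(rsumD (asummableZ a sI) (asummableZ b sR)).
apply/andP; split; apply/eqP; congr rsum; apply/funext => i;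
  by case: (u i) => x y /=; rewrite ?mulrN; lra.
Qed.

Lemma csum_conj u : csummable u -> csum (fun i => (u i)^*) = (csum u)^*.
Proof.
move=> su; rewrite /csum; apply/eqP; rewrite eq_complex /=.
rewrite -(rsumN (csummable_Im su)).
apply/andP; split; apply/eqP; congr rsum; apply/funext => i; by case: (u i).
Qed.

(** Summability of the product, by [2 |a b| <= |a|^2 + |b|^2]. *)
Lemma csummable_dot x y : csummable (fun i => x i * (y i)^*).
Proof.
apply: (@asummable_le _ (fun i => normc (x i) ^+ 2 + normc (y i) ^+ 2)
  (l2norm x ^+ 2 + l2norm y ^+ 2)) => [i|s us].
  rewrite ger0_norm ?normc_ge0// normcM normc_conj.
  have := sqr_ge0 (normc (x i) - normc (y i)); rewrite sqrrB.
  have := mulr_ge0 (normc_ge0 (x i)) (normc_ge0 (y i)); lra.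
by rewrite big_split lerD ?finite_le_l2norm.
Qed.

Lemma dotDl x y z : l2dot (x + y) z = l2dot x z + l2dot y z.
Proof.
rewrite /l2dot -(csumD (csummable_dot x z) (csummable_dot y z)).
by congr csum; apply/funext => i; rewrite -mulrDl.
Qed.

Lemma dotZl (c : R[i]) x y : l2dot (c *: x) y = c * l2dot x y.
Proof.
rewrite /l2dot -(csumZ c (csummable_dot x y)).
by congr csum; apply/funext => i; rewrite mulrA.
Qed.

Lemma dot_conj x y : l2dot y x = (l2dot x y)^*.
Proof.
rewrite /l2dot -(csum_conj (csummable_dot x y)).
by congr csum; apply/funext => i; rewrite rmorphM /= conjCK mulrC.
Qed.

Lemma dotDr x y z : l2dot x (y + z) = l2dot x y + l2dot x z.
Proof. by rewrite dot_conj dotDl rmorphD /= -!dot_conj. Qed.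

Lemma dotZr (c : R[i]) x y : l2dot x (c *: y) = c^* * l2dot x y.
Proof. by rewrite dot_conj dotZl rmorphM /= -dot_conj. Qed.

Lemma dotNl x y : l2dot (- x) y = - l2dot x y.
Proof. by rewrite -scaleN1r dotZl mulN1r. Qed.

Lemma dotNr x y : l2dot x (- y) = - l2dot x y.
Proof. by rewrite dot_conj dotNl rmorphN /= -dot_conj. Qed.

Lemma dotBl x y z : l2dot (x - y) z = l2dot x z - l2dot y z.
Proof. by rewrite dotDl dotNl. Qed.

Lemma dotBr x y z : l2dot x (y - z) = l2dot x y - l2dot x z.
Proof. by rewrite dotDr dotNr. Qed.

Lemma dot_self x : l2dot x x = (l2norm x ^+ 2)%:C.
Proof.
rewrite /l2dot; have -> : (fun i => x i * (x i)^*) = (fun i => (normc (x i) ^+ 2)%:C).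
  by apply/funext => i; rewrite mulc_conj.
have s0 : asummable (fun=> 0 : R).
  by rewrite /asummable esum1// => i _; rewrite normr0.
rewrite /csum /= rsum_ge0; last 2 first.
- by move=> i; exact: sqr_ge0.
- apply: (@asummable_le _ (fun i => normc (x i) ^+ 2) (l2norm x ^+ 2)) => [i|s us].
    by rewrite ger0_norm ?sqr_ge0.
  exact: finite_le_l2norm.
rewrite -l2norm_sqr /=; apply/eqP; rewrite eq_complex /= eqxx /=.
by rewrite rsum_ge0// esum1.
Qed.

Definition re_dot x y : R := complex.Re (l2dot x y).

Lemma l2norm_sqrD x y :
  l2norm (x + y) ^+ 2 = l2norm x ^+ 2 + 2 * re_dot x y + l2norm y ^+ 2.
Proof.
have h (u : l2 R I) : l2norm u ^+ 2 = complex.Re (l2dot u u) by rewrite dot_self.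
rewrite !h /re_dot dotDl !dotDr (dot_conj x y).
by case: (l2dot x x) (l2dot x y) (l2dot y y) => ? ? [? ?] [? ?] /=; lra.
Qed.

Lemma l2norm_sqrZ (c : R[i]) x : l2norm (c *: x) ^+ 2 = (normc c * l2norm x) ^+ 2.
Proof.
have h (u : l2 R I) : (l2norm u ^+ 2)%:C = l2dot u u by rewrite dot_self.
apply: complexI; rewrite h dotZl dotZr mulrA mulc_conj -h -rmorphM exprMn.
by [].
Qed.

Lemma l2normZ (c : R[i]) x : l2norm (c *: x) = normc c * l2norm x.
Proof.
apply/eqP; rewrite -(@eqrXn2 _ 2) ?l2norm_sqrZ//; first exact: l2norm_ge0.
by rewrite mulr_ge0 ?normc_ge0 ?l2norm_ge0.
Qed.

Lemma l2normN x : l2norm (- x) = l2norm x.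
Proof. by rewrite -scaleN1r l2normZ normcNr normc1 mul1r. Qed.

Lemma re_dotZr (r : R) x y : re_dot x (r%:C *: y) = r * re_dot x y.
Proof.
by rewrite /re_dot dotZr conj_real; case: (l2dot x y) => a b /=; lra.
Qed.

(** Cauchy-Schwarz, from the nonnegativity of the norm of
    [|y|^2 x - Re <x, y> y]. *)
Lemma cauchy_schwarz x y : re_dot x y <= l2norm x * l2norm y.
Proof.
have [/l2norm_eq0 ->|y0] := eqVneq (l2norm y) 0.
  by rewrite l2norm0 mulr0 /re_dot -(scale0r x) dotZr rmorph0 mul0r.
have ygt0 : 0 < l2norm y by rewrite lt_def y0 l2norm_ge0.
set d := re_dot x y.
have := sqr_ge0 (l2norm (x + (- (d / l2norm y ^+ 2))%:C *: y)).
rewrite l2norm_sqrD re_dotZr l2normZ normc_real normrN exprMn real_normK ?num_real//.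
rewrite -/d.
have -> : l2norm x ^+ 2 + 2 * (- (d / l2norm y ^+ 2) * d) +
  (d / l2norm y ^+ 2) ^+ 2 * l2norm y ^+ 2 = l2norm x ^+ 2 - d ^+ 2 / l2norm y ^+ 2.
  by field.
rewrite subr_ge0 ler_pdivrMr ?exprn_gt0// -exprMn => h.
apply: le_trans (ler_norm d) _.
rewrite -(@ler_pXn2r _ 2) ?nnegrE ?mulr_ge0 ?l2norm_ge0//.
by rewrite real_normK ?num_real.
Qed.

Lemma l2normD x y : l2norm (x + y) <= l2norm x + l2norm y.
Proof.
rewrite -(@ler_pXn2r _ 2) ?nnegrE ?addr_ge0 ?l2norm_ge0//.
rewrite l2norm_sqrD sqrrD; have := cauchy_schwarz x y; lra.
Qed.

Lemma l2normB x y : l2norm (x - y) <= l2norm x + l2norm y.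
Proof. by rewrite -(l2normN y) l2normD. Qed.

Lemma l2_coord_sum (T : Type) (s : seq T) (F : T -> l2 R I) i :
  (\sum_(t <- s) F t : l2 R I) i = \sum_(t <- s) F t i.
Proof. by elim/big_rec2: _ => // t a b _ <-. Qed.

(** Finitely supported vectors are dense: keep the finitely many coordinates
    that nearly exhaust the sum of squares. *)
Lemma l2_finite_approx x (e : R) : 0 < e -> exists s : seq I,
  uniq s /\ l2norm (x - \sum_(i <- s) x i *: basis i) <= e.
Proof.
move=> e0.
have [s us hs] : exists2 s : seq I, uniq s &
    l2norm x ^+ 2 - e ^+ 2 < \sum_(i <- s) normc (x i) ^+ 2.
  apply: contrapT => hn.
  have : l2norm x ^+ 2 <= l2norm x ^+ 2 - e ^+ 2.
    apply: l2norm_sqr_le => s us; rewrite leNgt; apply/negP => hs.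
    by apply: hn; exists s.
  by have := exprn_gt0 2 e0; lra.
exists s; split=> //; apply: l2norm_le (ltW e0) _ => t ut.
set v := \sum_(i <- s) _.
have vi i : v i = if i \in s then x i else 0.
  rewrite /v l2_coord_sum.
  have -> : \sum_(j <- s) (x j *: basis j : l2 R I) i =
      \sum_(j <- s) (if i == j then x j else 0).
    apply: eq_bigr => j _; rewrite -[LHS]/(x j * (i == j)%:R).
    by case: (i == j); rewrite ?mulr1// mulr0.
  rewrite -big_mkcond /=; case: ifPn => [ins|nins].
    rewrite (big_rem i ins) /= eqxx big1_seq ?addr0// => j /andP[/eqP <-].
    by rewrite mem_rem_uniq// inE eqxx.
  by rewrite big1_seq// => j /andP[/eqP <-]; rewrite (negbTE nins).
have : \sum_(i <- s) normc (x i) ^+ 2 +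
       \sum_(i <- t) normc ((x - v) i) ^+ 2 <= l2norm x ^+ 2.
  have -> : \sum_(i <- t) normc ((x - v) i) ^+ 2 =
      \sum_(i <- [seq i <- t | i \notin s]) normc (x i) ^+ 2.
    rewrite big_filter [in RHS]big_mkcond /=; apply: eq_bigr => i _.
    transitivity (normc (x i - v i) ^+ 2); first by [].
    rewrite vi; case: (i \in s) => /=.
      by rewrite subrr normc0 expr0n.
    by rewrite subr0.
  rewrite -big_cat /=; apply: finite_le_l2norm.
  rewrite cat_uniq us filter_uniq// andbT /=.
  by apply/hasPn => i; rewrite mem_filter => /andP[].
by move: hs; lra.
Qed.

End InnerProduct.

Section Completeness.
Context {R : realType} {I : choiceType}.

(** The coordinatewise limit. On a finite set of indices the sum of squares of
    [y - x m] is compared with that of [x n - x m] for [n] so large that the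
    coordinates of [y - x n] are negligible there. *)
Lemma l2_cauchy_limit (x : nat -> l2 R I) (eps : nat -> R) :
  (forall m n, (m <= n)%N -> l2norm (x n - x m) <= eps m) ->
  (forall e : R, 0 < e -> exists m, eps m <= e) ->
  exists y, forall m, l2norm (y - x m) <= eps m.
Proof.
move=> xeps eps0.
have /choice[y Hy] : forall i, exists w, forall m, normc (w - x m i) <= eps m.
  move=> i; apply: complex_cauchy_limit => // m n mn.
  by apply: le_trans (xeps m n mn); exact: (coord_le_l2norm (x n - x m) i).
have eps_ge0 m : 0 <= eps m by apply: le_trans (xeps m m (leqnn m)); exact: l2norm_ge0.
have dom m (s : seq I) : uniq s -> \sum_(i <- s) normc (y i - x m i) ^+ 2 <= eps m ^+ 2.
  move=> us; set A := \sum_(i <- s) _.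
  apply/ler_addgt0Pr => e e0.
  have [d d0 hd] : exists2 d : R, 0 < d &
      (d * ((size s)%:R * (2 * eps m + 3 * eps 0%N + 1))) <= e.
    set c := _%:R * _.
    have c0 : 0 <= c by rewrite mulr_ge0// !addr_ge0// mulr_ge0.
    exists (e / (c + 1)); first by rewrite divr_gt0// ltr_wpDl.
    by rewrite mulrAC ler_pdivrMr ?ltr_wpDl// ler_wpM2l ?lerDl// ltW.
  have [n0 hn0] : exists n, eps n <= Num.min d 1 / 2.
    by apply: eps0; rewrite divr_gt0// lt_min d0 ltr01.
  pose n := maxn n0 m.
  have yn i : normc (y i - x n i) <= Num.min d 1.
    have -> : y i - x n i = (y i - x n0 i) + (x n0 i - x n i) by rewrite addrA subrK.
    apply: le_trans (normc_triangle _ _) _.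
    have h1 := Hy i n0.
    have h2 : normc (x n0 i - x n i) <= eps n0.
      rewrite normcBr; apply: le_trans (xeps n0 n (leq_maxl _ _)).
      exact: (coord_le_l2norm (x n - x n0) i).
    by move: hn0 h1 h2; set M := Num.min _ _; lra.
  have xnm i : normc (x n i - x m i) <= eps m.
    apply: le_trans (xeps m n (leq_maxr _ _)).
    exact: (coord_le_l2norm (x n - x m) i).
  have term i : normc (y i - x m i) ^+ 2 <=
      normc (x n i - x m i) ^+ 2 + d * (2 * eps m + 3 * eps 0%N + 1).
    have t : normc (y i - x m i) <= normc (y i - x n i) + normc (x n i - x m i).
      by have := normc_triangle (y i - x n i) (x n i - x m i); rewrite addrA subrK.
    have [yd y1] : normc (y i - x n i) <= d /\ normc (y i - x n i) <= 1.
      by split; apply: le_trans (yn i) _; rewrite ge_min lexx ?orbT.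
    apply: le_trans (_ : (normc (y i - x n i) + normc (x n i - x m i)) ^+ 2 <= _).
      by rewrite lerXn2r ?nnegrE ?addr_ge0 ?normc_ge0.
    have p0 := normc_ge0 (y i - x n i); have q0 := normc_ge0 (x n i - x m i).
    have q1 := xnm i; have e00 := eps_ge0 0%N; have em0 := eps_ge0 m.
    move: p0 q0 q1 yd y1; set p := normc (y i - _); set q := normc _ => p0 q0 q1 yd y1.
    have : p * p <= d * 1 by apply: ler_pM.
    have : p * q <= d * eps m by apply: ler_pM.
    have : 0 <= d * eps 0%N by rewrite mulr_ge0// ltW.
    nra.
  apply: le_trans (ler_sum _ (fun i _ => term i)) _.
  rewrite big_split /=; apply: lerD.
    apply: le_trans (finite_le_l2norm (x n - x m) us) _.
    by rewrite lerXn2r ?nnegrE ?l2norm_ge0// xeps// leq_maxr.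
  rewrite big_const_seq iter_addr_0 count_predT -[leLHS]mulr_natl.
  by apply: le_trans hd; rewrite mulrCA.
have sy0 : square_summable (fun i => y i - x 0%N i : R[i]^o).
  by apply: square_summable_finite (dom 0%N).
exists (L2 sy0 + x 0%N) => m; apply: l2norm_le => // s us.
apply: le_trans (dom m s us); rewrite le_eqVlt; apply/orP; left; apply/eqP.
apply: eq_bigr => i _; congr (normc _ ^+ 2).
by rewrite -[LHS]/((y i - x 0%N i) + x 0%N i - x m i) subrK.
Qed.

End Completeness.

(** * Bounded operators and their matrices *)

Section OperatorBounds.
Context {R : realType}.

Section OneOperator.
Context {I J : choiceType}.
Implicit Types T : l2 R I -> l2 R J.

Lemma bounded_opD T x y : bounded_op T -> T (x + y) = T x + T y.
Proof. by case=> lT _; have := lT 1 x y; rewrite !scale1r. Qed.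

Lemma bounded_op0 T : bounded_op T -> T 0 = 0.
Proof.
by move=> bT; apply: (addrI (T 0)); rewrite -bounded_opD// !addr0.
Qed.

Lemma bounded_opZ T c x : bounded_op T -> T (c *: x) = c *: T x.
Proof.
by move=> bT; case: (bT) => lT _; have := lT c x 0; rewrite (bounded_op0 bT) !addr0.
Qed.

Lemma bounded_opB T x y : bounded_op T -> T (x - y) = T x - T y.
Proof.
by move=> bT; rewrite (bounded_opD _ _ bT) -scaleN1r (bounded_opZ _ _ bT) scaleN1r.
Qed.

Lemma bounded_op_sum T (K : Type) (s : seq K) (F : K -> l2 R I) :
  bounded_op T -> T (\sum_(k <- s) F k) = \sum_(k <- s) T (F k).
Proof.
move=> bT; elim: s => [|k s IH]; first by rewrite !big_nil bounded_op0.
by rewrite !big_cons bounded_opD// IH.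
Qed.

Lemma bounded_op_ge0 T : bounded_op T -> exists2 M, 0 <= M & opnorm_le T M.
Proof.
case=> _ [M hM]; exists `|M| => // x; apply: le_trans (hM x) _.
by rewrite ler_wpM2r ?l2norm_ge0// ler_norm.
Qed.

Lemma opnorm_leW T (M N : R) : M <= N -> opnorm_le T M -> opnorm_le T N.
Proof.
move=> MN hM x; apply: le_trans (hM x) _.
by rewrite ler_wpM2r ?l2norm_ge0.
Qed.

Lemma opnorm_leD S T (M N : R) :
  opnorm_le S M -> opnorm_le T N -> opnorm_le (S + T) (M + N).
Proof.
move=> hS hT x; apply: le_trans (l2normD (S x) (T x)) _.
by rewrite mulrDl lerD.
Qed.

Lemma opnorm_leN T (M : R) : opnorm_le T M -> opnorm_le (- T) M.
Proof. by move=> hT x; rewrite -[(- T) x]/(- T x) l2normN. Qed.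

Lemma opnorm_le_distC S T (M : R) : opnorm_le (S - T) M -> opnorm_le (T - S) M.
Proof. by move=> /opnorm_leN; rewrite opprB. Qed.

Lemma opnorm_le_triangle S T U (M N : R) :
  opnorm_le (S - T) M -> opnorm_le (T - U) N -> opnorm_le (S - U) (M + N).
Proof.
move=> hS hT; have -> : S - U = (S - T) + (T - U) by rewrite addrA subrK.
exact: opnorm_leD.
Qed.

Lemma opnorm_leZ T c (M : R) : opnorm_le T M -> opnorm_le (c *: T) (normc c * M).
Proof.
move=> hT x; rewrite -[(c *: T) x]/(c *: T x) l2normZ -mulrA.
by rewrite ler_wpM2l ?normc_ge0.
Qed.

Lemma opnorm_le0 (M : R) : 0 <= M -> opnorm_le (0 : l2 R I -> l2 R J) M.
Proof. by move=> M0 x; rewrite -[(0 : _ -> _) x]/(0) l2norm0 mulr_ge0 ?l2norm_ge0. Qed.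

Lemma bounded_op_zero : bounded_op (0 : l2 R I -> l2 R J).
Proof.
split; last by exists 0; exact: opnorm_le0.
by move=> c x y; rewrite -[RHS]/(c *: 0 + 0) scaler0 addr0.
Qed.

Lemma bounded_op_add S T : bounded_op S -> bounded_op T -> bounded_op (S + T).
Proof.
move=> [lS [M hM]] [lT [N hN]]; split; last by exists (M + N); exact: opnorm_leD.
move=> c x y; rewrite -[LHS]/(S (c *: x + y) + T (c *: x + y)) lS lT.
by rewrite -[(S + T) x]/(S x + T x) -[(S + T) y]/(S y + T y) scalerDr addrACA.
Qed.

Lemma bounded_op_scale c T : bounded_op T -> bounded_op (c *: T).
Proof.
move=> [lT [N hN]]; split; last by exists (normc c * N); exact: opnorm_leZ.
move=> d x y; rewrite -[LHS]/(c *: T (d *: x + y)) lT.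
by transitivity (d *: (c *: T x) + c *: T y) => //; rewrite scalerDr !scalerA mulrC.
Qed.

(** A bounded operator is determined by its matrix entries, since the finitely
    supported vectors are dense. *)
Lemma bounded_op_basisP S T : bounded_op S -> bounded_op T ->
  (forall i, S (basis i) = T (basis i)) -> S = T.
Proof.
move=> bS bT ST; apply/funext => x; apply/eqP; rewrite -subr_eq0; apply/eqP.
apply: l2norm_eq0; apply/eqP; rewrite eq_le l2norm_ge0 andbT.
have [M M0 hM] := bounded_op_ge0 bS; have [N N0 hN] := bounded_op_ge0 bT.
apply/ler_addgt0Pr => e e0; rewrite add0r.
have d0 : 0 < e / (M + N + 1) by rewrite divr_gt0// ltr_wpDl// addr_ge0.
have [s [us hs]] := l2_finite_approx x d0.
set v := \sum_(i <- s) _ in hs.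
have vE : S v = T v.
  rewrite (bounded_op_sum _ _ bS) (bounded_op_sum _ _ bT).
  by apply: eq_bigr => i _; rewrite (bounded_opZ _ _ bS) (bounded_opZ _ _ bT) ST.
have -> : S x - T x = S (x - v) - T (x - v).
  by rewrite (bounded_opB _ _ bS) (bounded_opB _ _ bT) vE opprB addrA subrK.
apply: le_trans (l2normB _ _) _.
apply: le_trans (lerD (hM _) (hN _)) _.
rewrite -mulrDl.
apply: le_trans (ler_wpM2l (addr_ge0 M0 N0) hs) _.
by rewrite mulrA ler_pdivrMr ?ltr_wpDl ?addr_ge0// mulrC ler_wpM2l ?lerDl// ltW.
Qed.

(** The limit is taken vector by vector; linearity and the error bounds pass to
    it. *)
Lemma operator_cauchy_limit (T_ : nat -> l2 R I -> l2 R J) (eps : nat -> R) :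
  (forall n, bounded_op (T_ n)) ->
  (forall m n, (m <= n)%N -> opnorm_le (T_ n - T_ m) (eps m)) ->
  (forall e : R, 0 < e -> exists m, eps m <= e) ->
  exists T, bounded_op T /\ forall m, opnorm_le (T - T_ m) (eps m).
Proof.
move=> bT Teps eps0.
have [i0|noI] := pselect (exists i : I, True); last first.
  exists 0; split; first exact: bounded_op_zero.
  move=> m x; have -> : x = 0 by apply: l2P => i; case: noI; exists i.
  by rewrite l2norm0 mulr0 -[(_ - _) 0]/(0 - T_ m 0) bounded_op0// subrr l2norm0.
have eps_ge0 m : 0 <= eps m.
  case: i0 => i _; have := Teps m m (leqnn m) (basis i).
  by rewrite l2norm_basis mulr1; apply: le_trans; exact: l2norm_ge0.
have /choice[T HT] : forall x, exists y, forall m,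
    l2norm (y - T_ m x) <= eps m * l2norm x.
  move=> x; apply: l2_cauchy_limit => [m n mn|e e0]; first exact: Teps.
  have [m hm] := eps0 (e / (l2norm x + 1)) (divr_gt0 e0 (ltr_wpDl (l2norm_ge0 x) ltr01)).
  exists m; apply: le_trans (ler_wpM2r (l2norm_ge0 x) hm) _.
  rewrite mulrAC ler_pdivrMr ?ltr_wpDl ?l2norm_ge0//.
  by rewrite ler_wpM2l ?lerDl// ltW.
exists T; split; last by move=> m x; exact: HT.
split; last first.
  have [M M0 hM] := bounded_op_ge0 (bT 0%N).
  exists (eps 0%N + M) => x; rewrite mulrDl -[T x](subrK (T_ 0%N x)).
  by apply: le_trans (l2normD _ _) _; rewrite lerD.
move=> c x y; apply/eqP; rewrite -subr_eq0; apply/eqP.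
apply: l2norm_eq0; apply/eqP; rewrite eq_le l2norm_ge0 andbT.
apply/ler_addgt0Pr => e e0; rewrite add0r.
set z := c *: x + y.
set K := l2norm z + (normc c * l2norm x + l2norm y).
have K0 : 0 <= K by rewrite !addr_ge0 ?mulr_ge0 ?l2norm_ge0 ?normc_ge0.
have [m hm] := eps0 (e / (K + 1)) (divr_gt0 e0 (ltr_wpDl K0 ltr01)).
have -> : T z - (c *: T x + T y) =
    (T z - T_ m z) - (c *: (T x - T_ m x) + (T y - T_ m y)).
  rewrite /z (bounded_opD _ _ (bT m)) (bounded_opZ _ _ (bT m)) scalerBr.
  rewrite addrACA -[- T_ m y]opprK -[- (c *: _)]opprK -opprD opprB !opprK.
  by rewrite addrA subrK.
apply: le_trans (l2normB _ _) _.
apply: le_trans (lerD (HT z m) (l2normD _ _)) _; rewrite l2normZ.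
have h1 := HT x m; have h2 := HT y m.
apply: le_trans (_ : eps m * K <= _); last first.
  apply: le_trans (ler_wpM2r K0 hm) _.
  by rewrite mulrAC ler_pdivrMr ?ltr_wpDl// ler_wpM2l ?lerDl// ltW.
rewrite /K mulrDr lerD2l mulrDr; apply: lerD => //.
by rewrite mulrCA ler_wpM2l ?normc_ge0.
Qed.

Lemma op_cvgP (T_ : nat -> l2 R I -> l2 R J) T :
  op_cvg T_ T <->
  forall e : R, 0 < e -> exists N, forall n, (N <= n)%N -> opnorm_le (T_ n - T) e.
Proof.
split=> h e e0; have := h e e0.
  by case=> N _ HN; exists N => n Nn; exact: HN.
by case=> N HN; exists N => // n /= Nn; exact: HN.
Qed.

End OneOperator.

Lemma opnorm_le_comp (I J K : choiceType) (S : l2 R J -> l2 R K)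
    (T : l2 R I -> l2 R J) (M N : R) :
  0 <= M -> opnorm_le S M -> opnorm_le T N -> opnorm_le (S \o T) (M * N).
Proof.
move=> M0 hS hT x; apply: le_trans (hS (T x)) _.
by rewrite -mulrA ler_wpM2l.
Qed.

Lemma bounded_op_comp (I J K : choiceType) (S : l2 R J -> l2 R K)
    (T : l2 R I -> l2 R J) :
  bounded_op S -> bounded_op T -> bounded_op (S \o T).
Proof.
move=> bS bT; have [M M0 hM] := bounded_op_ge0 bS; have [N N0 hN] := bounded_op_ge0 bT.
split; last by exists (M * N); exact: opnorm_le_comp.
by move=> c x y /=; case: bT => -> _; case: bS => -> _.
Qed.

Lemma opnorm_le_id (I : choiceType) : opnorm_le (id : l2 R I -> l2 R I) 1.
Proof. by move=> x; rewrite mul1r. Qed.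

Lemma bounded_op_id (I : choiceType) : bounded_op (id : l2 R I -> l2 R I).
Proof. by split; [move=> c x y | exists 1; exact: opnorm_le_id]. Qed.

End OperatorBounds.

Section OperatorAlgebra.
Context {R : realType}.
Local Notation Hp := (l2 R nat).

Definition bounded_pred : pred (Hp -> Hp) := fun T => `[< bounded_op T >].

Fact bounded_pred_submod : submod_closed bounded_pred.
Proof.
split; first exact/asboolP/bounded_op_zero.
move=> c S T /asboolP bS /asboolP bT; apply/asboolP.
by apply: bounded_op_add => //; exact: bounded_op_scale.
Qed.

HB.instance Definition _ :=
  GRing.isSubmodClosed.Build _ _ bounded_pred bounded_pred_submod.

Record bop := Bop { bop_fun :> Hp -> Hp; bop_pred : bounded_pred bop_fun }.

HB.instance Definition _ := [isSub for bop_fun].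
HB.instance Definition _ := [Choice of bop by <:].
HB.instance Definition _ := [SubChoice_isSubLmodule of bop by <:].

Implicit Types x y z : bop.

Lemma bopP x : bounded_op x.
Proof. exact/asboolP/(bop_pred x). Qed.

Definition mk_bop (T : Hp -> Hp) (bT : bounded_op T) : bop :=
  Bop (introT (asboolP _) bT).

Definition bop_one : bop := mk_bop (bounded_op_id nat).
Definition bop_mul x y : bop := mk_bop (bounded_op_comp (bopP x) (bopP y)).

Lemma bop_ext x y : (forall v, x v = y v) -> x = y.
Proof. by move=> xy; apply/val_inj/funext. Qed.

Fact bop_mulA : associative bop_mul. Proof. by move=> x y z; exact: bop_ext. Qed.
Fact bop_mul1 : left_id bop_one bop_mul. Proof. by move=> x; exact: bop_ext. Qed.
Fact bop_mulr1 : right_id bop_one bop_mul. Proof. by move=> x; exact: bop_ext. Qed.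
Fact bop_mulDl : left_distributive bop_mul +%R.
Proof. by move=> x y z; exact: bop_ext. Qed.
Fact bop_mulDr : right_distributive bop_mul +%R.
Proof. by move=> x y z; apply: bop_ext => v; rewrite /= (bounded_opD _ _ (bopP x)). Qed.
Fact bop_one_neq0 : bop_one != 0.
Proof.
apply/eqP => /(congr1 (fun x : bop => l2norm (x (basis 0%N)))).
by rewrite -[(0 : bop) _]/(0) l2norm0 /= l2norm_basis; exact/eqP/oner_neq0.
Qed.

HB.instance Definition _ := GRing.Zmodule_isNzRing.Build bop
  bop_mulA bop_mul1 bop_mulr1 bop_mulDl bop_mulDr bop_one_neq0.

Fact bop_scaleAl (c : R[i]) x y : c *: (x * y) = (c *: x) * y.
Proof. exact: bop_ext. Qed.
HB.instance Definition _ := GRing.Lmodule_isLalgebra.Build R[i] bop bop_scaleAl.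
Fact bop_scaleAr (c : R[i]) x y : c *: (x * y) = x * (c *: y).
Proof. by apply: bop_ext => v; rewrite /= (bounded_opZ _ _ (bopP x)). Qed.
HB.instance Definition _ := GRing.Lalgebra_isAlgebra.Build R[i] bop bop_scaleAr.

Lemma bop_mulE x y v : (x * y) v = x (y v). Proof. by []. Qed.
Lemma bop_oneE v : (1 : bop) v = v. Proof. by []. Qed.
Lemma bop_subE x y v : (x - y) v = x v - y v. Proof. by []. Qed.
Lemma bop_scaleE c x v : (c *: x) v = c *: x v. Proof. by []. Qed.

Definition opn x : R := inf [set M | 0 <= M /\ opnorm_le x M].

Lemma opn_has x : has_inf [set M | 0 <= M /\ opnorm_le x M].
Proof.
split; last by exists 0 => M [].
by have [M M0 hM] := bounded_op_ge0 (bopP x); exists M.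
Qed.

Lemma opn_ge0 x : 0 <= opn x.
Proof. by apply: lb_le_inf; [case: (opn_has x) | move=> M []]. Qed.

Lemma opn_min x (M : R) : 0 <= M -> opnorm_le x M -> opn x <= M.
Proof. by move=> M0 hM; apply: ge_inf; [case: (opn_has x) | split]. Qed.

(** The infimum defining the norm is attained. *)
Lemma opn_bound x v : l2norm (x v) <= opn x * l2norm v.
Proof.
have [v0|v0] := eqVneq (l2norm v) 0.
  by rewrite (l2norm_eq0 v0) (bounded_op0 (bopP x)) l2norm0 mulr0.
have vgt0 : 0 < l2norm v by rewrite lt_def v0 l2norm_ge0.
rewrite -ler_pdivrMr//; apply: lb_le_inf; first by case: (opn_has x).
by move=> M [M0 hM]; rewrite ler_pdivrMr.
Qed.

Lemma opn_leP x (M : R) : 0 <= M -> (opn x <= M <-> opnorm_le x M).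
Proof.
move=> M0; split; last exact: opn_min.
by move=> xM; apply: opnorm_leW xM _; exact: opn_bound.
Qed.

Lemma opnD x y : opn (x + y) <= opn x + opn y.
Proof.
apply: opn_min; first by rewrite addr_ge0 ?opn_ge0.
by apply: opnorm_leD; exact: opn_bound.
Qed.

Lemma opnM x y : opn (x * y) <= opn x * opn y.
Proof.
apply: opn_min; first by rewrite mulr_ge0 ?opn_ge0.
by apply: opnorm_le_comp; [exact: opn_ge0 | exact: opn_bound | exact: opn_bound].
Qed.

Lemma opnZ c x : opn (c *: x) <= normc c * opn x.
Proof.
apply: opn_min; first by rewrite mulr_ge0 ?normc_ge0 ?opn_ge0.
by apply: opnorm_leZ; exact: opn_bound.
Qed.

Lemma opnN x : opn (- x) = opn x.
Proof.
suff h y : opn (- y) <= opn y by apply/eqP; rewrite eq_le h -{1}[x]opprK h.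
by apply: opn_min (opn_ge0 _) _; apply: opnorm_leN; exact: opn_bound.
Qed.

Lemma opnB x y : opn (x - y) <= opn x + opn y.
Proof. by rewrite -(opnN y) opnD. Qed.

Lemma opn_distC x y : opn (x - y) = opn (y - x).
Proof. by rewrite -opprB opnN. Qed.

Lemma opn1 : opn 1 <= 1.
Proof. by apply: opn_min => //; exact: opnorm_le_id. Qed.

Lemma opn0 : opn 0 = 0.
Proof. by apply/eqP; rewrite eq_le opn_ge0 andbT; apply: opn_min => //; exact: opnorm_le0. Qed.

Lemma opnX x n : opn (x ^+ n) <= opn x ^+ n.
Proof.
elim: n => [|n IH]; first by rewrite !expr0 opn1.
by rewrite !exprS (le_trans (opnM _ _))// ler_wpM2l ?opn_ge0.
Qed.

Lemma opn_eq0 x : opn x = 0 -> x = 0.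
Proof.
move=> x0; apply: bop_ext => v; apply: l2norm_eq0; apply/eqP.
by rewrite eq_le l2norm_ge0 andbT; have := opn_bound x v; rewrite x0 mul0r.
Qed.

Lemma bop_cauchy_limit (x : nat -> bop) (eps : nat -> R) :
  (forall m n, (m <= n)%N -> opn (x n - x m) <= eps m) ->
  (forall e : R, 0 < e -> exists m, eps m <= e) ->
  exists y, forall m, opn (y - x m) <= eps m.
Proof.
move=> xeps eps0.
have eps_ge0 m : 0 <= eps m by apply: le_trans (xeps m m (leqnn m)); exact: opn_ge0.
have [T [bT hT]] := @operator_cauchy_limit R nat nat (fun n => x n) eps
  (fun n => bopP (x n)) (fun m n mn => opnorm_leW (xeps m n mn) (opn_bound _)) eps0.
by exists (mk_bop bT) => m; exact: (opn_min (x := mk_bop bT - x m) (eps_ge0 m) (hT m)).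
Qed.

Definition entry x i j : R[i] := x (basis j) i.

Lemma entry_le x i j : normc (entry x i j) <= opn x.
Proof.
apply: le_trans (coord_le_l2norm _ _) _.
by apply: le_trans (opn_bound _ _) _; rewrite l2norm_basis mulr1.
Qed.

Lemma entryD x y i j : entry (x + y) i j = entry x i j + entry y i j.
Proof. by []. Qed.
Lemma entryB x y i j : entry (x - y) i j = entry x i j - entry y i j.
Proof. by []. Qed.
Lemma entryZ c x i j : entry (c *: x) i j = c * entry x i j.
Proof. by []. Qed.

Lemma entryP x y : (forall i j, entry x i j = entry y i j) -> x = y.
Proof.
move=> xy; apply/val_inj/(bounded_op_basisP (bopP x) (bopP y)) => j.
by apply: l2P => i; exact: xy.
Qed.

End OperatorAlgebra.
Arguments bop R : clear implicits.

(** * Spectral theory of a self-adjoint element *)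

Section CstarTheory.
Context {R : realType}.
Variable A : set (l2 R nat -> l2 R nat).
Hypotheses (A_cstar : Cstar_subalgebra A) (A_id : A id).
Implicit Types (a r x y : bop R) (z : R[i]).

Lemma cstar_bounded T : A T -> bounded_op T.
Proof. by case: A_cstar => h _ _ _ _; exact: h. Qed.

Lemma cstar_one : A (1 : bop R). Proof. exact: A_id. Qed.

Lemma cstar_zero : A (0 : bop R).
Proof. by case: A_cstar => _ [h _] _ _ _. Qed.

Lemma cstarD x y : A x -> A y -> A (x + y).
Proof. by case: A_cstar => _ [_ h] _ _ _; exact: h. Qed.

Lemma cstarZ c x : A x -> A (c *: x).
Proof. by case: A_cstar => _ _ [h _] _ _; exact: h. Qed.

Lemma cstarM x y : A x -> A y -> A (x * y).
Proof. by case: A_cstar => _ _ [_ h] _ _; exact: h. Qed.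

Lemma cstarN x : A x -> A (- x).
Proof. by move=> Ax; rewrite -scaleN1r; exact: cstarZ. Qed.

Lemma cstarB x y : A x -> A y -> A (x - y).
Proof. by move=> Ax Ay; apply: cstarD => //; exact: cstarN. Qed.

Lemma cstarX x n : A x -> A (x ^+ n).
Proof.
move=> Ax; elim: n => [|n IH]; first by rewrite expr0; exact: cstar_one.
by rewrite exprS; exact: cstarM.
Qed.

Lemma cstar_sum (K : Type) (s : seq K) (F : K -> bop R) :
  (forall k, A (F k)) -> A (\sum_(k <- s) F k).
Proof.
move=> AF; elim: s => [|k s IH]; first by rewrite big_nil; exact: cstar_zero.
by rewrite big_cons; exact: cstarD.
Qed.

Lemma cstar_closed x (x_ : nat -> bop R) : (forall n, A (x_ n)) ->
  (forall e : R, 0 < e -> exists N, forall n, (N <= n)%N -> opn (x_ n - x) <= e) ->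
  A x.
Proof.
move=> Ax hx; case: A_cstar => _ _ _ _; apply; [exact: Ax | exact: bopP |].
apply/op_cvgP => e e0; have [N HN] := hx e e0; exists N => n Nn.
exact/(opn_leP (x_ n - x) (ltW e0))/HN.
Qed.

Lemma horner_algZ a c (p : {poly R[i]}) : horner_alg a (c *: p) = c *: horner_alg a p.
Proof. by rewrite -mul_polyC rmorphM /= horner_algC -scalerAl mul1r. Qed.

Lemma cstar_horner_alg a (p : {poly R[i]}) : A a -> A (horner_alg a p).
Proof.
move=> Aa; rewrite -[p]coefK poly_def linear_sum /=; apply: cstar_sum => i.
by rewrite horner_algZ rmorphXn /= horner_algX; apply/cstarZ/cstarX.
Qed.

Definition unit_in x := exists y, [/\ A y, x * y = 1 & y * x = 1].

Lemma unit_inM x y : unit_in x -> unit_in y -> unit_in (x * y).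
Proof.
move=> [x' [Ax' xx' x'x]] [y' [Ay' yy' y'y]]; exists (y' * x').
split; first exact: cstarM.
  by rewrite mulrA -(mulrA x) yy' mulr1.
by rewrite mulrA -(mulrA y') x'x mulr1.
Qed.

Lemma unit_inZ c x : c != 0 -> unit_in x -> unit_in (c *: x).
Proof.
move=> c0 [x' [Ax' xx' x'x]]; exists (c^-1 *: x'); split; first exact: cstarZ.
  by rewrite -scalerAl -scalerAr scalerA mulfV// scale1r.
by rewrite -scalerAl -scalerAr scalerA mulVf// scale1r.
Qed.

Lemma opn_small_eq0 x : (forall e : R, 0 < e -> opn x <= e) -> x = 0.
Proof.
move=> h; apply: opn_eq0; apply/eqP; rewrite eq_le opn_ge0 andbT.
by apply/ler_addgt0Pr => e e0; rewrite add0r; exact: h.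
Qed.

Lemma geometric_small (q C e : R) : 0 <= q < 1 -> 0 < e ->
  exists n, C * q ^+ n <= e.
Proof.
move=> /andP[q0 q1] e0.
have : (fun n => C * q ^+ n) @ \oo --> (C * 0 : R).
  by apply: cvgM; [exact: cvg_cst | apply: cvg_expr; rewrite ger0_norm].
rewrite mulr0 => /cvgrPdist_le /(_ e e0) [n _ hn]; exists n.
by have := hn n (leqnn n); rewrite sub0r normrN; apply: le_trans; exact: ler_norm.
Qed.

(** The partial sums of the geometric series are Cauchy in norm, so that the
    inverse they converge to stays in the closed algebra. *)
Lemma unit_in_neumann r : A r -> opn r < 1 -> unit_in (1 - r).
Proof.
move=> Ar; set q := opn r => q1; have q0 : 0 <= q := opn_ge0 r.
have q1' : 0 < 1 - q by rewrite subr_gt0.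
pose s n : bop R := \sum_(k < n) r ^+ k.
have seps m n : (m <= n)%N -> opn (s n - s m) <= (1 - q)^-1 * q ^+ m.
  elim: n => [|n IH].
    rewrite leqn0 => /eqP ->; rewrite subrr opn0 mulr_ge0 ?exprn_ge0//.
    by rewrite invr_ge0 ltW.
  rewrite leq_eqVlt => /orP[/eqP ->|mn].
    by rewrite subrr opn0 mulr_ge0 ?exprn_ge0// invr_ge0 ltW.
  suff h d : opn (s (m + d)%N - s m) <= (1 - q ^+ d) * ((1 - q)^-1 * q ^+ m).
    have -> : n.+1 = (m + (n.+1 - m))%N by rewrite subnKC// ltnW.
    apply: le_trans (h _) _; rewrite ler_piMl ?mulr_ge0 ?exprn_ge0 ?invr_ge0 ?(ltW q1')//.
    by rewrite lerBlDr lerDl exprn_ge0.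
  elim: d => [|d IHd]; first by rewrite addn0 subrr opn0 expr0 subrr mul0r.
  have -> : s (m + d.+1)%N - s m = (s (m + d)%N - s m) + r ^+ (m + d).
    by rewrite addnS /s big_ord_recr /= addrAC.
  apply: le_trans (opnD _ _) _; apply: le_trans (lerD IHd (opnX _ _)) _.
  rewrite -/q exprD exprS le_eqVlt; apply/orP; left; apply/eqP.
  by field; rewrite gt_eqF.
have [|y hy] := bop_cauchy_limit seps.
  by move=> e e0; apply: geometric_small; rewrite ?q0.
have As n : A (s n) by apply: cstar_sum => k; exact: cstarX.
have sS n : s n.+1 = s n + r ^+ n by rewrite /s big_ord_recr.
have s0 : s 0%N = 0 by rewrite /s big_ord0.
have sl n : (1 - r) * s n = 1 - r ^+ n.
  elim: n => [|n IH]; first by rewrite s0 mulr0 expr0 subrr.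
  by rewrite sS mulrDr IH mulrBl mul1r exprS addrA subrK.
have sr n : s n * (1 - r) = 1 - r ^+ n.
  elim: n => [|n IH]; first by rewrite s0 mul0r expr0 subrr.
  by rewrite sS mulrDl IH mulrBr mulr1 exprSr addrA subrK.
have lim u : (forall n, opn (u - (1 - r ^+ n)) <= opn (1 - r) * ((1 - q)^-1 * q ^+ n)) ->
    u = 1.
  move=> hu; apply/eqP; rewrite -subr_eq0; apply/eqP; apply: opn_small_eq0 => e e0.
  have [n hn] := @geometric_small q (opn (1 - r) * (1 - q)^-1 + 1) e
    (introT andP (conj q0 q1)) e0.
  apply: le_trans hn.
  have -> : u - 1 = (u - (1 - r ^+ n)) - r ^+ n by rewrite opprB [r ^+ n - 1]addrC addrA addrK.
  apply: le_trans (opnB _ _) _; rewrite mulrDl mul1r -mulrA.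
  by rewrite lerD// opnX.
exists y; split.
- apply: (cstar_closed As) => e e0.
  have [|n hn] := @geometric_small q (1 - q)^-1 e _ e0; first by rewrite q0.
  exists n => m nm; rewrite opn_distC; apply: le_trans (hy m) _; apply: le_trans hn.
  by rewrite ler_wpM2l ?invr_ge0 ?(ltW q1')// ler_wiXn2l// ltW.
- apply: lim => n; rewrite -sl -mulrBr.
  by apply: le_trans (opnM _ _) _; rewrite ler_wpM2l ?opn_ge0.
- apply: lim => n; rewrite -sr -mulrBl.
  by apply: le_trans (opnM _ _) _; rewrite mulrC ler_wpM2l ?opn_ge0.
Qed.

Lemma unit_in_near_scalar x c : A x -> opn (x - c%:A) < normc c -> unit_in x.
Proof.
move=> Ax xc.
have cgt0 : 0 < normc c by apply: le_lt_trans xc; exact: opn_ge0.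
have c0 : c != 0 by rewrite -normc_eq0 gt_eqF.
have -> : x = c *: (1 - c^-1 *: (c%:A - x)).
  by rewrite scalerBr scalerA mulfV// scale1r opprB addrC subrK.
apply: unit_inZ => //; apply: unit_in_neumann.
  by apply/cstarZ/cstarB => //; apply/cstarZ/cstar_one.
apply: le_lt_trans (opnZ _ _) _.
by rewrite normcV opn_distC mulrC ltr_pdivrMr// mul1r.
Qed.

Lemma unit_in_open x : A x -> unit_in x -> exists2 d : R, 0 < d &
  forall y, A y -> opn (y - x) < d -> unit_in y.
Proof.
move=> Ax [x' [Ax' xx' x'x]]; exists (opn x' + 1)^-1.
  by rewrite invr_gt0 ltr_wpDl ?opn_ge0.
move=> y Ay yx.
have -> : y = x * (1 - x' * (x - y)).
  by rewrite mulrBr mulr1 mulrA xx' mul1r opprB addrC subrK.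
apply: unit_inM; first by exists x'; split.
apply: unit_in_neumann; first by apply/cstarM/cstarB.
apply: le_lt_trans (opnM _ _) _; rewrite opn_distC.
have x1 : 0 < opn x' + 1 by rewrite ltr_wpDl ?opn_ge0.
apply: le_lt_trans (_ : (opn x' + 1) * opn (y - x) < 1).
  by rewrite ler_wpM2r ?opn_ge0// lerDl.
by rewrite mulrC -ltr_pdivlMr// div1r.
Qed.

Lemma spectrumE a (z : R[i]) : spectrum A a z <-> ~ unit_in (a - z%:A).
Proof.
have mulE y : (a - z%:A) * y = 1 <-> (bop_fun a - z *: id) \o bop_fun y = id.
  by split=> [/(congr1 (@bop_fun R))//|h]; apply/val_inj.
have mulE' y : y * (a - z%:A) = 1 <-> bop_fun y \o (bop_fun a - z *: id) = id.
  by split=> [/(congr1 (@bop_fun R))//|h]; apply/val_inj.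
split=> h.
  by move=> [y [Ay y1 y2]]; apply: h; exists y; split=> //; [exact/mulE | exact/mulE'].
move=> [b [Ab b1 b2]]; apply: h; exists (mk_bop (cstar_bounded Ab)).
by split=> //; [exact/mulE | exact/mulE'].
Qed.

Section SelfAdjoint.
Variable a : bop R.
Hypotheses (A_a : A a) (a_sa : self_adjoint a).

Let sigma := [set t : R | spectrum A a t%:C].

Lemma spectrum_bounded t : sigma t -> `|t| <= opn a.
Proof.
move=> /spectrumE st; rewrite leNgt; apply/negP => at_; apply: st.
apply: (@unit_in_near_scalar _ (- t%:C)).
  by apply: cstarB => //; apply/cstarZ/cstar_one.
by rewrite scaleNr opprK subrK normcNr normc_real.
Qed.

Lemma re_dot_sa_imag v (s : R) : re_dot (a v) ((0 +i* s) *: v) = 0.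
Proof.
have h : (l2dot (a v) v)^* = l2dot (a v) v by rewrite -dot_conj -a_sa.
rewrite /re_dot dotZr; case: (l2dot (a v) v) h => x y [] /= y0.
have {}y0 : y = 0 by lra.
by rewrite y0 mul0r mulr0 subrr.
Qed.

Lemma sa_imag_shift_norm v (s : R) :
  l2norm (a v + (0 +i* s) *: v) ^+ 2 = l2norm (a v) ^+ 2 + s ^+ 2 * l2norm v ^+ 2.
Proof.
rewrite l2norm_sqrD re_dot_sa_imag mulr0 addr0 l2normZ exprMn.
by rewrite normc_sqrE /= expr0n add0r.
Qed.

End SelfAdjoint.

Lemma self_adjoint_shift a (r : R) : self_adjoint a -> self_adjoint (a - (r%:C)%:A : bop R).
Proof.
move=> asa u v; rewrite !bop_subE !bop_scaleE !bop_oneE dotBl dotBr dotZl dotZr.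
by rewrite conj_real asa.
Qed.

(** For self-adjoint [a] and [y != 0] the operator [a - iy] is close, relative
    to [m], to the scalar [- i m] when [m] is large, as
    [|a + i(m - y)|^2 <= |a|^2 + (m - y)^2 < m^2]. *)
Lemma unit_in_imag a (y : R) : A a -> self_adjoint a -> y != 0 ->
  unit_in (a - (0 +i* y)%:A).
Proof.
move=> Aa asa y0.
pose m := (opn a ^+ 2 + y ^+ 2) / y.
apply: (@unit_in_near_scalar _ (0 +i* (- m))).
  by apply: cstarB => //; apply/cstarZ/cstar_one.
have y2 : 0 < y ^+ 2 by rewrite lt_def expf_neq0//= sqr_ge0.
have K0 : 0 <= opn a ^+ 2 + (m - y) ^+ 2 by rewrite addr_ge0 ?sqr_ge0.
have lt_m : opn a ^+ 2 + (m - y) ^+ 2 < m ^+ 2.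
  have -> : (m - y) ^+ 2 = m ^+ 2 - 2 * (m * y) + y ^+ 2 by ring.
  rewrite /m divfK//; have := sqr_ge0 (opn a); lra.
apply: le_lt_trans (_ : Num.sqrt (opn a ^+ 2 + (m - y) ^+ 2) < _); last first.
  rewrite -(@ltr_pXn2r _ 2) ?nnegrE ?sqrtr_ge0 ?normc_ge0// (sqr_sqrtr K0).
  have -> : normc (0 +i* - m) ^+ 2 = m ^+ 2 by rewrite normc_sqrE /= sqrrN expr0n add0r.
  exact: lt_m.
apply: opn_min; first exact: sqrtr_ge0.
move=> v; have -> : (a - (0 +i* y)%:A - (0 +i* - m)%:A : bop R) v =
    a v + (0 +i* (m - y)) *: v.
  rewrite !bop_subE !bop_scaleE !bop_oneE -addrA -opprD -scalerDl -scaleNr.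
  congr (_ + _ *: _); apply/eqP; rewrite eq_complex /=; apply/andP.
  by split; apply/eqP; ring.
rewrite -(@ler_pXn2r _ 2) ?nnegrE ?mulr_ge0 ?l2norm_ge0 ?sqrtr_ge0//.
rewrite exprMn (sqr_sqrtr K0) (sa_imag_shift_norm asa) mulrDl lerD2r -exprMn.
by rewrite lerXn2r ?nnegrE ?mulr_ge0 ?l2norm_ge0 ?opn_ge0// opn_bound.
Qed.

Lemma spectrum_real a z : A a -> self_adjoint a -> ~ unit_in (a - z%:A) ->
  z = (complex.Re z)%:C.
Proof.
move=> Aa asa; case: z => r y /= ninv; apply/eqP; rewrite eq_complex /= eqxx /=.
apply/negPn/negP => y0; apply: ninv.
have := @unit_in_imag (a - (r%:C)%:A) y.
have -> : a - (r%:C)%:A - (0 +i* y)%:A = a - (r +i* y)%:A.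
  rewrite -addrA -opprD -scalerDl (_ : r%:C + (0 +i* y) = r +i* y)//.
  by apply/eqP; rewrite eq_complex /= addr0 add0r !eqxx.
apply=> //; first by apply: cstarB => //; apply/cstarZ/cstar_one.
exact: self_adjoint_shift.
Qed.

Definition conj_poly (p : {poly R[i]}) := map_poly (Num.conj : R[i] -> R[i]) p.

Lemma horner_algE a (p : {poly R[i]}) : horner_alg a p = \sum_(i < size p) p`_i *: a ^+ i.
Proof.
rewrite -{1}[p]coefK poly_def linear_sum /=; apply: eq_bigr => i _.
by rewrite horner_algZ rmorphXn /= horner_algX.
Qed.

Lemma bop_sum_app (K : Type) (s : seq K) (F : K -> bop R) v :
  (\sum_(k <- s) F k : bop R) v = \sum_(k <- s) F k v.
Proof. by elim/big_rec2: _ => // k x y _ <-. Qed.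

Lemma dot_suml (K : Type) (s : seq K) (F : K -> l2 R nat) v :
  l2dot (\sum_(k <- s) F k) v = \sum_(k <- s) l2dot (F k) v.
Proof.
elim: s => [|k s IH]; last by rewrite !big_cons dotDl IH.
by rewrite !big_nil -(scale0r v) dotZl mul0r.
Qed.

Lemma dot_sumr (K : Type) (s : seq K) (F : K -> l2 R nat) v :
  l2dot v (\sum_(k <- s) F k) = \sum_(k <- s) l2dot v (F k).
Proof.
elim: s => [|k s IH]; last by rewrite !big_cons dotDr IH.
by rewrite !big_nil -(scale0r v) dotZr conjC0 mul0r.
Qed.

Lemma adjoint_horner a (p : {poly R[i]}) : self_adjoint a ->
  is_adjoint (horner_alg a p) (horner_alg a (conj_poly p)).
Proof.
move=> asa u v; rewrite !horner_algE !bop_sum_app dot_suml dot_sumr.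
rewrite size_map_poly; apply: eq_bigr => i _.
rewrite !bop_scaleE dotZl dotZr coef_map /= conjCK; congr (_ * _).
elim: (nat_of_ord i) u => [|n IH] u; first by rewrite expr0.
by rewrite [in LHS]exprSr [in RHS]exprS !bop_mulE IH asa.
Qed.

Section Adjoint.
Variables x y : bop R.
Hypothesis xy : is_adjoint x y.

Lemma adjoint_opn : opn y <= opn x.
Proof.
apply: opn_min; first exact: opn_ge0.
move=> v.
have [yv0|yv0] := eqVneq (l2norm (y v)) 0; first by rewrite yv0 mulr_ge0 ?opn_ge0 ?l2norm_ge0.
have gt0 : 0 < l2norm (y v) by rewrite lt_def yv0 l2norm_ge0.
rewrite -(ler_pM2l gt0).
have -> : l2norm (y v) * l2norm (y v) = re_dot (x (y v)) v.
  by rewrite /re_dot xy dot_self.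
apply: le_trans (cauchy_schwarz _ _) _; rewrite mulrA.
by rewrite ler_wpM2r ?l2norm_ge0// mulrC opn_bound.
Qed.

(** Here [y] is the adjoint of [x]. With [lam = |x|^2] one has
    [|y x v - lam v|^2 <= 2 lam (lam |v|^2 - |x v|^2)]; an inverse of [y x - lam]
    would bound [|v|^2] by a multiple [c] of the bracket, hence [|x v|^2] by
    [(lam - 1 / c) |v|^2], contradicting that [lam] is the square of the norm. *)
Lemma norm_square_in_spectrum : ~ unit_in (y * x - ((opn x ^+ 2)%:C)%:A).
Proof.
set lam := opn x ^+ 2; move=> [w [_ _ wq]].
have lam0 : 0 <= lam := sqr_ge0 _.
have key v : l2norm ((y * x - (lam%:C)%:A : bop R) v) ^+ 2 <=
    2 * lam * (lam * l2norm v ^+ 2 - l2norm (x v) ^+ 2).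
  rewrite bop_subE bop_scaleE bop_oneE bop_mulE -scaleNr.
  rewrite -rmorphN l2norm_sqrD re_dotZr l2normZ normc_real normrN exprMn.
  have -> : re_dot (y (x v)) v = l2norm (x v) ^+ 2.
    rewrite /re_dot dot_conj -xy dot_self conj_real.
    by [].
  have : l2norm (y (x v)) ^+ 2 <= lam ^+ 2 * l2norm v ^+ 2.
    rewrite -exprMn lerXn2r ?nnegrE ?mulr_ge0 ?l2norm_ge0 ?opn_ge0//.
    apply: le_trans (opn_bound y _) _.
    apply: le_trans (ler_wpM2l (opn_ge0 y) (opn_bound x _)) _.
    rewrite mulrA ler_wpM2r ?l2norm_ge0// /lam expr2.
    by rewrite ler_wpM2r ?opn_ge0// adjoint_opn.
  rewrite real_normK ?num_real//; nra.
pose c := opn w ^+ 2 * (2 * lam).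
have c0 : 0 <= c by rewrite !mulr_ge0 ?opn_ge0.
have lower v : l2norm v ^+ 2 <= c * (lam * l2norm v ^+ 2 - l2norm (x v) ^+ 2).
  have vE : v = w ((y * x - (lam%:C)%:A : bop R) v) by rewrite -bop_mulE wq.
  rewrite {1}vE; apply: le_trans (_ : (opn w * l2norm ((y * x - (lam%:C)%:A : bop R) v)) ^+ 2 <= _).
    by rewrite lerXn2r ?nnegrE ?mulr_ge0 ?l2norm_ge0 ?opn_ge0// opn_bound.
  by rewrite exprMn /c -mulrA ler_wpM2l ?sqr_ge0.
have cgt0 : 0 < c.
  rewrite lt_def c0 andbT; apply/eqP => cE.
  by have := lower (basis 0%N); rewrite cE mul0r l2norm_basis expr1n; lra.
have upper v : l2norm (x v) ^+ 2 <= (lam - c^-1) * l2norm v ^+ 2.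
  have := lower v; rewrite mulrBl -ler_pdivrMl// mulrC; lra.
have mu0 : 0 <= lam - c^-1.
  have := upper (basis 0%N); rewrite l2norm_basis expr1n mulr1.
  by apply: le_trans; exact: sqr_ge0.
have : opn x <= Num.sqrt (lam - c^-1).
  apply: opn_min => [|v]; first exact: sqrtr_ge0.
  rewrite -(@ler_pXn2r _ 2) ?nnegrE ?mulr_ge0 ?l2norm_ge0 ?sqrtr_ge0//.
  by rewrite exprMn (sqr_sqrtr mu0).
rewrite -(@ler_pXn2r _ 2) ?nnegrE ?opn_ge0 ?sqrtr_ge0// sqr_sqrtr// -/lam.
have : 0 < c^-1 by rewrite invr_gt0.
lra.
Qed.

End Adjoint.

Section PolynomialCalculus.
Variable a : bop R.
Hypotheses (A_a : A a) (a_sa : self_adjoint a).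

Let sigma := [set t : R | spectrum A a t%:C].

Lemma unit_in_linear_factors (s : seq R[i]) :
  (forall z, z \in s -> unit_in (a - z%:A)) ->
  unit_in (horner_alg a (\prod_(z <- s) ('X - z%:P))).
Proof.
elim: s => [_|z s IH hs].
  by rewrite big_nil rmorph1; exists 1; split; rewrite ?mulr1//; exact: cstar_one.
rewrite big_cons rmorphM; apply: unit_inM; last first.
  by apply: IH => w ws; apply: hs; rewrite inE ws orbT.
rewrite rmorphB /= horner_algX horner_algC; apply: hs; exact: mem_head.
Qed.

(** The element [q(a)] is [p(a)^* p(a) - |p(a)|^2], which is not invertible. Over
    the complex numbers [q] splits, so that some factor [a - z] is not invertible
    either, and [z] is a root of [q] that is real by self-adjointness. *)
Lemma norm_attained_root (p : {poly R[i]}) :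
  let q := conj_poly p * p - ((opn (horner_alg a p) ^+ 2)%:C)%:P in
  q != 0 -> exists2 t, sigma t & q.[t%:C] = 0.
Proof.
move=> q q0.
have nq : ~ unit_in (horner_alg a q).
  rewrite rmorphB rmorphM /= horner_algC.
  by apply: norm_square_in_spectrum; exact: adjoint_horner.
have [s qs] := closed_field_poly_normal q.
have [z zs nz] : exists2 z, z \in s & ~ unit_in (a - z%:A).
  apply: contrapT => hn; apply: nq; rewrite qs horner_algZ; apply: unit_inZ.
    by rewrite lead_coef_eq0.
  apply: unit_in_linear_factors => z zs; apply: contrapT => nz.
  by apply: hn; exists z.
have zE := spectrum_real A_a a_sa nz.
exists (complex.Re z); first by apply/spectrumE; rewrite -zE.
rewrite -zE qs hornerZ; apply/eqP; rewrite mulf_eq0; apply/orP; right.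
by rewrite -/(root _ _) root_prod_XsubC.
Qed.

Lemma conj_poly_real (p : {poly R[i]}) (t : R) :
  (conj_poly p * p).[t%:C] = (normc p.[t%:C] ^+ 2)%:C.
Proof.
rewrite hornerM -mulc_conj mulrC; congr (_ * _).
by rewrite -{1}[t%:C]conj_real horner_map.
Qed.

(** The case of the polynomial [X], where the polynomial [X^2 - |a|^2] is not 0. *)
Lemma spectrum_nonempty : sigma !=set0.
Proof.
have [|t st _] := @norm_attained_root 'X; last by exists t.
apply/eqP => /(congr1 (fun q : {poly R[i]} => q`_2)).
rewrite coef0 coefB /conj_poly map_polyX -expr2 coefXn coefC /= subr0.
exact/eqP/oner_neq0.
Qed.

(** Spectral mapping and the equality of norm and spectral radius, for a
    polynomial in a self-adjoint element; if [|p|^2] is constantly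
    [|p(a)|^2], any point of the spectrum serves. *)
Lemma norm_attained (p : {poly R[i]}) :
  exists2 t, sigma t & opn (horner_alg a p) = normc p.[t%:C].
Proof.
have [t st qt] : exists2 t, sigma t &
    (conj_poly p * p - ((opn (horner_alg a p) ^+ 2)%:C)%:P).[t%:C] = 0.
  have [q0|] := eqVneq (conj_poly p * p - ((opn (horner_alg a p) ^+ 2)%:C)%:P) 0.
    by have [t st] := spectrum_nonempty; exists t => //; rewrite q0 horner0.
  exact: norm_attained_root.
exists t => //; move: qt; rewrite hornerD hornerN hornerC conj_poly_real.
move/eqP; rewrite subr_eq0 => /eqP/complexI/eqP.
by rewrite eqrXn2 ?opn_ge0 ?normc_ge0// => /eqP.
Qed.

Lemma polynomial_norm_le (p : {poly R[i]}) (M : R) :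
  (forall t, sigma t -> normc p.[t%:C] <= M) -> opn (horner_alg a p) <= M.
Proof. by have [t st ->] := norm_attained p; apply. Qed.

Lemma spectrum_closed : closed sigma.
Proof.
rewrite -[sigma]setCK; apply: open_closedC; rewrite openE => t /= /spectrumE.
have At : A (a - (t%:C)%:A : bop R) by apply: cstarB => //; apply/cstarZ/cstar_one.
rewrite notK => ut; have [d d0 hd] := unit_in_open At ut.
exists d => //= u tu; rewrite /setC /=; move/spectrumE; apply; apply: hd.
- by apply: cstarB => //; apply/cstarZ/cstar_one.
have -> : a - (u%:C)%:A - (a - (t%:C)%:A) = ((t - u)%:C)%:A.
  by rewrite opprB addrC addrA subrK rmorphB scalerBl.
apply: le_lt_trans (opnZ _ _) _; rewrite normc_real.
by apply: le_lt_trans tu; rewrite ler_piMr// opn1.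
Qed.

Lemma poly_opE (p : {poly R[i]}) : poly_op p a = horner_alg a p :> (_ -> _).
Proof.
apply/funext => v; rewrite horner_algE bop_sum_app /poly_op.
elim/big_rec2: _ => // i x y _ <-.
rewrite -[LHS]/(p`_i *: iter i a v + y v) -[RHS]/(p`_i *: (a ^+ i) v + y v).
congr (_ *: _ + _); elim: (nat_of_ord i) => [|n IH]; first by rewrite expr0.
by rewrite iterS IH exprS.
Qed.

(** Polynomials that approximate [f] on the spectrum have values at [a] that are
    Cauchy by [polynomial_norm_le]; their limit is at distance at most [M] from
    [p(a)] whenever [p] is within [M] of [f]. Such distances also force uniqueness. *)
Lemma functional_calculus (f : R -> R[i]) :
  (forall e : R, 0 < e -> exists p : {poly R[i]},
    forall t, sigma t -> normc (f t - p.[t%:C]) <= e) ->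
  exists b : bop R, unique (is_cfc A a f) b /\
    forall (p : {poly R[i]}) (M : R),
      (forall t, sigma t -> normc (f t - p.[t%:C]) <= M) ->
      opn (b - horner_alg a p) <= M.
Proof.
move=> fapp.
have dist (p q : {poly R[i]}) (M N : R) :
    (forall t, sigma t -> normc (f t - p.[t%:C]) <= M) ->
    (forall t, sigma t -> normc (f t - q.[t%:C]) <= N) ->
    opn (horner_alg a p - horner_alg a q) <= M + N.
  move=> hp hq; rewrite -rmorphB; apply: polynomial_norm_le => t st.
  rewrite hornerD hornerN.
  have -> : p.[t%:C] - q.[t%:C] = - (f t - p.[t%:C]) + (f t - q.[t%:C]).
    by rewrite opprB addrA subrK.
  by apply: le_trans (normc_triangle _ _) _; rewrite normcNr lerD ?hp ?hq.
have e_gt0 n : 0 < (n.+1%:R)^-1 :> R by rewrite invr_gt0.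
have /choice[P hP] : forall n : nat, exists p : {poly R[i]},
    forall t, sigma t -> normc (f t - p.[t%:C]) <= (n.+1%:R)^-1.
  by move=> n; exact: fapp.
have inv_small (e : R) : 0 < e -> exists n : nat, n.+1%:R^-1 + n.+1%:R^-1 <= e.
  move=> e0; exists (Num.truncn (2 / e)).
  have : 2 / e < (Num.truncn (2 / e)).+1%:R by rewrite Num.Theory.truncnS_gt.
  pose N : R := (Num.truncn (2 / e)).+1%:R; rewrite -/N ltr_pdivrMr// => h.
  have N0 : 0 < N by rewrite ltr0n.
  have -> : N^-1 + N^-1 = 2 / N by rewrite -mulr2n -[LHS]mulr_natl.
  by rewrite ler_pdivrMr// mulrC ltW.
have [||b hb] := @bop_cauchy_limit R (fun n => horner_alg a (P n))
  (fun n => n.+1%:R^-1 + n.+1%:R^-1).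
- move=> m n mn; apply: le_trans (dist _ _ _ _ (hP n) (hP m)) _.
  by rewrite lerD2r lef_pV2 ?posrE// ler_nat ltnS.
- exact: inv_small.
have isom (p : {poly R[i]}) (M : R) :
    (forall t, sigma t -> normc (f t - p.[t%:C]) <= M) ->
    opn (b - horner_alg a p) <= M.
  move=> hp; apply/ler_addgt0Pr => e e0.
  have [n hn] := inv_small (e / 2) (divr_gt0 e0 (ltr0n _ 2)).
  have -> : b - horner_alg a p =
      (b - horner_alg a (P n)) + (horner_alg a (P n) - horner_alg a p).
    by rewrite addrA subrK.
  apply: le_trans (opnD _ _) _.
  have h1 := hb n; have h2 := dist _ _ _ _ (hP n) hp; have h3 := e_gt0 n.
  by move: hn h1 h2 h3; move: (n.+1%:R^-1 : R) (opn _) (opn _) => k u v; lra.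
have Ab : A b.
  apply: (@cstar_closed _ (fun n => horner_alg a (P n))).
    by move=> n; exact: cstar_horner_alg.
  move=> e e0; have [n hn] := inv_small e e0; exists n => m nm.
  rewrite opn_distC; apply: le_trans (hb m) _; apply: le_trans hn.
  by apply: lerD; rewrite lef_pV2 ?posrE// ler_nat ltnS.
exists b; split=> //; split.
  split=> // e e0; have [p hp] := fapp e e0; exists p; split=> //.
  rewrite poly_opE; apply/(opn_leP (b - horner_alg a p) (ltW e0)); exact: isom.
move=> y [Ay hy]; pose y' := mk_bop (cstar_bounded Ay).
suff : b - y' = 0 by move/eqP; rewrite subr_eq0 => /eqP ->.
apply: opn_small_eq0 => e e0.
have e2 : 0 < e / 2 by rewrite divr_gt0.
have [p [hp yp]] := hy (e / 2) e2.
have -> : b - y' = (b - horner_alg a p) - (y' - horner_alg a p).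
  by rewrite opprB addrA subrK.
rewrite [leRHS]splitr; apply: le_trans (opnB _ _) _; apply: lerD; first exact: isom.
by apply/(opn_leP (y' - horner_alg a p) (ltW e2)); rewrite poly_opE in yp.
Qed.

End PolynomialCalculus.
End CstarTheory.

(** * Cutoff functions *)

Section SmoothClasses.
Context {R : realType}.
Implicit Types (f g h : R -> R) (P : (R -> R) -> Prop).

Definition has_deriv f f' := forall x : R, is_derive x 1 f (f' x).

(** The classes [Cn] and [Bn] below are instances, for [P] continuity and
    boundedness; both are closed under sums and products because [P] is. *)
Fixpoint derivs_in P (n : nat) f : Prop :=
  P f /\ if n is m.+1 then exists2 f', has_deriv f f' & derivs_in P m f' else True.

Lemma derivs_inS P n f : derivs_in P n.+1 f -> derivs_in P n f.
Proof.
elim: n f => [|n IH] f [Pf [f' ff' Pf']]; first by split.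
by split=> //; exists f' => //; exact: IH.
Qed.

Lemma derivs_in_le P m n f : (m <= n)%N -> derivs_in P n f -> derivs_in P m f.
Proof.
elim: n => [|n IH]; first by rewrite leqn0 => /eqP ->.
by rewrite leq_eqVlt => /orP[/eqP -> //|mn] /derivs_inS; exact: IH.
Qed.

Lemma has_derivD f f' g g' :
  has_deriv f f' -> has_deriv g g' -> has_deriv (f + g) (f' + g').
Proof. by move=> hf hg x; exact: is_deriveD. Qed.

Lemma has_derivM f f' g g' :
  has_deriv f f' -> has_deriv g g' -> has_deriv (f * g) (f * g' + g * f').
Proof. by move=> hf hg x; exact: is_deriveM. Qed.

Lemma has_deriv_comp f f' g g' :
  has_deriv f f' -> has_deriv g g' -> has_deriv (f \o g) ((f' \o g) * g').
Proof. by move=> hf hg x; exact: is_derive1_comp. Qed.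

Lemma has_deriv_cst (c : R) : has_deriv (cst c) (cst 0).
Proof. by move=> x; exact: is_derive_cst. Qed.

Lemma has_deriv_id : has_deriv id (cst 1).
Proof. by move=> x; exact: is_derive_id. Qed.

Lemma has_deriv_continuous f f' : has_deriv f f' -> continuous f.
Proof.
by move=> ff' x; apply: differentiable_continuous; apply/derivable1_diffP;
  have [] := ff' x.
Qed.

Lemma derivable_has_deriv f x : derivable f x 1 -> is_derive x 1 f (derive1 f x).
Proof. by move=> fx; rewrite derive1E; exact: derivableP. Qed.

Section Closure.
Variable P : (R -> R) -> Prop.
Hypotheses (PD : forall f g, P f -> P g -> P (f + g))
           (PM : forall f g, P f -> P g -> P (f * g))
           (Pc : forall c : R, P (cst c)).

Lemma derivs_inD n f g : derivs_in P n f -> derivs_in P n g -> derivs_in P n (f + g).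
Proof.
elim: n f g => [|n IH] f g /= [Pf hf] [Pg hg]; first by split=> //; exact: PD.
case: hf => f' ff' f'n; case: hg => g' gg' g'n; split; first exact: PD.
by exists (f' + g'); [exact: has_derivD | exact: IH].
Qed.

Lemma derivs_inM n f g : derivs_in P n f -> derivs_in P n g -> derivs_in P n (f * g).
Proof.
elim: n f g => [|n IH] f g; first by move=> [Pf _] [Pg _]; split=> //; exact: PM.
move=> hf hg; have fn := derivs_inS hf; have gn := derivs_inS hg.
case: hf => Pf [f' ff' f'n]; case: hg => Pg [g' gg' g'n]; split; first exact: PM.
exists (f * g' + g * f'); first exact: has_derivM.
by apply: derivs_inD; exact: IH.
Qed.

Lemma derivs_in_cst n (c : R) : derivs_in P n (cst c).
Proof.
elim: n c => [|n IH] c; split=> //.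
by exists (cst 0); [exact: has_deriv_cst | exact: IH].
Qed.

Lemma derivs_inN n f : derivs_in P n f -> derivs_in P n (- f).
Proof.
move=> hf; have -> : - f = cst (-1) * f by apply/funext => x; rewrite /= mulN1r.
exact: derivs_inM (derivs_in_cst _ _) hf.
Qed.

End Closure.

Definition Cn := derivs_in (fun f => continuous f).

Lemma CnD n f g : Cn n f -> Cn n g -> Cn n (f + g).
Proof. by apply: derivs_inD => {}f {}g hf hg x; exact: cvgD (hf x) (hg x). Qed.

Lemma CnM n f g : Cn n f -> Cn n g -> Cn n (f * g).
Proof.
apply: derivs_inM => {}f {}g hf hg x; first exact: cvgD (hf x) (hg x).
exact: cvgM (hf x) (hg x).
Qed.

Lemma Cn_cst n (c : R) : Cn n (cst c).
Proof. by apply: derivs_in_cst => d x; exact: cvg_cst. Qed.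

Lemma Cn_id n : Cn n id.
Proof.
case: n => [|n]; split=> //; try by move=> x.
by exists (cst 1); [exact: has_deriv_id | exact: Cn_cst].
Qed.

Lemma CnB n f g : Cn n f -> Cn n g -> Cn n (f - g).
Proof.
move=> hf hg; apply: CnD => //.
have -> : - g = cst (-1) * g by apply/funext => x; rewrite /= mulN1r.
exact: CnM (Cn_cst _ _) hg.
Qed.

Lemma Cn_comp n f g : Cn n f -> Cn n g -> Cn n (f \o g).
Proof.
elim: n f g => [|n IH] f g.
  by move=> [cf _] [cg _]; split=> // x; apply: continuous_comp; [exact: cg | exact: cf].
move=> hf hg; have gn := derivs_inS hg.
case: hf => Pf [f' ff' f'n]; case: hg => Pg [g' gg' g'n].
split; first by move=> x; apply: continuous_comp; [exact: Pg | exact: Pf].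
exists ((f' \o g) * g'); first exact: has_deriv_comp.
by apply: CnM => //; exact: IH.
Qed.

Definition bounded_real f := exists M : R, forall x, `|f x| <= M.

Definition Bn := derivs_in bounded_real.

Lemma bounded_realD f g : bounded_real f -> bounded_real g -> bounded_real (f + g).
Proof.
move=> [M hM] [N hN]; exists (M + N) => x.
by apply: le_trans (ler_normD _ _) _; exact: lerD.
Qed.

Lemma bounded_realM f g : bounded_real f -> bounded_real g -> bounded_real (f * g).
Proof.
by move=> [M hM] [N hN]; exists (M * N) => x; rewrite normrM ler_pM.
Qed.

Lemma bounded_real_cst (c : R) : bounded_real (cst c).
Proof. by exists `|c|. Qed.

Lemma BnM n f g : Bn n f -> Bn n g -> Bn n (f * g).
Proof. exact: derivs_inM bounded_realD bounded_realM n f g. Qed.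

Lemma BnN n f : Bn n f -> Bn n (- f).
Proof. exact: derivs_inN bounded_realD bounded_realM bounded_real_cst n f. Qed.

Lemma sin_bound (x : R) : `|sin x| <= 1.
Proof. by rewrite ler_norml sin_geN1 sin_le1. Qed.

Lemma cos_bound (x : R) : `|cos x| <= 1.
Proof. by rewrite ler_norml cos_geN1 cos_le1. Qed.

Lemma Bn_sin_cos n : Bn n sin /\ Bn n cos.
Proof.
elim: n => [|n [IHs IHc]].
  by split; split=> //; exists 1 => x; [exact: sin_bound | exact: cos_bound].
split; split; first by exists 1 => x; exact: sin_bound.
- by exists cos => // x; exact: is_derive_sin.
- by exists 1 => x; exact: cos_bound.
- exists (- sin); last exact: BnN.
  by move=> x; exact: is_derive_cos.
Qed.

Lemma continuous_bounded_segment f : continuous f ->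
  exists M : R, forall x, -1 <= x <= 1 -> `|f x| <= M.
Proof.
move=> cf; have cnf : {within `[(-1 : R), 1], continuous (fun x => `|f x|)}.
  apply: continuous_subspaceT => x; apply: continuous_comp; first exact: cf.
  exact: norm_continuous.
have [|c _ hc] := EVT_max _ cnf; first by lra.
by exists `|f c| => x xI; apply: hc; rewrite in_itv.
Qed.

(** Composition with the cosine makes every derivative bounded, because it only
    sees the values of [g] and its derivatives on the segment from -1 to 1. *)
Lemma Bn_comp_cos n g : Cn n g -> Bn n (g \o cos).
Proof.
have bnd f : continuous f -> bounded_real (f \o cos).
  move=> /continuous_bounded_segment[M hM]; exists M => x /=.
  by apply: hM; rewrite cos_geN1 cos_le1.
elim: n g => [|n IH] g [cg hg]; split=> //; try exact: bnd.
case: hg => g' gg' g'n; exists ((g' \o cos) * (- sin)).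
  by apply: has_deriv_comp => // x; exact: is_derive_cos.
by apply: BnM; [exact: IH | apply: BnN; exact: (Bn_sin_cos n).1].
Qed.

Lemma MVT_lipschitz f f' (M : R) : has_deriv f f' -> (forall x, `|f' x| <= M) ->
  forall x y, `|f x - f y| <= M * `|x - y|.
Proof.
move=> ff' hM x y; wlog xy : x y / y <= x.
  move=> hw; have [/hw //|/ltW /hw] := leP y x.
  by rewrite distrC (distrC y).
have [||c _ ->] := @MVT_segment R f f' y x xy; first by move=> z _; exact: ff'.
  by apply: continuous_subspaceT; exact: has_deriv_continuous ff'.
by rewrite normrM ler_wpM2r.
Qed.

(** The positive part of [x ^ m], whose class of differentiability is limited only
    by its behaviour at 0. Finite smoothness suffices below, and these powers avoid
    the exponential functions that a smooth cutoff would require. *)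
Definition pos_pow (m : nat) (x : R) : R := Num.max x 0 ^+ m.

Lemma pos_pow_le0 m x : x <= 0 -> pos_pow m.+1 x = 0.
Proof. by move=> x0; rewrite /pos_pow max_r// expr0n. Qed.

Lemma pos_pow_ge0 m x : 0 <= x -> pos_pow m x = x ^+ m.
Proof. by move=> x0; rewrite /pos_pow max_l. Qed.

Lemma continuous_pos_pow m : continuous (pos_pow m).
Proof.
move=> x; apply: (@continuous_comp _ _ _ (fun x : R => Num.max x 0) (fun x : R => x ^+ m)).
  by apply: continuous_max; [exact: cvg_id | exact: cvg_cst].
exact: exprn_continuous.
Qed.

Lemma has_deriv_pos_pow m :
  has_deriv (pos_pow m.+2) (fun x => m.+2%:R * pos_pow m.+1 x).
Proof.
move=> x; have [x0|x0|->] := ltrgt0P x.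
- apply: (@near_eq_is_derive _ _ _ (fun y : R => y ^+ m.+2)).
    near=> y; rewrite pos_pow_ge0// ltW//; near: y.
    exact: lt_nbhsr.
  have -> : (fun y : R => y ^+ m.+2) = (id : R -> R) ^+ m.+2.
    by rewrite exprfctE.
  have := @is_deriveX R R id m.+2 x 1 1 (is_derive_id x (1:R)); move=> /is_derive_eq; apply.
  by rewrite pos_pow_ge0 ?ltW//= -[RHS]mulr1.
- apply: (@near_eq_is_derive _ _ _ (cst 0 : R -> R)).
    near=> y; rewrite pos_pow_le0// ltW//; near: y.
    exact: lt_nbhsl.
  by rewrite pos_pow_le0 ?ltW// mulr0; exact: is_derive_cst.
- rewrite pos_pow_le0// mulr0.
  have cv : (fun t => t^-1 *: (pos_pow m.+2 (t *: 1 + 0) - pos_pow m.+2 0)) @ 0^'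
      --> (0 : R).
    apply: (@cvg_trans _ (pos_pow m.+1 t @[t --> 0^'])); last first.
      apply: cvg_trans (cvg_app _ (cvg_within _)) _.
      by rewrite -[X in _ --> X](@pos_pow_le0 m 0)//; exact: continuous_pos_pow.
    apply: near_eq_cvg; near=> t.
    have t0 : t != 0 by near: t; exact: nbhs_dnbhs_neq.
    rewrite (@pos_pow_le0 m.+1 0)// subr0 addr0 /GRing.scale /= mulr1.
    have [tp|tn] := leP 0 t; first by rewrite !pos_pow_ge0// [in RHS]exprS mulKf.
    by rewrite !pos_pow_le0 ?ltW// mulr0.
  by split; [apply/cvg_ex; exists 0 | exact: cvg_lim cv].
Unshelve. all: by end_near. Qed.

Lemma Cn_pos_pow n : Cn n (pos_pow n.+1).
Proof.
elim: n => [|n IH]; split=> //; try exact: continuous_pos_pow.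
exists (fun x => n.+2%:R * pos_pow n.+1 x); first exact: has_deriv_pos_pow.
exact: (CnM (Cn_cst n n.+2%:R) IH).
Qed.

(** It is 0 on the negative half-line and 1 beyond 1. *)
Definition smooth_step (n : nat) (x : R) : R := 1 - pos_pow n.+1 (1 - pos_pow n.+1 x).

Lemma smooth_step_le0 n x : x <= 0 -> smooth_step n x = 0.
Proof.
by move=> x0; rewrite /smooth_step (pos_pow_le0 n x0) subr0 pos_pow_ge0// expr1n subrr.
Qed.

Lemma smooth_step_ge1 n x : 1 <= x -> smooth_step n x = 1.
Proof.
move=> x1; rewrite /smooth_step (@pos_pow_le0 n (1 - _)) ?subr0//.
by rewrite subr_le0 pos_pow_ge0 ?(le_trans ler01)// exprn_ege1.
Qed.

Lemma Cn_smooth_step n : Cn n (smooth_step n).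
Proof.
apply: (CnB (Cn_cst n 1)); apply: (Cn_comp (f := pos_pow n.+1)); first exact: Cn_pos_pow.
exact: (CnB (Cn_cst n 1) (Cn_pos_pow n)).
Qed.

(** The quotient is at least 1 when [|x - t| <= d] and at most 0 when
    [|x - t| >= 2 d]. *)
Definition bump (n : nat) (t d x : R) : R :=
  smooth_step n ((4 * d ^+ 2 - (x - t) ^+ 2) / (3 * d ^+ 2)).

Lemma Cn_bump n t d : Cn n (bump n t d).
Proof.
apply: (Cn_comp (f := smooth_step n)); first exact: Cn_smooth_step.
apply: (CnM (g := cst ((3 * d ^+ 2)^-1))); last exact: Cn_cst.
apply: (CnB (Cn_cst n (4 * d ^+ 2))).
have xt : Cn n (fun x => x - t) := CnB (Cn_id n) (Cn_cst n t).
have -> : (fun x => (x - t) ^+ 2) = (fun x => x - t) * (fun x => x - t).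
  by apply/funext => x; rewrite expr2.
exact: CnM.
Qed.

Lemma bump_near n t d x : 0 < d -> `|x - t| <= d -> bump n t d x = 1.
Proof.
move=> d0 xt; apply: smooth_step_ge1.
have h : (x - t) ^+ 2 <= d ^+ 2.
  by rewrite -real_normK ?num_real// lerXn2r ?nnegrE// ltW.
have := exprn_gt0 2 d0; rewrite ler_pdivlMr ?mulr_gt0 ?exprn_gt0//; lra.
Qed.

Lemma bump_far n t d x : 0 < d -> 2 * d <= `|x - t| -> bump n t d x = 0.
Proof.
move=> d0 xt; apply: smooth_step_le0.
have h : (2 * d) ^+ 2 <= (x - t) ^+ 2.
  by rewrite -[leRHS]real_normK ?num_real// lerXn2r ?nnegrE// mulr_ge0// ltW.
have := exprn_gt0 2 d0; rewrite pmulr_lle0 ?invr_gt0 ?mulr_gt0 ?exprn_gt0//.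
move: h; rewrite exprMn; lra.
Qed.

(** Vanishing near each point outside [O], rather than at it, passes to
    derivatives and makes the product with any function differentiable there. *)
Definition vanishes_off (O : set R) (chi : R -> R) :=
  forall x, ~ O x -> \forall y \near x, chi y = 0.

(** Finitely many bumps cover the compact set; they are combined by
    [1 - (1 - u) (1 - v)], which is 1 where [u] or [v] is and 0 where both are. *)
Lemma cutoff_exists (n : nat) (sigma O : set R) :
  compact sigma -> open O -> sigma `<=` O ->
  exists chi : R -> R,
    [/\ Cn n chi, forall t, sigma t -> chi t = 1 & vanishes_off O chi].
Proof.
move=> csig oO sO.
have /choice[d hd] : forall t : R, exists d : R, 0 < d /\
    (O t -> forall x, `|x - t| < 3 * d -> O x).
  move=> t; have [Ot|nOt] := pselect (O t); last by exists 1; split.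
  have : nbhs t O by rewrite nbhsE; exists O => //; split.
  case=> e /= e0 he; exists (e / 3); split; first by rewrite divr_gt0.
  move=> _ x; rewrite mulrC divfK ?pnatr_eq0// => xt; apply: he.
  by rewrite /ball /= distrC.
have : cover_compact sigma by rewrite -compact_cover.
move=> /(_ R sigma (fun t => ball t (d t))) [].
- by move=> t _; exact: ball_open.
- by move=> t st; exists t => //; apply: ballxx; exact: (hd t).1.
move=> D Dsig Dcov.
suff [chi [chiC chi1 chi0]] : exists chi : R -> R, [/\ Cn n chi,
    forall t, (exists2 s, s \in finmap.enum_fset D & ball s (d s) t) -> chi t = 1 &
    vanishes_off O chi].
  by exists chi; split=> // t /Dcov [s sD st]; apply: chi1; exists s.
clear Dcov.
have : {in finmap.enum_fset D, forall s, O s}.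
  by move=> s sD; apply: sO; have := Dsig s sD; rewrite inE.
clear Dsig.
move: (finmap.enum_fset D) => l0; elim: l0 => [|s l IH] Ol.
  exists (cst 0); split; first exact: Cn_cst.
    by move=> t [].
  by move=> x _; near=> y.
have [|chi [chiC chi1 chi0]] := IH.
  by move=> u ul; apply: Ol; rewrite inE ul orbT.
pose b := bump n s (d s); have bC : Cn n b := Cn_bump n s (d s).
exists (chi + b - chi * b); split.
- by apply: CnB; [exact: CnD | exact: CnM].
- move=> t [u]; rewrite inE => /orP[/eqP ->|ul] ut.
    rewrite -[LHS]/(chi t + b t - chi t * b t).
    have -> : b t = 1 by apply: bump_near (hd s).1 _; rewrite distrC ltW.
    by rewrite mulr1 addrC addrA addNr add0r.
  rewrite -[LHS]/(chi t + b t - chi t * b t) chi1; last by exists u.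
  by rewrite mul1r addrK.
- move=> x nOx.
  have xs : 2 * d s < `|x - s|.
    rewrite ltNge; apply/negP => xs; apply: nOx; apply: (hd s).2.
      by apply: Ol; exact: mem_head.
    by apply: le_lt_trans xs _; have := (hd s).1; lra.
  near=> y.
  have chy : chi y = 0 by near: y; exact: chi0.
  have by0 : b y = 0.
    apply: bump_far (hd s).1 _; apply: ltW.
    near: y; have e0 : 0 < `|x - s| - 2 * d s by rewrite subr_gt0.
    exists (`|x - s| - 2 * d s) => //= y; rewrite /ball /= => xy.
    have := ler_normD (x - y) (y - s); rewrite addrA subrK; lra.
  by rewrite -[LHS]/(chi y + b y - chi y * b y) chy by0 mulr0 subr0 addr0.
Unshelve. all: by end_near. Qed.

Lemma vanishes_off_deriv (O : set R) (chi chi' : R -> R) :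
  has_deriv chi chi' -> vanishes_off O chi -> vanishes_off O chi'.
Proof.
move=> dchi v0 x /v0 /near_join; apply: filterS => y hy.
have d0 : is_derive y 1 chi 0.
  apply: (near_eq_is_derive _ (has_deriv_cst 0 y)).
  by near=> z; apply/esym; near: z.
by have [_ <-] := dchi y; have [_ <-] := d0.
Unshelve. all: by end_near. Qed.

Lemma has_deriv_cutoff (O : set R) (chi chi' f : R -> R) :
  has_deriv chi chi' -> vanishes_off O chi ->
  (forall x, O x -> derivable f x 1) ->
  has_deriv (chi * f) (chi * derive1 f + f * chi').
Proof.
move=> dchi v0 fO x; have [Ox|nOx] := pselect (O x).
  by apply: is_deriveM; [exact: dchi | apply: derivable_has_deriv; exact: fO].
have chi'x : chi' x = 0 := nbhs_singleton (vanishes_off_deriv dchi v0 nOx).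
have chix : chi x = 0 := nbhs_singleton (v0 x nOx).
rewrite (_ : _ x = 0); last first.
  by rewrite -[LHS]/(chi x * derive1 f x + f x * chi' x) chi'x chix mul0r mulr0 addr0.
apply: (near_eq_is_derive _ (has_deriv_cst 0 x)).
near=> y; apply/esym; rewrite -[LHS]/(chi y * f y) (_ : chi y = 0) ?mul0r//.
by near: y; exact: v0.
Unshelve. all: by end_near. Qed.

(** By induction on [n], the derivative being [chi f' + f chi'], a sum of two
    products of the same kind. Outside [O] the function [f] and its formal
    derivatives take arbitrary values, which are multiplied by 0. *)
Lemma Cn_cutoff n (O : set R) (chi f : R -> R) : Cn n.+1 chi -> vanishes_off O chi ->
  (forall k x, O x -> derivable (derive1n k f) x 1) -> Cn n (chi * f).
Proof.
elim: n chi f => [|n IH] chi f [cchi [chi' dchi chi'n]] v0 fO.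
  have dM := has_deriv_cutoff dchi v0 (fO 0%N).
  by split=> //; exact: has_deriv_continuous dM.
have dM := has_deriv_cutoff dchi v0 (fO 0%N).
split; first exact: has_deriv_continuous dM.
exists (chi * derive1 f + f * chi') => //.
apply: CnD; last by rewrite mulrC; apply: IH => //; exact: vanishes_off_deriv dchi v0.
apply: IH => //; first by split=> //; exists chi' => //; exact: derivs_inS chi'n.
by move=> k x Ox; rewrite -derive1Sn; exact: fO.
Qed.

End SmoothClasses.

(** * Chebyshev approximation of smooth functions *)

Section Jordan.
Context {R : realType}.

Lemma pi_le4 : pi <= 4 :> R.
Proof. by have [/andP[_ h] _] := pihalf_02_cos_pihalf R; lra. Qed.

Lemma sin_ge_quarter (y : R) : 0 <= y <= pi / 2 -> y / 4 <= sin y.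
Proof.
move=> /andP[y0 y2].
have p4 : cos (pi / 4) ^+ 2 = 2^-1 :> R.
  have := cos_mulr2n (pi / 4 : R).
  have -> : pi / 4 *+ 2 = pi / 2 :> R by rewrite mulr2n; lra.
  rewrite cos_pihalf; move: (cos _ ^+ 2) => u; rewrite mulr2n; lra.
have pi0 := pi_gt0 R; have pi4 := pi_le4.
have c0 : 0 < cos (pi / 4) :> R by apply: cos_gt0_pihalf; apply/andP; split; lra.
have c12 : 2^-1 <= cos (pi / 4) :> R.
  rewrite -(@ler_pXn2r _ 2) ?nnegrE ?(ltW c0)// p4 expr2; lra.
(* On the first half of the interval the slope is at least cos (pi / 4). *)
have low (u : R) : 0 <= u <= pi / 4 -> u / 2 <= sin u.
  move=> /andP[u0 u4].
  have [|c cI] := @MVT_segment R sin cos 0 u u0.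
  - by apply: continuous_subspaceT; exact: continuous_sin.
  - move: cI; rewrite in_itv /= => /andP[c0' cu].
    rewrite sin0 !subr0 => ->; rewrite mulrC ler_wpM2r//.
    apply: le_trans c12 _.
    have [->//|ne] := eqVneq c (pi / 4).
    apply: ltW; rewrite ltr_cos ?in_itv /=; try by apply/andP; split; lra.
    by rewrite lt_neqAle ne; lra.
have [y4|y4] := leP y (pi / 4); first by have := low y; rewrite y0 y4 => /(_ isT); lra.
(* On the second half the sine is cos (pi / 2 - y) >= cos (pi / 4). *)
have -> : sin y = cos (y - pi / 2) by rewrite cosBpihalf.
rewrite -cosN opprB.
suff : cos (pi / 4) <= cos (pi / 2 - y) by lra.
apply: ltW; rewrite ltr_cos ?in_itv /=; try by apply/andP; split; lra.
lra.
Qed.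

Lemma two_minus_cos_ge (x : R) : 0 <= x <= pi -> x ^+ 2 / 16 <= 2 - 2 * cos x.
Proof.
move=> /andP[x0 xpi].
have h : x / 2 / 4 <= sin (x / 2) by apply: sin_ge_quarter; apply/andP; split; lra.
have s2 : (x / 8) ^+ 2 <= sin (x / 2) ^+ 2.
  by rewrite lerXn2r ?nnegrE; lra.
have -> : cos x = 2 * cos (x / 2) ^+ 2 - 1.
  have := cos_mulr2n (x / 2); rewrite (mulr2n (cos (x / 2) ^+ 2)).
  by have -> : x / 2 *+ 2 = x by [rewrite -mulr_natr; lra]; move=> ->; ring.
have := cos2Dsin2 (x / 2); move: s2.
have -> : (x / 8) ^+ 2 = x ^+ 2 / 64 by field.
lra.
Qed.

Lemma sin_natpi (k : nat) : sin (k%:R * pi) = 0 :> R.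
Proof.
elim: k => [|k IH]; first by rewrite mul0r sin0.
by rewrite -addn1 natrD mulrDl mul1r sinDpi IH oppr0.
Qed.

Lemma sin_lipschitz (a x y : R) : `|sin (a * x) - sin (a * y)| <= `|a| * `|x - y|.
Proof.
have h := @MVT_lipschitz R sin cos 1 (fun x => is_derive_sin x) cos_bound.
by apply: le_trans (h _ _) _; rewrite mul1r -mulrBr normrM.
Qed.

End Jordan.

Section SineTransform.
Context {R : realType}.
Variables (N : nat).
Hypothesis N0 : (0 < N)%N.
Local Notation th := (pi / N%:R : R).
Implicit Types h : R -> R.

Let Nth : N%:R * th = pi.
Proof. by rewrite mulrC divfK// pnatr_eq0 -lt0n. Qed.

Let th_gt0 : 0 < th.
Proof. by rewrite divr_gt0 ?pi_gt0// ltr0n. Qed.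

(** The Dirichlet kernel at a node, which telescopes after multiplication by
    twice the sine of half the angle. *)
Lemma sum_cos_node (m : nat) : (0 < m < N.*2)%N ->
  \sum_(n < N) cos (n%:R * (m%:R * th)) = (1 - cos (m%:R * pi)) / 2.
Proof.
move=> /andP[m0 mN]; set z := m%:R * th / 2.
have sz : sin z != 0.
  rewrite gt_eqF// sin_gt0_pi//; apply/andP; split.
    by rewrite /z divr_gt0// mulr_gt0// ltr0n.
  have : m%:R * th < N.*2%:R * th by rewrite ltr_pM2r// ltr_nat.
  by rewrite -muln2 natrM mulrAC Nth /z; lra.
have tel (q : nat) : 2 * sin z * (\sum_(n < q) cos (n%:R * (m%:R * th))) =
    sin (2 * q%:R * z - z) + sin z.
  elim: q => [|q IH].
    by rewrite big_ord0 !mulr0 mul0r sub0r sinN addNr.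
  rewrite big_ord_recr /= mulrDr IH.
  have -> : 2 * q.+1%:R * z - z = 2 * q%:R * z + z by rewrite -natr1; ring.
  have -> : q%:R * (m%:R * th) = 2 * q%:R * z by rewrite /z; move: th => t; field.
  by rewrite sinB sinD; ring.
apply: (mulfI (_ : 2 * sin z != 0)); first by rewrite mulf_neq0// pnatr_eq0.
rewrite tel; have -> : 2 * N%:R * z - z = m%:R * pi - z.
  by rewrite -Nth /z; field; rewrite pnatr_eq0 -lt0n.
by rewrite sinB sin_natpi mul0r sub0r; field.
Qed.

Lemma cos_natpi_parity (j k : nat) : (j <= k)%N ->
  cos ((k - j)%:R * pi) = cos ((k + j)%:R * pi) :> R.
Proof.
move=> jk; rewrite natrB// natrD mulrBl mulrDl cosB cosD.
by rewrite !sin_natpi mulr0 addr0 subr0.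
Qed.

Lemma sine_orthogonality (j k : nat) : (0 < j < N)%N -> (0 < k < N)%N ->
  \sum_(n < N) sin (n%:R * (j%:R * th)) * sin (n%:R * (k%:R * th)) =
  if j == k then N%:R / 2 else 0.
Proof.
wlog jk : j k / (j <= k)%N.
  move=> hw hj hk; have [/hw->//|/ltnW/hw] := leqP j k.
  by rewrite eq_sym => <- //; apply: eq_bigr => n _; rewrite mulrC.
move=> /andP[j0 jN] /andP[k0 kN].
have prod (n : nat) : sin (n%:R * (j%:R * th)) * sin (n%:R * (k%:R * th)) =
    (cos (n%:R * ((k - j)%:R * th)) - cos (n%:R * ((k + j)%:R * th))) / 2.
  rewrite natrB// natrD.
  have -> : n%:R * ((k%:R - j%:R) * th) = n%:R * (k%:R * th) - n%:R * (j%:R * th) by ring.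
  have -> : n%:R * ((k%:R + j%:R) * th) = n%:R * (k%:R * th) + n%:R * (j%:R * th) by ring.
  by rewrite cosB cosD; field.
under eq_bigr do rewrite prod.
rewrite -mulr_suml big_split /= sumrN.
rewrite (sum_cos_node (m := (k + j)%N)); last first.
  by lia.
case: eqVneq => [->|ne].
  rewrite subnn; under eq_bigr do rewrite mul0r mulr0 cos0.
  rewrite big_const_ord iter_addr_0 -[1 *+ N]/(N%:R).
  have -> : cos ((k + k)%:R * pi) = 1 :> R by rewrite -cos_natpi_parity// subnn mul0r cos0.
  by lra.
rewrite (sum_cos_node (m := (k - j)%N)); last first.
  rewrite subn_gt0 ltn_neqAle ne jk /=.
  by apply: leq_ltn_trans (leq_subr _ _) _; rewrite -addnn ltn_addr.
by rewrite cos_natpi_parity// subrr mul0r.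
Qed.

(** The coefficients of the trigonometric interpolation of [h] at the nodes. *)
Definition sine_coef h (n : nat) : R :=
  2 / N%:R * \sum_(j < N) h (j%:R * th) * sin (n%:R * (j%:R * th)).

(** By orthogonality of the sine vectors, the coefficients define the sine
    polynomial that takes the values of [h] at the nodes. *)
Lemma sine_interpolation h (k : nat) : (0 < k < N)%N ->
  \sum_(n < N) sine_coef h n * sin (n%:R * (k%:R * th)) = h (k%:R * th).
Proof.
move=> kN; have /andP[_ kltN] := kN.
have -> : \sum_(n < N) sine_coef h n * sin (n%:R * (k%:R * th)) =
    2 / N%:R * \sum_(j < N) h (j%:R * th) *
      \sum_(n < N) sin (n%:R * (j%:R * th)) * sin (n%:R * (k%:R * th)).
  rewrite mulr_sumr; under [RHS]eq_bigr do rewrite mulr_sumr mulr_sumr.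
  rewrite exchange_big /=; apply: eq_bigr => n _.
  rewrite /sine_coef mulr_sumr mulr_suml; apply: eq_bigr => j _; ring.
rewrite (bigD1 (Ordinal kltN)) //= sine_orthogonality// eqxx big1 ?addr0.
  by field; rewrite pnatr_eq0 -lt0n.
move=> j jk; have [j0|j0] := posnP j.
  rewrite j0; rewrite [X in _ * X]big1 ?mulr0// => n _.
  by rewrite mul0r mulr0 sin0 mul0r.
rewrite sine_orthogonality ?j0 ?ltn_ord// ifN ?mulr0//.
Qed.

Section Decay.
Variable h : R -> R.
Hypotheses (h_odd : forall x, h (- x) = - h x)
           (h_per : forall x, h (x + pi *+ 2) = h x).
Variable n : nat.

(** The sum over a full period, in which summation by parts leaves no boundary
    terms. *)
Definition full_sum (g : R -> R) : R :=
  \sum_(j < N.*2) g (j%:R * th) * sin (n%:R * (j%:R * th)).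

Let N2th : N.*2%:R * th = pi *+ 2.
Proof. by rewrite -muln2 natrM mulrAC Nth mulr_natr. Qed.

Lemma sum_period_shift (q : nat) (F : nat -> R) : F q = F 0%N ->
  \sum_(j < q) F j.+1 = \sum_(j < q) F j.
Proof.
move=> Fq; apply: (addrI (F 0%N)).
rewrite -(big_ord_recl q (fun j : 'I_q.+1 => F j)) big_ord_recr /= Fq addrC.
by [].
Qed.

Lemma sin_n2pi (x : R) : sin (n%:R * (pi *+ 2) + x) = sin x.
Proof.
have -> : n%:R * (pi *+ 2) = (n.*2)%:R * pi :> R by rewrite -muln2 natrM mulr2n; ring.
rewrite sinD sin_natpi mul0r add0r.
have -> : cos (n.*2%:R * pi) = 1 :> R by rewrite -addnn -cos_natpi_parity// subnn mul0r cos0.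
by rewrite mul1r.
Qed.

Lemma full_sum_half : full_sum h = 2 * \sum_(j < N) h (j%:R * th) * sin (n%:R * (j%:R * th)).
Proof.
pose g (j : nat) := h (j%:R * th) * sin (n%:R * (j%:R * th)).
have h0 : h 0 = 0 by have := h_odd 0; rewrite oppr0; lra.
have g0 : g 0%N = 0 by rewrite /g mul0r h0 mul0r.
have gN : g N = 0 by rewrite /g Nth sin_natpi mulr0.
(* By oddness and periodicity the nodes beyond pi repeat the terms before it. *)
have gsym (i : nat) : (i < N)%N -> g (N + (N - i.+1))%N = g i.+1.
  move=> iN; rewrite /g.
  have -> : (N + (N - i.+1))%:R * th = - (i.+1%:R * th) + pi *+ 2.
    by rewrite natrD natrB// mulrDl mulrBl !Nth; ring.
  by rewrite h_per h_odd mulrDr addrC sin_n2pi mulrN sinN mulrNN.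
rewrite /full_sum -addnn big_split_ord /= -/(g _).
have -> : \sum_(i < N) h ((N + i)%:R * th) * sin (n%:R * ((N + i)%:R * th)) =
    \sum_(i < N) g i.
  rewrite (reindex_inj rev_ord_inj) /=.
  under eq_bigr => i _ do rewrite -/(g (N + (N - i.+1))%N) gsym//.
  by apply: sum_period_shift; rewrite g0 gN.
rewrite -[X in X + _]/(\sum_(i < N) g i) -[X in _ = 2 * X]/(\sum_(i < N) g i).
by ring.
Qed.

Definition diff2 (e : R) (g : R -> R) (x : R) : R := g (x + e) + g (x - e) - 2 * g x.

(** Summation by parts: second differences at the spacing of the nodes act on the
    sampled sine by the scalar [2 cos (n th) - 2]. *)
Lemma full_sum_diff2 (g : R -> R) : (forall x, g (x + pi *+ 2) = g x) ->
  full_sum (diff2 th g) = - (2 - 2 * cos (n%:R * th)) * full_sum g.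
Proof.
move=> gper.
pose F (j : nat) := g (j%:R * th) * sin (n%:R * (j%:R * th - th)).
pose G (j : nat) := g (j%:R * th - th) * sin (n%:R * (j%:R * th)).
have Sth (j : nat) : j.+1%:R * th = j%:R * th + th by rewrite -natr1 mulrDl mul1r.
have FS : \sum_(j < N.*2) F j.+1 = \sum_(j < N.*2) F j.
  apply: sum_period_shift; rewrite /F N2th mul0r sub0r.
  rewrite -[pi *+ 2]add0r gper add0r mulrDr sin_n2pi.
  by [].
have GS : \sum_(j < N.*2) G j.+1 = \sum_(j < N.*2) G j.
  apply: sum_period_shift; rewrite /G N2th mul0r sub0r mulr0 sin0 mulr0.
  by have := sin_n2pi 0; rewrite addr0 sin0 => ->; rewrite mulr0.
have -> : full_sum (diff2 th g) =
    \sum_(j < N.*2) F j.+1 + \sum_(j < N.*2) G j - 2 * full_sum g.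
  rewrite /full_sum mulr_sumr -sumrN -!big_split /=; apply: eq_bigr => j _.
  by rewrite /F /G /diff2 Sth addrK; ring.
rewrite FS -GS.
have -> : \sum_(j < N.*2) F j + \sum_(j < N.*2) G j.+1 =
    2 * cos (n%:R * th) * full_sum g.
  rewrite /full_sum mulr_sumr -big_split /=; apply: eq_bigr => j _.
  by rewrite /F /G Sth addrK mulrBr mulrDr sinB sinD; ring.
ring.
Qed.

Lemma full_sum_iter K (g : R -> R) : (forall x, g (x + pi *+ 2) = g x) ->
  full_sum (iter K (diff2 th) g) = (- (2 - 2 * cos (n%:R * th))) ^+ K * full_sum g.
Proof.
elim: K g => [|K IH] g gper; first by rewrite expr0 mul1r.
rewrite iterSr IH.
  by rewrite full_sum_diff2// exprSr mulrA.
move=> x; rewrite /diff2 (addrAC x (pi *+ 2) th) (addrAC x (pi *+ 2) (- th)).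
by rewrite !gper.
Qed.

(** The discrete counterpart of the decay of Fourier coefficients: each second
    difference of [h] costs a factor of order [th^2] and gains one of order
    [(n th)^2], so that each pair of bounded derivatives gains [n^2]. *)
Lemma sine_coef_decay (K : nat) (M : R) : (n <= N)%N ->
  (forall x, `|iter K (diff2 th) h x| <= (th ^+ 2) ^+ K * M) ->
  `|sine_coef h n| * (n%:R ^+ 2) ^+ K <= 2 * M * 16 ^+ K.
Proof.
move=> nN hM.
have cE : sine_coef h n = full_sum h / N%:R.
  by rewrite full_sum_half /sine_coef; field; rewrite pnatr_eq0 -lt0n.
have Npos : 0 < N%:R :> R by rewrite ltr0n.
have x0 : 0 <= n%:R * th <= pi.
  apply/andP; split; first by rewrite mulr_ge0 ?(ltW th_gt0).
  by rewrite -[leRHS]Nth ler_wpM2r ?(ltW th_gt0)// ler_nat.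
have low := two_minus_cos_ge x0; set d := 2 - 2 * _ in low.
have d0 : 0 <= d by apply: le_trans low; rewrite divr_ge0// sqr_ge0.
have up : `|full_sum (iter K (diff2 th) h)| <= N.*2%:R * ((th ^+ 2) ^+ K * M).
  apply: le_trans (ler_norm_sum _ _ _) _.
  apply: le_trans (_ : \sum_(j < N.*2) (th ^+ 2) ^+ K * M <= _).
    apply: ler_sum => j _; rewrite normrM -[leRHS]mulr1.
    by apply: ler_pM => //; exact: sin_bound.
  by rewrite big_const_ord iter_addr_0 -[leLHS]mulr_natl.
rewrite full_sum_iter// normrM normrX normrN (ger0_norm d0) in up.
have tK : 0 < (th ^+ 2) ^+ K by rewrite !exprn_gt0.
have key : ((n%:R * th) ^+ 2 / 16) ^+ K <= d ^+ K.
  by rewrite lerXn2r ?nnegrE// divr_ge0// sqr_ge0.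
have key2 : ((n%:R * th) ^+ 2 / 16) ^+ K * `|full_sum h| <=
    N.*2%:R * ((th ^+ 2) ^+ K * M).
  by apply: le_trans up; rewrite ler_wpM2r.
rewrite cE normrM normfV (ger0_norm (ltW Npos)).
have e16 : 0 < 16 ^+ K :> R by rewrite exprn_gt0.
rewrite -(ler_pM2l tK) -(ler_pM2l Npos).
have -> : N%:R * ((th ^+ 2) ^+ K * (`|full_sum h| / N%:R * (n%:R ^+ 2) ^+ K)) =
   16 ^+ K * (((n%:R * th) ^+ 2 / 16) ^+ K * `|full_sum h|).
  have -> (t : R) : ((n%:R * t) ^+ 2 / 16) ^+ K = (n%:R ^+ 2) ^+ K * (t ^+ 2) ^+ K / 16 ^+ K.
    by rewrite expr_div_n (exprMn 2) (exprMn K (n%:R ^+ 2) (t ^+ 2)).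
  move: (th ^+ 2 ^+ K) (n%:R ^+ 2 ^+ K) e16 => u v.
  by move: (16 ^+ K) => w w0; field; rewrite (gt_eqF w0) (gt_eqF Npos).
have -> : N%:R * ((th ^+ 2) ^+ K * (2 * M * 16 ^+ K)) =
   16 ^+ K * (N.*2%:R * ((th ^+ 2) ^+ K * M)).
  by rewrite -muln2 natrM; ring.
by rewrite ler_wpM2l// ltW.
Qed.

End Decay.
End SineTransform.

(** The Chebyshev polynomials of the second kind, evaluated in an arbitrary ring by
    their three-term recurrence. *)
Fixpoint chebU (A : pzRingType) (x : A) (n : nat) : A :=
  match n with
  | 0 => 1
  | n1.+1 => match n1 with
             | 0 => x + x
             | n2.+1 => (x + x) * chebU x n1 - chebU x n2
             end
  end.

Lemma chebUSS (A : pzRingType) (x : A) n :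
  chebU x n.+2 = (x + x) * chebU x n.+1 - chebU x n.
Proof. by []. Qed.

Lemma chebU_rmorph (A B : pzRingType) (phi : {rmorphism A -> B}) (x : A) n :
  phi (chebU x n) = chebU (phi x) n.
Proof.
elim/ltn_ind: n => -[|[|n]] IH; first by rewrite rmorph1.
  by rewrite /= rmorphD.
by rewrite !chebUSS rmorphB rmorphM rmorphD !IH.
Qed.

Section ChebyshevApproximation.
Context {R : realType}.
Implicit Types (f g h : R -> R).

(** This identity turns a sine polynomial in the angle into a Chebyshev sum times
    the sine. *)
Lemma chebU_sin (x : R) n : chebU (cos x) n * sin x = sin (n.+1%:R * x).
Proof.
elim/ltn_ind: n => -[|[|n]] IH; first by rewrite /= mul1r mul1r.
  by rewrite /= mulr_natl sin_mulr2n -mulr_natl; ring.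
rewrite chebUSS mulrBl -mulrA !IH//.
have -> : n.+3%:R * x = n.+2%:R * x + x by rewrite -natr1 mulrDl mul1r.
have -> : n.+1%:R * x = n.+2%:R * x - x by rewrite -[n.+2%:R]natr1 mulrDl mul1r addrK.
by rewrite sinB sinD; ring.
Qed.

Lemma sin_acos_ge_half (t : R) : `|t| <= 2^-1 -> 2^-1 <= sin (acos t).
Proof.
move=> t2.
have tI : -1 <= t <= 1 by move: t2; rewrite ler_norml => /andP[? ?]; apply/andP; split; lra.
rewrite sin_acos// -(@ler_pXn2r _ 2) ?nnegrE ?sqrtr_ge0 ?invr_ge0//.
have tt : t ^+ 2 <= 4^-1.
  rewrite -real_normK ?num_real//.
  apply: le_trans (_ : (2^-1) ^+ 2 <= _); first by rewrite lerXn2r ?nnegrE ?invr_ge0.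
  by rewrite expr2; lra.
by rewrite sqr_sqrtr ?subr_ge0 ?[2^-1 ^+ 2]expr2; lra.
Qed.

(** On the half interval the sine of the angle is at least 1/2. *)
Lemma chebU_bound (t : R) n : `|t| <= 2^-1 -> `|chebU t n| <= 2.
Proof.
move=> t2.
have tI : -1 <= t <= 1 by move: t2; rewrite ler_norml => /andP[? ?]; apply/andP; split; lra.
have s2 := sin_acos_ge_half t2.
have := chebU_sin (acos t) n; rewrite acosK ?in_itv//= => hE.
have : `|chebU t n * sin (acos t)| <= 1 by rewrite hE sin_bound.
rewrite normrM [`|sin _|]ger0_norm; last by lra.
move=> h; have := ler_wpM2l (normr_ge0 (chebU t n)) s2; lra.
Qed.

Lemma sum_inv_sq (q : nat) : \sum_(k < q) (k.+1%:R ^+ 2)^-1 <= 2 :> R.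
Proof.
case: q => [|q]; first by rewrite big_ord0.
suff : \sum_(k < q.+1) (k.+1%:R ^+ 2)^-1 <= 2 - (q.+1%:R)^-1 :> R.
  by move/le_trans; apply; rewrite gerBl invr_ge0.
elim: q => [|q IH]; first by rewrite big_ord_recr big_ord0 /= expr1n invr1; lra.
rewrite big_ord_recr /=; apply: le_trans (lerD IH (lexx _)) _.
have u0 : 0 < q.+1%:R :> R by rewrite ltr0n.
rewrite -[q.+2%:R]natr1; move: (q.+1%:R : R) u0 => u u0.
have v0 : 0 < u + 1 by lra.
have -> : 2 - (u + 1)^-1 = 2 - u^-1 + u^-1 * (u + 1)^-1.
  by field; rewrite !gt_eqF.
rewrite lerD2l -invfM lef_pV2 ?posrE ?exprn_gt0 ?mulr_gt0//.
by rewrite expr2 ler_wpM2r; lra.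
Qed.

Lemma has_deriv_shift f f' (e : R) : has_deriv f f' ->
  has_deriv (fun x => f (x + e)) (fun x => f' (x + e)).
Proof.
move=> ff'; have d1 : has_deriv (fun x : R => x + e) (cst 1 + cst 0).
  exact: has_derivD has_deriv_id (has_deriv_cst e).
move=> x; have := has_deriv_comp ff' d1 x; rewrite /= => /is_derive_eq; apply.
by rewrite -[LHS]/(f' (x + e) * (1 + 0)) addr0 mulr1.
Qed.

Lemma has_deriv_diff2 f f' (e : R) : has_deriv f f' ->
  has_deriv (diff2 e f) (diff2 e f').
Proof.
move=> ff'.
have h := has_derivD (has_derivD (has_deriv_shift e ff') (has_deriv_shift (- e) ff'))
  (has_derivM (has_deriv_cst (-2)) ff').
move=> x; have := h x.
have -> : diff2 e f = (fun x => f (x + e)) + (fun x => f (x - e)) + cst (-2) * f.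
  by apply/funext => y; rewrite /diff2 -[RHS]/(f (y + e) + f (y - e) + (-2) * f y); ring.
move=> /is_derive_eq; apply.
rewrite /diff2 -[LHS]/(f' (x + e) + f' (x - e) + (-2 * f' x + f x * 0)); ring.
Qed.

Lemma has_deriv_iter_diff2 K f f' (e : R) : has_deriv f f' ->
  has_deriv (iter K (diff2 e) f) (iter K (diff2 e) f').
Proof. by move=> ff'; elim: K => [//|K IH]; exact: has_deriv_diff2. Qed.

(** Apply the mean value inequality twice. *)
Lemma diff2_bound f f' f'' (e B : R) : has_deriv f f' -> has_deriv f' f'' ->
  0 <= e -> (forall x, `|f'' x| <= B) -> forall x, `|diff2 e f x| <= e ^+ 2 * B.
Proof.
move=> ff' f'f'' e0 hB x.
pose psi := (fun x => f (x + e)) + (cst (-1) * f).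
have dpsi : has_deriv psi (fun x => f' (x + e) - f' x).
  move=> y; have := has_derivD (has_deriv_shift e ff') (has_derivM (has_deriv_cst (-1)) ff') y.
  move=> /is_derive_eq; apply.
  by rewrite -[LHS]/(f' (y + e) + (-1 * f' y + f y * 0)); ring.
have bpsi y : `|f' (y + e) - f' y| <= B * e.
  by apply: le_trans (MVT_lipschitz f'f'' hB _ _) _; rewrite [y + e]addrC addrK ger0_norm.
have -> : diff2 e f x = psi x - psi (x - e).
  by rewrite /diff2 -[RHS]/(f (x + e) + (-1) * f x - (f (x - e + e) + (-1) * f (x - e))) subrK; ring.
apply: le_trans (MVT_lipschitz dpsi bpsi _ _) _.
by rewrite opprB addrC subrK ger0_norm// expr2 mulrC mulrAC mulrA.
Qed.

Lemma iter_diff2_bound K h : Bn K.*2 h ->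
  exists M : R, forall e x, 0 <= e -> `|iter K (diff2 e) h x| <= (e ^+ 2) ^+ K * M.
Proof.
elim: K h => [|K IH] h; first by case=> [[M hM] _]; exists M => e x _; rewrite expr0 mul1r.
rewrite doubleS => -[_ [h1 dh1 [_ [h2 dh2 /IH[M hM]]]]]; exists M => e x e0.
rewrite iterS exprS -mulrA.
apply: (diff2_bound (has_deriv_iter_diff2 K e dh1) (has_deriv_iter_diff2 K e dh2) e0).
by move=> y; exact: hM.
Qed.

(** The derivative of the sum is dominated by the sum of [C / n^2]. *)
Lemma sine_sum_lipschitz (N : nat) (b : nat -> R) (C : R) :
  (forall n, (0 < n < N)%N -> `|b n| * n%:R * n%:R ^+ 2 <= C) -> 0 <= C ->
  forall x y, `|\sum_(n < N) b n * sin (n%:R * x) - \sum_(n < N) b n * sin (n%:R * y)|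
    <= 2 * C * `|x - y|.
Proof.
move=> hb C0 x y; rewrite -sumrB.
apply: le_trans (ler_norm_sum _ _ _) _.
apply: le_trans (_ : \sum_(n < N) (`|b n| * n%:R) * `|x - y| <= _).
  apply: ler_sum => n _; rewrite -mulrBr normrM -mulrA ler_wpM2l//.
  by apply: le_trans (sin_lipschitz _ _ _) _; rewrite ger0_norm.
rewrite -mulr_suml ler_wpM2r//.
case: N hb => [|N] hb; first by rewrite big_ord0 mulr_ge0.
rewrite big_ord_recl /= mulr0 add0r.
apply: le_trans (_ : \sum_(n < N) C * (n.+1%:R ^+ 2)^-1 <= _).
  apply: ler_sum => n _; rewrite ler_pdivlMr ?exprn_gt0 ?ltr0n//.
  by apply: hb; rewrite /= ltnS ltn_ord.
by rewrite -mulr_sumr mulrC ler_wpM2r// sum_inv_sq.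
Qed.

(** Put [h x = g (cos x) sin x]. The sine polynomial [P] interpolating [h] at the
    [N] nodes has coefficients that decay at the rate given by the derivatives of
    [h]. Since [h] and [P] agree at the nodes and are Lipschitz with constants not
    depending on [N], they differ by [O(1 / N)] everywhere, and dividing by the sine
    turns [P] into a Chebyshev sum. *)
Lemma chebyshev_interpolation (K : nat) g : Cn K.+2.*2 g ->
  exists C : R, forall N, (0 < N)%N -> exists c : nat -> R,
    (forall n, `|c n| * n.+1%:R ^+ K <= C) /\
    forall t, `|t| <= 2^-1 -> `|g t - \sum_(n < N.-1) c n * chebU t n| <= C / N%:R.
Proof.
set K' := K.+2 => gC; pose h := (g \o cos) * sin.
have hB : Bn K'.*2 h by apply: BnM; [exact: Bn_comp_cos | exact: (Bn_sin_cos _).1].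
have h_odd x : h (- x) = - h x by rewrite /h -[LHS]/(g (cos (- x)) * sin (- x)) cosN sinN mulrN.
have h_per x : h (x + pi *+ 2) = h x.
  by rewrite /h -[LHS]/(g (cos (x + pi *+ 2)) * sin (x + pi *+ 2)) cosD2pi sinD2pi.
have [M hM] := iter_diff2_bound hB.
have M0 : 0 <= M by have := hM 1 0 ler01; rewrite !expr1n mul1r; apply: le_trans.
have [_ [h' dh [[L hL] _]]] : Bn 1 h by apply: derivs_in_le hB.
have L0 : 0 <= L by apply: le_trans (hL 0).
pose C1 := 2 * M * 16 ^+ K'.
have C10 : 0 <= C1 by rewrite mulr_ge0 ?exprn_ge0 ?mulr_ge0.
have pi0 := pi_ge0 R.
pose C := C1 + 2 * (L + 2 * C1) * pi.
have CC1 : C1 <= C by rewrite lerDl !mulr_ge0// addr_ge0// mulr_ge0.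
exists C => N N0.
have Npos : 0 < N%:R :> R by rewrite ltr0n.
pose th : R := pi / N%:R.
have th0 : 0 < th by rewrite divr_gt0 ?pi_gt0.
have Nth : N%:R * th = pi by rewrite mulrC divfK// gt_eqF.
pose b n := sine_coef N h n.
have bdec n : (n <= N)%N -> `|b n| * (n%:R ^+ 2) ^+ K' <= C1.
  by move=> nN; apply: sine_coef_decay => // x; apply: hM; exact: ltW.
(* The sine of [n.+1] times the angle is that of [chebU _ n]. *)
pose c n := if (n.+1 <= N)%N then b n.+1 else 0.
exists c; split.
  move=> n; rewrite /c; case: ifP => [nN|_]; last first.
    by rewrite normr0 mul0r (le_trans C10).
  apply: le_trans CC1; apply: le_trans (bdec _ nN); rewrite ler_wpM2l// -exprM.
  rewrite ler_weXn2l ?ler1n// mul2n -addnn.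
  by apply: leq_trans (leq_addr _ _); exact: leqW (leqnSn K).
move=> t t2.
have tI : -1 <= t <= 1 by move: t2; rewrite ler_norml => /andP[? ?]; apply/andP; split; lra.
set x := acos t; have s2 : 2^-1 <= sin x := sin_acos_ge_half t2.
pose P y := \sum_(n < N) b n * sin (n%:R * y).
have PE : P x = (\sum_(n < N.-1) c n * chebU t n) * sin x.
  rewrite /P; case: (N) N0 @c => // q _ /=.
  rewrite big_ord_recl /= mul0r sin0 mulr0 add0r mulr_suml.
  apply: eq_bigr => n _; rewrite ltnS (ltnW (ltn_ord n)) -mulrA; congr (_ * _).
  by rewrite -[t in chebU t](acosK (x := t)) ?in_itv// chebU_sin.
have hE : h x = g t * sin x by rewrite -[LHS]/(g (cos x) * sin x) acosK ?in_itv.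
have lipP := @sine_sum_lipschitz N b C1 _ C10.
have {}lipP y z : `|P y - P z| <= 2 * C1 * `|y - z|.
  apply: lipP => n /andP[n0 nN]; apply: le_trans (bdec _ (ltnW nN)).
  rewrite -mulrA ler_wpM2l// -exprS -exprM ler_weXn2l ?ler1n//.
  by rewrite !mulnS.
have lipH y z : `|h y - h z| <= L * `|y - z| := MVT_lipschitz dh hL y z.
have x0 : 0 <= x by exact: acos_ge0.
have xpi : x <= pi by exact: acos_lepi.
(* Compare with the last node before [x]. *)
pose k := Num.truncn (x / th).
have /andP[kl ku] : k%:R <= x / th < k.+1%:R.
  by apply: Num.Theory.truncn_itv; rewrite divr_ge0// ltW.
have xk : `|x - k%:R * th| <= th.
  move: kl ku; rewrite ler_pdivlMr// ltr_pdivrMr// -natr1 mulrDl mul1r => kl ku.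
  by rewrite ger0_norm; lra.
have kN : (k <= N)%N.
  rewrite -(ler_nat R); apply: le_trans kl _.
  by rewrite ler_pdivrMr// Nth.
(* At both ends of [0, pi] the two functions vanish; at the inner nodes [P]
   interpolates [h]. *)
have node : h (k%:R * th) = P (k%:R * th).
  have [k0|k0] := posnP k.
    rewrite k0 mul0r /h -[LHS]/(g (cos 0) * sin 0) sin0 mulr0 /P big1// => n _.
    by rewrite mulr0 sin0 mulr0.
  move: kN; rewrite leq_eqVlt => /orP[/eqP kN|kN].
    rewrite kN Nth /h -[LHS]/(g (cos pi) * sin pi) sinpi mulr0 /P big1// => n _.
    by rewrite sin_natpi mulr0.
  by rewrite /P sine_interpolation// k0.
have err : `|h x - P x| <= (L + 2 * C1) * th.
  have -> : h x - P x = (h x - h (k%:R * th)) + (P (k%:R * th) - P x).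
    by rewrite node addrA subrK.
  apply: le_trans (ler_normD _ _) _; rewrite mulrDl; apply: lerD.
    by apply: le_trans (lipH _ _) _; rewrite ler_wpM2l.
  by apply: le_trans (lipP _ _) _; rewrite distrC ler_wpM2l// mulr_ge0.
rewrite hE PE -mulrBl normrM (ger0_norm (le_trans _ s2)) ?invr_ge0// in err.
set D := `|_| in err *.
have D2 : D <= 2 * ((L + 2 * C1) * th).
  have := ler_wpM2l (normr_ge0 _ : 0 <= D) s2; lra.
apply: le_trans D2 _; rewrite /th /C mulrDl.
have := divr_ge0 C10 (ltW Npos); rewrite !mulrA; lra.
Qed.

(** The function is first cut off, to be of class C^n on the whole line, and
    rescaled, to bring [sigma] into the half interval. The order [n] depends on the
    rate [K]. *)
Lemma chebyshev_approximation f (sigma O : set R) (lam : R) :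
  compact sigma -> open O -> sigma `<=` O -> 0 < lam ->
  (forall t, sigma t -> `|t| <= lam / 2) ->
  (forall k x, O x -> derivable (derive1n k f) x 1) ->
  forall K : nat, exists C : R, forall e : R, 0 < e -> exists N (c : nat -> R),
    (forall n, `|c n| * n.+1%:R ^+ K <= C) /\
    forall t, sigma t -> `|f t - \sum_(n < N) c n * chebU (t / lam) n| <= e.
Proof.
move=> csig oO sO lam0 s2 fO K.
have [chi [chiC chi1 chi0]] := cutoff_exists K.+2.*2.+1 csig oO sO.
have gC : Cn K.+2.*2 ((chi * f) \o (cst lam * id)).
  by apply: Cn_comp; [exact: Cn_cutoff chiC chi0 fO | exact: CnM (Cn_cst _ _) (Cn_id _)].
have [C hC] := chebyshev_interpolation gC.
exists C => e e0.
have [N N0 CN] : exists2 N, (0 < N)%N & C / N%:R <= e.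
  exists (Num.truncn (`|C| / e)).+1 => //.
  rewrite ler_pdivrMr ?ltr0n// mulrC -ler_pdivrMr//.
  apply: le_trans (_ : `|C| / e <= _); first by rewrite ler_wpM2r ?ler_norm// invr_ge0 ltW.
  by rewrite ltW// Num.Theory.truncnS_gt.
have [c [cd cg]] := hC N N0; exists N.-1, c; split=> // t st.
have tl : `|t / lam| <= 2^-1.
  by rewrite normrM normfV (gtr0_norm lam0) ler_pdivrMr// mulrC; exact: s2.
apply: le_trans CN; have := cg (t / lam) tl.
rewrite -[X in `|X - _|]/(chi (lam * (t / lam)) * f (lam * (t / lam))).
have -> : lam * (t / lam) = t by rewrite mulrC divfK// gt_eqF.
by rewrite chi1// mul1r.
Qed.

End ChebyshevApproximation.

(** * Weighted operator norms of Chebyshev polynomials *)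

(** A derivation turns the three-term recurrence into an inhomogeneous one, whose
    solution is the convolution of the inhomogeneity [(delta x + delta x) U_m(x)]
    with the Chebyshev polynomials themselves. That there are only [n] summands is
    what makes derivatives of Chebyshev polynomials grow polynomially. *)
Lemma chebU_derivation (A : pzRingType) (delta : A -> A) (x : A) n :
  (forall y z, delta (y + z) = delta y + delta z) ->
  (forall y z, delta (y * z) = delta y * z + y * delta z) ->
  delta (chebU x n) =
  \sum_(m < n) chebU x (n - m.+1) * (delta x + delta x) * chebU x m.
Proof.
move=> dD dM.
have d0 : delta 0 = 0 by apply: (addrI (delta 0)); rewrite -dD !addr0.
have dN y : delta (- y) = - delta y.
  by apply: (addrI (delta y)); rewrite -dD !subrr.
have d1 : delta 1 = 0.
  by apply: (addrI (delta 1)); rewrite addr0 -[in RHS](mulr1 1) dM mulr1 mul1r.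
elim/ltn_ind: n => -[|[|n]] IH; first by rewrite big_ord0 d1.
  by rewrite big_ord_recr big_ord0 /= dD add0r mul1r mulr1.
rewrite chebUSS dD dN dM dD (IH n.+1)// (IH n)//.
set d := delta x + delta x.
(* The two last terms are split off; in the others the recurrence applies to the
   first factor. *)
rewrite [in RHS]big_ord_recr /= [in RHS]big_ord_recr /= subnn mul1r.
rewrite [X in d * _ + X - _](_ : _ = (x + x) *
    \sum_(m < n) chebU x (n.+1 - m.+1) * d * chebU x m + (x + x) * (d * chebU x n)).
  rewrite subSS subSnn /=.
  have -> : \sum_(i < n) chebU x (n.+2 - i.+1) * d * chebU x i =
      (x + x) * (\sum_(m < n) chebU x (n.+1 - m.+1) * d * chebU x m) -
      \sum_(m < n) chebU x (n - m.+1) * d * chebU x m.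
    rewrite mulr_sumr -sumrB; apply: eq_bigr => i _.
    have -> : (n.+2 - i.+1 = (n - i.+1).+2)%N by have := ltn_ord i; lia.
    have -> : (n.+1 - i.+1 = (n - i.+1).+1)%N by have := ltn_ord i; lia.
    by rewrite chebUSS mulrBl mulrBl !mulrA.
  by rewrite [RHS]addrC [X in _ = _ + X]addrAC [RHS]addrA (mulrA (x + x) d).
by rewrite big_ord_recr /= subnn mul1r mulrDr.
Qed.

Section WeightedNorms.
Context {R : realType}.
Implicit Types (x y s L W : bop R).

Definition del L x := L * x - x * L.

Lemma delD L x y : del L (x + y) = del L x + del L y.
Proof. by rewrite /del mulrDl mulrDr opprD addrACA. Qed.

Lemma delM L x y : del L (x * y) = del L x * y + x * del L y.
Proof. by rewrite /del mulrBl mulrBr !mulrA addrA subrK. Qed.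

Lemma delZ L c x : del L (c *: x) = c *: del L x.
Proof. by rewrite /del -scalerAl -scalerAr scalerBr. Qed.

Lemma del0 L : del L 0 = 0.
Proof. by rewrite /del mulr0 mul0r subrr. Qed.

Lemma del_sum L (n : nat) (F : nat -> bop R) :
  del L (\sum_(i < n) F i) = \sum_(i < n) del L (F i).
Proof.
elim: n => [|n IH]; first by rewrite !big_ord0 del0.
by rewrite !big_ord_recr /= delD IH.
Qed.

(** It controls [x] and its first [k] commutators with [L]. Defined by this
    recursion it is submultiplicative without binomial coefficients. *)
Fixpoint comm_norm L (k : nat) x : R :=
  if k is k'.+1 then comm_norm L k' x + comm_norm L k' (del L x) else opn x.

(** It controls the operators [L^i s L^j] with [i + j <= p]; for a weight [L] that
    grows these measure the decay of all entries of [s]. *)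
Fixpoint smoothing_norm L (p : nat) s : R :=
  if p is q.+1 then
    smoothing_norm L q s + smoothing_norm L q (L * s) + smoothing_norm L q (s * L)
  else opn s.

Lemma comm_norm_ge0 L k x : 0 <= comm_norm L k x.
Proof. by elim: k x => [|k IH] x /=; [exact: opn_ge0 | rewrite addr_ge0]. Qed.

Lemma smoothing_norm_ge0 L p s : 0 <= smoothing_norm L p s.
Proof. by elim: p s => [|p IH] s /=; [exact: opn_ge0 | rewrite !addr_ge0]. Qed.

Lemma comm_normD L k x y : comm_norm L k (x + y) <= comm_norm L k x + comm_norm L k y.
Proof.
elim: k x y => [|k IH] x y /=; first exact: opnD.
by rewrite delD; have := IH x y; have := IH (del L x) (del L y); lra.
Qed.

Lemma comm_normZ L k c x : comm_norm L k (c *: x) <= normc c * comm_norm L k x.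
Proof.
elim: k x => [|k IH] x /=; first exact: opnZ.
by rewrite delZ mulrDr lerD.
Qed.

Lemma comm_norm0 L k : comm_norm L k 0 = 0.
Proof. by elim: k => [|k IH] /=; rewrite ?opn0// del0 IH addr0. Qed.

Lemma comm_norm_sum L k n (F : nat -> bop R) :
  comm_norm L k (\sum_(i < n) F i) <= \sum_(i < n) comm_norm L k (F i).
Proof.
elim: n => [|n IH]; first by rewrite !big_ord0 comm_norm0.
by rewrite !big_ord_recr /=; apply: le_trans (comm_normD _ _ _ _) _; rewrite lerD2r.
Qed.

Lemma comm_normM L k x y : comm_norm L k (x * y) <= comm_norm L k x * comm_norm L k y.
Proof.
elim: k x y => [|k IH] x y /=; first exact: opnM.
rewrite delM; have h1 := IH x y; have h2 := IH (del L x) y; have h3 := IH x (del L y).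
have h4 := comm_normD L k (del L x * y) (x * del L y).
have h5 := mulr_ge0 (comm_norm_ge0 L k (del L x)) (comm_norm_ge0 L k (del L y)).
nra.
Qed.

Lemma opn_le_comm_norm L k x : opn (iter k (del L) x) <= comm_norm L k x.
Proof.
elim: k x => [//|k IH] x /=.
by rewrite -iterS iterSr; apply: le_trans (IH _) _; rewrite lerDr comm_norm_ge0.
Qed.

Lemma smoothing_normD L p s t :
  smoothing_norm L p (s + t) <= smoothing_norm L p s + smoothing_norm L p t.
Proof.
elim: p s t => [|p IH] s t /=; first exact: opnD.
rewrite mulrDl mulrDr.
by have := IH s t; have := IH (L * s) (L * t); have := IH (s * L) (t * L); lra.
Qed.

Lemma smoothing_normZ L p c s : smoothing_norm L p (c *: s) <= normc c * smoothing_norm L p s.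
Proof.
elim: p s => [|p IH] s /=; first exact: opnZ.
by rewrite -scalerAl -scalerAr !mulrDr !lerD.
Qed.

Lemma smoothing_norm0 L p : smoothing_norm L p 0 = 0.
Proof. by elim: p => [|p IH] /=; rewrite ?opn0// mulr0 mul0r IH !addr0. Qed.

Lemma smoothing_norm_sum L p n (F : nat -> bop R) :
  smoothing_norm L p (\sum_(i < n) F i) <= \sum_(i < n) smoothing_norm L p (F i).
Proof.
elim: n => [|n IH]; first by rewrite !big_ord0 smoothing_norm0.
by rewrite !big_ord_recr /=; apply: le_trans (smoothing_normD _ _ _ _) _; rewrite lerD2r.
Qed.

(** Smoothing operators form an ideal: [L] is moved past [x] at the cost of
    a commutator, [L x = x L + [L, x]]. *)
Lemma smoothing_normM L p x s y : smoothing_norm L p (x * s * y) <=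
  comm_norm L p x * smoothing_norm L p s * comm_norm L p y.
Proof.
elim: p x s y => [|p IH] x s y /=.
  apply: le_trans (opnM _ _) _; rewrite ler_wpM2r ?opn_ge0//; exact: opnM.
have -> : L * (x * s * y) = x * (L * s) * y + del L x * s * y.
  by rewrite /del !mulrBl !mulrA addrC subrK.
have -> : x * s * y * L = x * (s * L) * y - x * s * del L y.
  by rewrite /del !mulrBr !mulrA opprB addrC subrK.
have g x' := comm_norm_ge0 L p x'; have g' s' := smoothing_norm_ge0 L p s'.
have h1 := IH x s y; have h2 := IH x (L * s) y; have h3 := IH (del L x) s y.
have h4 := IH x (s * L) y; have h5 := IH x s (del L y).
have h6 := smoothing_normD L p (x * (L * s) * y) (del L x * s * y).
have h7 := smoothing_normD L p (x * (s * L) * y) (- (x * s * del L y)).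
have h8 : smoothing_norm L p (- (x * s * del L y)) <= smoothing_norm L p (x * s * del L y).
  by rewrite -scaleN1r; apply: le_trans (smoothing_normZ _ _ _ _) _; rewrite normcNr normc1 mul1r.
move: h1 h2 h3 h4 h5 h6 h7 h8.
move: (g x) (g y) (g (del L x)) (g (del L y)) (g' s) (g' (L * s)) (g' (s * L)).
move: (comm_norm L p x) (comm_norm L p y) (comm_norm L p (del L x))
  (comm_norm L p (del L y)) (smoothing_norm L p s) (smoothing_norm L p (L * s))
  (smoothing_norm L p (s * L)) => a b a' b' t t1 t2 a0 b0 a'0 b'0 t0 t10 t20.
have -> : (a + a') * (t + t1 + t2) * (b + b') =
  a * t * b + a * t1 * b + a' * t * b + a * t2 * b + a * t * b' +
  (a' * t1 * b + a' * t2 * b + a' * t * b' + a' * t1 * b' + a' * t2 * b' +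
   a * t1 * b' + a * t2 * b') by ring.
have : 0 <= a' * t1 * b + a' * t2 * b + a' * t * b' + a' * t1 * b' + a' * t2 * b' +
   a * t1 * b' + a * t2 * b' by rewrite !addr_ge0// !mulr_ge0.
lra.
Qed.

Lemma opn_le_smoothing_norm L i j s :
  opn (L ^+ i * s * L ^+ j) <= smoothing_norm L (i + j) s.
Proof.
elim: i s => [|i IH] s.
  rewrite mul1r add0n; elim: j s => [|j IH] s; first by rewrite mulr1.
  rewrite exprS mulrA /=; apply: le_trans (IH _) _.
  by rewrite lerDr addr_ge0 ?smoothing_norm_ge0.
rewrite exprSr -mulrA addSn /=.
have := IH (L * s); rewrite !mulrA => /le_trans; apply.
by rewrite addrAC lerDr addr_ge0 ?smoothing_norm_ge0.
Qed.

Section ChebyshevGrowth.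
Variables (F : set (bop R)) (x : bop R).
Hypothesis x_cheb : forall n, opn (chebU x n) <= 2.
Hypothesis x_comm : forall k, exists B, forall L, F L -> comm_norm L k x <= B.

(** By induction on [k], the step being [chebU_derivation] for the commutator with
    [L]. The bound is uniform over a family [F] of operators [L], as it will be used
    for bounded truncations of an unbounded weight. *)
Lemma comm_norm_chebU k : exists (C : R) (q : nat), 0 <= C /\
  forall L n, F L -> comm_norm L k (chebU x n) <= C * n.+1%:R ^+ q.
Proof.
elim: k => [|k [C [q [C0 hC]]]].
  by exists 2, 0%N; split=> // L n _; rewrite expr0 mulr1; exact: x_cheb.
have [B hB] := x_comm k.+1.
pose B' := `|B|; have B0 : 0 <= B' := normr_ge0 B.
exists (C + C * (B' + B') * C), (q + q).+1; split.
  by rewrite addr_ge0// !mulr_ge0// addr_ge0.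
move=> L n FL /=.
have n1 : 1 <= n.+1%:R :> R by rewrite ler1n.
rewrite mulrDl; apply: lerD.
  by apply: le_trans (hC L n FL) _; rewrite ler_wpM2l// ler_weXn2l//; lia.
rewrite (chebU_derivation _ _ (delD L) (delM L)).
apply: le_trans (comm_norm_sum L k n (fun m => chebU x (n - m.+1) * (del L x + del L x) * chebU x m)) _.
apply: le_trans (_ : \sum_(m < n) (C * (B' + B') * C) * n.+1%:R ^+ (q + q) <= _); last first.
  rewrite big_const_ord iter_addr_0 -[leLHS]mulr_natl exprS mulrCA.
  rewrite ler_wpM2l ?mulr_ge0 ?addr_ge0// ler_wpM2r ?exprn_ge0// ler_nat//.
apply: ler_sum => m _.
have dB : comm_norm L k (del L x + del L x) <= B' + B'.
  apply: le_trans (comm_normD _ _ _ _) _; have := hB L FL => /= h.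
  have := comm_norm_ge0 L k x; have := ler_norm B; rewrite -/B'; lra.
have bnd (i : nat) : (i <= n)%N -> comm_norm L k (chebU x i) <= C * n.+1%:R ^+ q.
  move=> i_n; apply: le_trans (hC L i FL) _; rewrite ler_wpM2l//.
  by rewrite lerXn2r ?nnegrE ?ler0n// ler_nat.
apply: le_trans (comm_normM _ _ _ _) _.
apply: le_trans (_ : (C * n.+1%:R ^+ q * (B' + B')) * (C * n.+1%:R ^+ q) <= _); last first.
  by rewrite exprD le_eqVlt; apply/orP; left; apply/eqP; ring.
apply: ler_pM; rewrite ?comm_norm_ge0//; last by apply: bnd; exact: ltnW (ltn_ord m).
apply: le_trans (comm_normM _ _ _ _) _.
by apply: ler_pM; rewrite ?comm_norm_ge0//; apply: bnd; exact: leq_subr.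
Qed.

Variable W : bop R.
Hypothesis x_smoothing : forall p, exists B, forall L, F L ->
  smoothing_norm L p (del W x) <= B.

(** Here [chebU_derivation] is applied to the commutator with [W]: each summand has
    the smoothing factor [del W x] between two Chebyshev polynomials. *)
Lemma smoothing_norm_chebU p : exists (C : R) (q : nat), 0 <= C /\
  forall L n, F L -> smoothing_norm L p (del W (chebU x n)) <= C * n.+1%:R ^+ q.
Proof.
have [C [q [C0 hC]]] := comm_norm_chebU p.
have [B hB] := x_smoothing p.
pose B' := `|B|; have B0 : 0 <= B' := normr_ge0 B.
exists (C * (B' + B') * C), (q + q).+1; split.
  by rewrite !mulr_ge0// addr_ge0.
move=> L n FL.
rewrite (chebU_derivation _ _ (delD W) (delM W)).
apply: le_trans (smoothing_norm_sum L p n (fun m => chebU x (n - m.+1) * (del W x + del W x) * chebU x m)) _.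
apply: le_trans (_ : \sum_(m < n) (C * (B' + B') * C) * n.+1%:R ^+ (q + q) <= _); last first.
  rewrite big_const_ord iter_addr_0 -[leLHS]mulr_natl exprS mulrCA.
  rewrite ler_wpM2l ?mulr_ge0 ?addr_ge0// ler_wpM2r ?exprn_ge0// ler_nat//.
apply: ler_sum => m _.
have dB : smoothing_norm L p (del W x + del W x) <= B' + B'.
  apply: le_trans (smoothing_normD _ _ _ _) _; have h := hB L FL.
  have := ler_norm B; rewrite -/B'; lra.
have bnd (i : nat) : (i <= n)%N -> comm_norm L p (chebU x i) <= C * n.+1%:R ^+ q.
  move=> i_n; apply: le_trans (hC L i FL) _; rewrite ler_wpM2l//.
  by rewrite lerXn2r ?nnegrE ?ler0n// ler_nat.
apply: le_trans (smoothing_normM _ _ _ _ _) _.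
apply: le_trans (_ : (C * n.+1%:R ^+ q * (B' + B')) * (C * n.+1%:R ^+ q) <= _); last first.
  by rewrite exprD le_eqVlt; apply/orP; left; apply/eqP; ring.
apply: ler_pM; rewrite ?mulr_ge0 ?comm_norm_ge0 ?smoothing_norm_ge0//;
  last by apply: bnd; exact: ltnW (ltn_ord m).
by apply: ler_pM; rewrite ?comm_norm_ge0 ?smoothing_norm_ge0//; apply: bnd; exact: leq_subr.
Qed.

Lemma decaying_sum_bound (c : nat -> R[i]) (C C' : R) (q N : nat) (T : nat -> R) :
  0 <= C -> 0 <= C' -> (forall n, normc (c n) * n.+1%:R ^+ (q + 2) <= C) ->
  (forall n, T n <= C' * n.+1%:R ^+ q) ->
  \sum_(n < N) normc (c n) * T n <= 2 * (C * C').
Proof.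
move=> C0 C'0 cC TC.
apply: le_trans (_ : \sum_(n < N) (C * C') * (n.+1%:R ^+ 2)^-1 <= _); last first.
  by rewrite -mulr_sumr mulrC ler_wpM2r ?mulr_ge0// sum_inv_sq.
apply: ler_sum => n _.
apply: le_trans (ler_wpM2l (normc_ge0 _) (TC n)) _.
rewrite ler_pdivlMr ?exprn_gt0 ?ltr0n//.
have := ler_wpM2r C'0 (cC n); rewrite exprD => h; apply: le_trans h.
by rewrite le_eqVlt; apply/orP; left; apply/eqP; ring.
Qed.

Lemma comm_norm_chebU_sum k : exists (q : nat) (C' : R), 0 <= C' /\
  forall (c : nat -> R[i]) (C : R) N L, 0 <= C -> F L ->
  (forall n, normc (c n) * n.+1%:R ^+ (q + 2) <= C) ->
  comm_norm L k (\sum_(n < N) c n *: chebU x n) <= 2 * (C * C').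
Proof.
have [C' [q [C'0 hC']]] := comm_norm_chebU k; exists q, C'; split=> //.
move=> c C N L C0 FL hc.
apply: le_trans (comm_norm_sum _ _ _ (fun n => c n *: chebU x n)) _.
apply: le_trans (decaying_sum_bound N C0 C'0 hc (fun n => hC' L n FL)).
by apply: ler_sum => n _; exact: comm_normZ.
Qed.

Lemma smoothing_norm_chebU_sum p : exists (q : nat) (C' : R), 0 <= C' /\
  forall (c : nat -> R[i]) (C : R) N L, 0 <= C -> F L ->
  (forall n, normc (c n) * n.+1%:R ^+ (q + 2) <= C) ->
  smoothing_norm L p (del W (\sum_(n < N) c n *: chebU x n)) <= 2 * (C * C').
Proof.
have [C' [q [C'0 hC']]] := smoothing_norm_chebU p; exists q, C'; split=> //.
move=> c C N L C0 FL hc.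
rewrite (del_sum W N (fun n => c n *: chebU x n)).
apply: le_trans (smoothing_norm_sum _ _ _ (fun n => del W (c n *: chebU x n))) _.
apply: le_trans (decaying_sum_bound N C0 C'0 hc (fun n => hC' L n FL)).
by apply: ler_sum => n _; rewrite delZ; exact: smoothing_normZ.
Qed.

End ChebyshevGrowth.
End WeightedNorms.

(** * Decay of matrix entries and weighted norms *)

Section Schur.
Context {R : realType}.

Lemma weighted_cauchy_schwarz (T : Type) (s : seq T) (w a : T -> R) :
  (forall t, 0 <= w t) -> (forall t, 0 <= a t) ->
  (\sum_(t <- s) w t * a t) ^+ 2 <= (\sum_(t <- s) w t) * \sum_(t <- s) w t * a t ^+ 2.
Proof.
move=> w0 a0; elim: s => [|t s IH]; first by rewrite !big_nil mul0r expr2 mul0r.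
rewrite !big_cons; have := w0 t; have := a0 t; move: IH.
have : 0 <= \sum_(j <- s) w j * a j by apply: sumr_ge0 => j _; rewrite mulr_ge0.
have : 0 <= \sum_(j <- s) w j by apply: sumr_ge0.
have : 0 <= \sum_(j <- s) w j * a j ^+ 2.
  by apply: sumr_ge0 => j _; rewrite mulr_ge0// sqr_ge0.
move: (\sum_(j <- s) w j * a j) (\sum_(j <- s) w j) (\sum_(j <- s) w j * a j ^+ 2)
  (w t) (a t) => A W Q v b Q0 W0 A0 h b0 v0.
have key : 2 * (A * b) <= W * b ^+ 2 + Q.
  have k0 : 0 <= W * b ^+ 2 + Q by rewrite addr_ge0// mulr_ge0// sqr_ge0.
  rewrite -(@ler_pXn2r _ 2) ?nnegrE ?mulr_ge0//.
  have := ler_wpM2r (sqr_ge0 b) h; have := sqr_ge0 (W * b ^+ 2 - Q).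
  rewrite !expr2; nra.
have := ler_wpM2l v0 key; rewrite !expr2; nra.
Qed.

(** The Schur test: Cauchy-Schwarz with the weights [psi i j] in each row, then
    exchange of the two summations. *)
Lemma schur_test (x : bop R) (psi : nat -> nat -> R) (C : R) :
  (forall i j, normc (entry x i j) <= psi i j) ->
  (forall i (s : seq nat), uniq s -> \sum_(j <- s) psi i j <= C) ->
  (forall j (s : seq nat), uniq s -> \sum_(i <- s) psi i j <= C) ->
  opn x <= C.
Proof.
move=> xpsi rows cols.
have psi0 i j : 0 <= psi i j by apply: le_trans (xpsi i j); exact: normc_ge0.
have C0 : 0 <= C by have := rows 0%N [::] isT; rewrite big_nil.
have fin (s : seq nat) (c : nat -> R[i]) : uniq s ->
    l2norm (x (\sum_(j <- s) c j *: basis j)) ^+ 2 <=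
    C ^+ 2 * \sum_(j <- s) normc (c j) ^+ 2.
  move=> us; apply: l2norm_sqr_le => t ut.
  apply: le_trans (_ : \sum_(i <- t) C * \sum_(j <- s) psi i j * normc (c j) ^+ 2 <= _).
    apply: ler_sum => i _.
    rewrite (bounded_op_sum _ _ (bopP x)) l2_coord_sum.
    apply: le_trans (_ : (\sum_(j <- s) psi i j * normc (c j)) ^+ 2 <= _).
      rewrite lerXn2r ?nnegrE ?normc_ge0//.
        by apply: sumr_ge0 => j _; rewrite mulr_ge0 ?normc_ge0.
      apply: le_trans (normc_sum _ _ _) _; apply: ler_sum => j _.
      have -> : x (c j *: basis j) i = c j * entry x i j.
        by rewrite (bounded_opZ _ _ (bopP x)).
      by rewrite normcM mulrC ler_wpM2r ?normc_ge0.
    apply: le_trans (weighted_cauchy_schwarz _ (psi0 i) (fun j => normc_ge0 _)) _.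
    rewrite ler_wpM2r ?rows//; apply: sumr_ge0 => j _.
    by rewrite mulr_ge0 ?sqr_ge0.
  rewrite -mulr_sumr expr2 -mulrA ler_wpM2l// exchange_big /= mulr_sumr.
  apply: ler_sum => j _; rewrite -mulr_suml ler_wpM2r ?sqr_ge0//; exact: cols.
apply: opn_min => // v; apply/ler_addgt0Pr => e e0.
have d0 : 0 < e / (opn x + 1) by rewrite divr_gt0// ltr_wpDl ?opn_ge0.
have [s [us hs]] := l2_finite_approx v d0.
set u := \sum_(j <- s) _ in hs.
have xu : l2norm (x u) <= C * l2norm v.
  rewrite -(@ler_pXn2r _ 2) ?nnegrE ?l2norm_ge0 ?mulr_ge0 ?l2norm_ge0//.
  apply: le_trans (fin s v us) _.
  by rewrite exprMn ler_wpM2l ?sqr_ge0// finite_le_l2norm.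
have -> : x v = x u + x (v - u) by rewrite (bounded_opB _ _ (bopP x)) addrC subrK.
apply: le_trans (l2normD _ _) _; apply: lerD => //.
apply: le_trans (opn_bound _ _) _; apply: le_trans (ler_wpM2l (opn_ge0 x) hs) _.
by rewrite mulrA ler_pdivrMr ?ltr_wpDl ?opn_ge0// mulrC ler_wpM2l ?lerDl// ltW.
Qed.

Definition ndist (i j : nat) : nat := ((i - j) + (j - i))%N.

Lemma ndistC i j : ndist i j = ndist j i. Proof. by rewrite /ndist addnC. Qed.

Lemma sum_ndist (i : nat) (s : seq nat) : uniq s ->
  \sum_(j <- s) ((ndist i j).+1%:R ^+ 2)^-1 <= 4 :> R.
Proof.
move=> us; pose f j : R := ((ndist i j).+1%:R ^+ 2)^-1.
have f0 j : 0 <= f j by rewrite invr_ge0 exprn_ge0.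
pose m := (\max_(j <- s) j).+1.
have sub j : j \in s -> (j < m)%N.
  by move=> js; rewrite ltnS (big_rem j js) /= leq_maxl.
have E : perm_eq s [seq j <- iota 0 (i + m) | j \in s].
  apply: uniq_perm => //; first by rewrite filter_uniq// iota_uniq.
  move=> j; rewrite mem_filter mem_iota add0n leq0n /=.
  case js : (j \in s) => //=; apply/esym/(leq_trans (sub j js)); exact: leq_addl.
rewrite (perm_big _ E) big_filter /=.
apply: le_trans (_ : \sum_(j <- iota 0 (i + m)) f j <= _).
  rewrite big_mkcond /=; apply: ler_sum => j _.
  by case: ifP => // _; exact: f0.
have -> : iota 0 (i + m) = index_iota 0 (i + m) by rewrite /index_iota subn0.
rewrite (big_cat_nat (n := i)) ?leq_addr//=.
have -> : 4 = 2 + 2 :> R by lra.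
apply: lerD.
  rewrite big_mkord (reindex_inj rev_ord_inj) /=.
  apply: le_trans (sum_inv_sq i); apply: ler_sum => j _.
  rewrite /f /ndist lef_pV2 ?posrE ?exprn_gt0 ?ltr0n//.
  rewrite lerXn2r ?nnegrE ?ler0n// ler_nat; have := ltn_ord j; lia.
rewrite -{1}(add0n i) big_addn addKn big_mkord.
apply: le_trans (sum_inv_sq m); apply: ler_sum => j _.
rewrite /f /ndist lef_pV2 ?posrE ?exprn_gt0 ?ltr0n//.
by rewrite lerXn2r ?nnegrE ?ler0n// ler_nat; lia.
Qed.

Lemma schur_decay (x : bop R) (C : R) :
  (forall i j, normc (entry x i j) * (ndist i j).+1%:R ^+ 2 <= C) -> opn x <= 4 * C.
Proof.
move=> hx.
have C0 : 0 <= C.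
  by apply: le_trans (hx 0%N 0%N); rewrite mulr_ge0 ?normc_ge0// exprn_ge0.
apply: (@schur_test x (fun i j => C * ((ndist i j).+1%:R ^+ 2)^-1)).
- by move=> i j; rewrite ler_pdivlMr ?exprn_gt0 ?ltr0n.
- by move=> i s us; rewrite -mulr_sumr mulrC ler_wpM2r// sum_ndist.
- move=> j s us; rewrite -mulr_sumr mulrC ler_wpM2r//.
  by under eq_bigr do rewrite ndistC; exact: sum_ndist.
Qed.

End Schur.

Section PartialIsometries.
Context {R : realType}.

Lemma l2norm_coord_leZ (I J : choiceType) (x y : l2 R I) (M : R) : 0 <= M ->
  (forall i, normc (x i) <= M * normc (y i)) -> l2norm x <= M * l2norm y.
Proof.
move=> M0 xy; have -> : M * l2norm y = l2norm (M%:C *: y).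
  by rewrite l2normZ normc_real ger0_norm.
apply: l2norm_coordP => i; apply: le_trans (xy i) _.
by rewrite -[(_ *: y) i]/(M%:C * y i) normcM normc_real ger0_norm.
Qed.

Lemma mul_op_bounded (I : choiceType) (g : I -> R[i]) (M : R) : 0 <= M ->
  (forall i, normc (g i) <= M) -> bounded_op (mul_op g) /\ opnorm_le (mul_op g) M.
Proof.
move=> M0 gM.
have bd : opnorm_le (mul_op g) M.
  move=> v; apply: (@l2norm_coord_leZ I I) => // i.
  by rewrite (mul_opE _ _ gM) normcM ler_wpM2r ?normc_ge0.
split=> //; split; last by exists M.
move=> c u v; apply: l2P => i; rewrite (mul_opE _ _ gM).
rewrite -[RHS]/(c * mul_op g u i + mul_op g v i) !(mul_opE _ _ gM).
by rewrite -[(c *: u + v) i]/(c * u i + v i) mulrDr mulrCA.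
Qed.

Section Pull.
Context {I J : choiceType} (g : J -> option I)
  (g_inj : forall j j' i, g j = Some i -> g j' = Some i -> j = j').

(** The operators [Vpow n], [U_op], [incl_s] and [proj_ge0] are all of this form. *)
Definition pull (x : l2 R I) : l2 R J := L2 (pull_square_summable g_inj x).

Lemma pullE x j : pull x j = if g j is Some i then x i else 0.
Proof. by []. Qed.

Lemma pull_bounded : bounded_op pull /\ opnorm_le pull 1.
Proof.
have bd : opnorm_le pull 1.
  move=> x; rewrite mul1r; apply: l2norm_le (l2norm_ge0 x) _ => s us.
  have -> : \sum_(j <- s) normc (pull x j) ^+ 2 = \sum_(i <- pmap g s) normc (x i) ^+ 2.
    elim: s {us} => [|j s IH]; first by rewrite !big_nil.
    rewrite big_cons IH pullE.
    have -> : pmap g (j :: s) = if g j is Some i then i :: pmap g s else pmap g s by [].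
    case: (g j) => [i|]; first by rewrite big_cons.
    by rewrite normc0 expr0n add0r.
  apply: finite_le_l2norm.
  elim: s us => [//|j s IH] /= /andP[js us]; case E: (g j) => [i|] /=; last exact: IH.
  rewrite IH// andbT; apply/negP; rewrite mem_pmap => /mapP[j' j's] Ej'.
  by move: js; rewrite (g_inj E (esym Ej')) j's.
split=> //; split; last by exists 1.
move=> c x y; apply: l2P => j.
rewrite -[RHS]/(c * pull x j + pull y j) !pullE; case: (g j) => [i|]; first by [].
by rewrite -[RHS]/(c * (0 : R[i]) + 0) mulr0 addr0.
Qed.

End Pull.

Lemma toeplitzE (b : l2 R int -> l2 R int) v i :
  toeplitz b v i = b (incl_s v) (Posz i).
Proof. by []. Qed.

Lemma incl_bounded : bounded_op (incl_s : l2 R nat -> l2 R int) /\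
  opnorm_le (incl_s : l2 R nat -> l2 R int) 1.
Proof. exact: (pull_bounded nonneg_inj). Qed.

Lemma proj_bounded : bounded_op (proj_ge0 : l2 R int -> l2 R nat) /\
  opnorm_le (proj_ge0 : l2 R int -> l2 R nat) 1.
Proof. exact: (pull_bounded proj_inj). Qed.

Lemma Vpow_bounded n : bounded_op (Vpow n : l2 R int -> l2 R int) /\
  opnorm_le (Vpow n : l2 R int -> l2 R int) 1.
Proof. exact: (pull_bounded (@bilateral_inj n)). Qed.

Lemma U_op_bounded : bounded_op (U_op : l2 R nat -> l2 R nat).
Proof. exact: (proj1 (pull_bounded unilateral_inj)). Qed.

Lemma incl_basis (j : nat) : incl_s (basis j : l2 R nat) = basis (Posz j).
Proof. by apply: l2P; case. Qed.

Lemma toeplitz_bounded b : bounded_op b -> bounded_op (toeplitz b : l2 R nat -> l2 R nat).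
Proof.
move=> bb; apply: bounded_op_comp incl_bounded.1.
by apply: bounded_op_comp proj_bounded.1 bb.
Qed.

Lemma toeplitz_opnorm b (M : R) : 0 <= M -> opnorm_le b M ->
  opnorm_le (toeplitz b : l2 R nat -> l2 R nat) M.
Proof.
move=> M0 bM x; apply: le_trans (proj_bounded.2 _) _; rewrite mul1r.
apply: le_trans (bM _) _; rewrite ler_wpM2l//.
by have := incl_bounded.2 x; rewrite mul1r.
Qed.

Fact down_inj (j j' i : nat) : Some j.+1 = Some i -> Some j'.+1 = Some i -> j = j'.
Proof. by move=> [<-] []. Qed.

Lemma esum_succ (a : nat -> \bar R) : a 0%N = 0%E ->
  (\esum_(i in [set: nat]) a i = \esum_(i in [set: nat]) a i.+1)%E.
Proof.
move=> a0; rewrite -(@reindex_esum R nat nat [set: nat] (range S) S a); last first.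
  by split=> //= x y _ _ [].
rewrite [in RHS]esum_mkcond; apply: eq_esum => -[|i] _.
  by rewrite a0; case: ifP.
by rewrite mem_set//; exists i.
Qed.

Lemma rsum_succ (f : nat -> R) : f 0%N = 0 -> rsum f = rsum (f \o S).
Proof.
move=> f0; rewrite /rsum; congr (fine (_ - _)%E); rewrite esum_succ.
- by apply: eq_esum => i _; rewrite !funeposE.
- by rewrite funeposE /= f0 maxxx.
- by apply: eq_esum => i _; rewrite !funenegE.
- by rewrite funenegE /= f0 ?oppe0 ?oppr0 maxxx.
Qed.

(** The adjoint of the shift puts the backward shift into every C*-algebra that
    contains the shift. *)
Lemma U_op_adjoint : is_adjoint (U_op : l2 R nat -> l2 R nat) (pull down_inj).
Proof.
move=> x y; rewrite /l2dot /csum; congr (_ +i* _); rewrite rsum_succ//=;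
  by rewrite mul0r.
Qed.

End PartialIsometries.

Section ShiftAndDiagonal.
Context {R : realType}.
Implicit Types (x y s : bop R).

Definition shift_bop : bop R := mk_bop U_op_bounded.

Lemma entry_shiftl x i j :
  entry (shift_bop * x) i j = if i is i'.+1 then entry x i' j else 0.
Proof. by case: i. Qed.

Lemma entry_shiftr x i j : entry (x * shift_bop) i j = entry x i j.+1.
Proof. by rewrite /entry bop_mulE /= U_op_basis. Qed.

Lemma entry_shiftXl l x i j :
  entry (shift_bop ^+ l * x) i j = if (l <= i)%N then entry x (i - l)%N j else 0.
Proof.
elim: l i => [|l IH] i; first by rewrite mul1r subn0.
rewrite exprS -mulrA entry_shiftl; case: i => [//|i].
by rewrite IH ltnS subSS.
Qed.

Lemma entry_shiftXr l x i j : entry (x * shift_bop ^+ l) i j = entry x i (j + l)%N.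
Proof.
elim: l x => [|l IH] x; first by rewrite mulr1 addn0.
by rewrite exprS mulrA IH entry_shiftr addnS.
Qed.

Lemma entry_del_shift l x i j : entry (del (shift_bop ^+ l) x) i j =
  (if (l <= i)%N then entry x (i - l)%N j else 0) - entry x i (j + l)%N.
Proof. by rewrite /del entryB entry_shiftXl entry_shiftXr. Qed.

(** The number operator plus one, truncated so as to be bounded. Estimates that are
    uniform in the truncation [r] amount to estimates for the untruncated operator,
    as the entry [(i, j)] sees no truncation once [r >= i + j]. *)
Definition weight (r i : nat) : R := (minn i r).+1%:R.

Lemma weight_bound r i : normc (weight r i)%:C <= r.+1%:R.
Proof. by rewrite normc_real ger0_norm// ler_nat ltnS geq_minr. Qed.

Definition weight_bop (r : nat) : bop R :=
  mk_bop (proj1 (mul_op_bounded (ler0n R r.+1) (weight_bound r))).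

Lemma weight_bopE r v i : weight_bop r v i = (weight r i)%:C * v i.
Proof. exact: mul_opE (weight_bound r). Qed.

Lemma entry_weightl r x i j : entry (weight_bop r * x) i j = (weight r i)%:C * entry x i j.
Proof. by rewrite /entry bop_mulE weight_bopE. Qed.

Lemma entry_weightr r x i j : entry (x * weight_bop r) i j = (weight r j)%:C * entry x i j.
Proof.
rewrite /entry bop_mulE.
have -> : weight_bop r (basis j) = (weight r j)%:C *: basis j.
  exact: (mul_op_basis j (weight_bound r)).
by rewrite (bounded_opZ _ _ (bopP x)).
Qed.

Lemma entry_iter_del r k x i j : entry (iter k (del (weight_bop r)) x) i j =
  ((weight r i - weight r j) ^+ k)%:C * entry x i j.
Proof.
elim: k => [|k IH]; first by rewrite expr0 mul1r.
rewrite iterS /del entryB entry_weightl entry_weightr IH -mulrBl -rmorphB mulrA.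
by rewrite -rmorphM exprS.
Qed.

Lemma entry_weightX r p q x i j : entry (weight_bop r ^+ p * x * weight_bop r ^+ q) i j =
  (weight r i ^+ p * weight r j ^+ q)%:C * entry x i j.
Proof.
elim: q => [|q IH].
  rewrite !expr0 !mulr1; elim: p => [|p IH]; first by rewrite expr0 mul1r mul1r.
  by rewrite exprS -mulrA entry_weightl IH mulrA -rmorphM -exprS.
by rewrite exprSr mulrA entry_weightr IH mulrA -rmorphM (exprSr (weight r j))
  mulrCA [weight r j * _]mulrC.
Qed.

Lemma weight_dist r i j : `|weight r i - weight r j| <= (ndist i j)%:R.
Proof.
wlog ij : i j / (j <= i)%N.
  by move=> h; have [/h//|/ltnW/h] := leqP j i; rewrite distrC ndistC.
have h : (minn j r <= minn i r)%N by lia.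
rewrite /weight -natrB ?ltnS// ger0_norm// ler_nat /ndist subSS; lia.
Qed.

(** Rapid decay away from the diagonal, shared by Toeplitz parts and compact parts.
    By Schur's test it means that all iterated commutators with the weights are
    bounded. *)
Definition off_diag_RD x := forall k : nat, exists C : R, forall i j,
  normc (entry x i j) * (ndist i j)%:R ^+ k <= C.

(** Rapid decay of the whole matrix, the defining property of smooth compact
    operators. *)
Definition entries_RD s := forall p : nat, exists C : R, forall i j,
  normc (entry s i j) * (i.+1 * j.+1)%:R ^+ p <= C.

Lemma off_diag_RD_succ x : off_diag_RD x -> forall k : nat, exists C : R, forall i j,
  normc (entry x i j) * (ndist i j).+1%:R ^+ k <= C.
Proof.
move=> xRD k; have [C hC] := xRD k; have [D hD] := xRD 0%N.
exists (2 ^+ k * (C + D)) => i j.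
have := hC i j; have := hD i j; rewrite expr0 mulr1.
have n0 := normc_ge0 (entry x i j); set n := normc _ in n0 *; set d := ndist i j => h1 h2.
have k2 : 1 <= 2 ^+ k :> R by rewrite exprn_ege1// ler1n.
have [d0|d0] := posnP d.
  rewrite d0 expr1n mulr1.
  have C0 : 0 <= C by apply: le_trans h2; rewrite mulr_ge0// exprn_ge0.
  have : n <= C + D by lra.
  by move=> h; apply: le_trans h _; rewrite ler_peMl//; lra.
apply: le_trans (_ : n * (2 ^+ k * d%:R ^+ k) <= _).
  rewrite ler_wpM2l// -exprMn lerXn2r ?nnegrE ?mulr_ge0//.
  by rewrite -natrM ler_nat; lia.
rewrite mulrCA ler_wpM2l//; lra.
Qed.

Definition weights := [set L : bop R | exists r, L = weight_bop r].

Lemma off_diag_comm_norm x : off_diag_RD x ->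
  forall k, exists B, forall L, weights L -> comm_norm L k x <= B.
Proof.
move=> xRD.
suff h k : forall m, exists B, forall L, weights L ->
    comm_norm L k (iter m (del L) x) <= B.
  by move=> k; exact: (h k 0%N).
elim: k => [|k IH] m; last first.
  have [B hB] := IH m; have [B' hB'] := IH m.+1; exists (B + B') => L wL /=.
  by apply: lerD; [exact: hB | exact: hB'].
have [C hC] := off_diag_RD_succ xRD (m + 2).
exists (4 * C) => _ [r ->] /=; apply: schur_decay => i j.
apply: le_trans (hC i j); rewrite entry_iter_del normcM normc_real normrX.
rewrite mulrAC mulrC ler_wpM2l ?normc_ge0// exprD ler_wpM2r ?exprn_ge0//.
rewrite lerXn2r ?nnegrE// (le_trans (weight_dist _ _ _))// ler_nat//.
Qed.

Lemma weight_le r i : weight r i <= i.+1%:R.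
Proof. by rewrite ler_nat ltnS geq_minl. Qed.

Lemma entries_RD_smoothing_norm s : entries_RD s ->
  forall p, exists B, forall L, weights L -> smoothing_norm L p s <= B.
Proof.
move=> sRD.
suff h p : forall m n, exists B, forall L, weights L ->
    smoothing_norm L p (L ^+ m * s * L ^+ n) <= B.
  move=> p; have [B hB] := h p 0%N 0%N; exists B => L wL.
  by have := hB L wL; rewrite !expr0 mul1r mulr1.
elim: p => [|p IH] m n; last first.
  have [B1 h1] := IH m n; have [B2 h2] := IH m.+1 n; have [B3 h3] := IH m n.+1.
  exists (B1 + B2 + B3) => L wL /=; rewrite !lerD//; first exact: h1.
    by have := h2 L wL; rewrite exprS -!mulrA.
  by have := h3 L wL; rewrite exprSr !mulrA.
have [C hC] := sRD (m + n + 2)%N.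
exists (4 * C) => _ [r ->] /=; apply: schur_decay => i j.
apply: le_trans (hC i j).
rewrite entry_weightX normcM normc_real mulrAC mulrC ler_wpM2l ?normc_ge0//.
rewrite ger0_norm ?mulr_ge0 ?exprn_ge0// [leRHS]exprD; apply: ler_pM.
- by rewrite mulr_ge0 ?exprn_ge0.
- by rewrite exprn_ge0.
- have e (a b : nat) : (0 < b)%N -> weight r a <= (a.+1 * b)%:R.
    by move=> b0; apply: le_trans (weight_le _ _) _; rewrite ler_nat; nia.
  rewrite exprD; apply: ler_pM; rewrite ?exprn_ge0//.
    by rewrite lerXn2r ?nnegrE// e.
  by rewrite lerXn2r ?nnegrE// mulnC e.
- by rewrite lerXn2r ?nnegrE// ler_nat /ndist; nia.
Qed.

Lemma comm_norm_off_diag k x i j (B : R) :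
  (forall L, weights L -> comm_norm L k x <= B) ->
  normc (entry x i j) * (ndist i j)%:R ^+ k <= B.
Proof.
move=> hB; have wL : weights (weight_bop (i + j)) by exists (i + j)%N.
apply: le_trans (hB _ wL); apply: le_trans (opn_le_comm_norm _ _ _).
apply: le_trans (entry_le _ i j).
rewrite entry_iter_del normcM normc_real normrX mulrC.
rewrite ler_wpM2r ?normc_ge0// lerXn2r ?nnegrE//.
have -> : weight (i + j) i = i.+1%:R by rewrite /weight; congr (_%:R); lia.
have -> : weight (i + j) j = j.+1%:R by rewrite /weight; congr (_%:R); lia.
have [ij|ij] := leqP i j.
  by rewrite distrC -natrB// ger0_norm// ler_nat /ndist; lia.
by rewrite -natrB ?ltnS ?(ltnW ij)// ger0_norm// ler_nat /ndist; lia.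
Qed.

Lemma smoothing_norm_entries p s i j (B : R) :
  (forall L, weights L -> smoothing_norm L (p + p) s <= B) ->
  normc (entry s i j) * (i.+1 * j.+1)%:R ^+ p <= B.
Proof.
move=> hB; have wL : weights (weight_bop (i + j)) by exists (i + j)%N.
apply: le_trans (hB _ wL); apply: le_trans (opn_le_smoothing_norm _ _ _ _).
apply: le_trans (entry_le _ i j).
rewrite entry_weightX normcM normc_real mulrC ger0_norm ?mulr_ge0 ?exprn_ge0//.
have -> : weight (i + j) i = i.+1%:R by rewrite /weight; congr (_%:R); lia.
have -> : weight (i + j) j = j.+1%:R by rewrite /weight; congr (_%:R); lia.
by rewrite -exprMn -natrM.
Qed.

(** The weighted norms of the Chebyshev sums are bounded, the decay of the
    coefficients beating the polynomial growth of [comm_norm_chebU] and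
    [smoothing_norm_chebU]; the corresponding bounds on entries pass to the limit. *)
Lemma chebyshev_limit_RD (x b : bop R) (l : nat) :
  (forall n, opn (chebU x n) <= 2) ->
  off_diag_RD x -> entries_RD (del (shift_bop ^+ l) x) ->
  (forall K : nat, exists C : R, forall e : R, 0 < e ->
     exists N (c : nat -> R[i]), (forall n, normc (c n) * n.+1%:R ^+ K <= C) /\
       opn (b - \sum_(n < N) c n *: chebU x n) <= e) ->
  off_diag_RD b /\ entries_RD (del (shift_bop ^+ l) b).
Proof.
move=> x2 xRD dRD happ.
have hx := off_diag_comm_norm xRD; have hd := entries_RD_smoothing_norm dRD.
have C_ge0 (c : nat -> R[i]) (K : nat) (C : R) :
    (forall n, normc (c n) * n.+1%:R ^+ K <= C) -> 0 <= C.
  by move=> h; apply: le_trans (h 0%N); rewrite mulr_ge0 ?normc_ge0// exprn_ge0.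
split=> k.
  have [q [C' [C'0 hq]]] := comm_norm_chebU_sum x2 hx k.
  have [C hC] := happ (q + 2)%N; exists (2 * (C * C')) => i j.
  apply/ler_addgt0Pr => e e0.
  have [N [c [cC cb]]] := hC (e / ((ndist i j)%:R ^+ k + 1))
    (divr_gt0 e0 (ltr_wpDl (exprn_ge0 _ (ler0n R _)) ltr01)).
  set y := \sum_(n < N) _ in cb.
  have hy : normc (entry y i j) * (ndist i j)%:R ^+ k <= 2 * (C * C').
    by apply: comm_norm_off_diag => L wL; apply: hq => //; exact: C_ge0 cC.
  have -> : entry b i j = entry y i j + entry (b - y) i j.
    by rewrite entryB addrC subrK.
  apply: le_trans (ler_wpM2r (exprn_ge0 _ (ler0n _ _)) (normc_triangle _ _)) _.
  rewrite mulrDl lerD//.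
  apply: le_trans (ler_wpM2r (exprn_ge0 _ (ler0n _ _)) (le_trans (entry_le _ _ _) cb)) _.
  rewrite mulrAC ler_pdivrMr ?ltr_wpDl ?exprn_ge0//.
  by rewrite ler_wpM2l ?lerDl// ltW.
have [q [C' [C'0 hq]]] := smoothing_norm_chebU_sum x2 hx hd (k + k)%N.
have [C hC] := happ (q + 2)%N; exists (2 * (C * C')) => i j.
apply/ler_addgt0Pr => e e0.
set W := shift_bop ^+ l; pose D := (opn W + opn W) * (i.+1 * j.+1)%:R ^+ k.
have D0 : 0 <= D by rewrite mulr_ge0 ?exprn_ge0 ?addr_ge0 ?opn_ge0.
have [N [c [cC cb]]] := hC (e / (D + 1)) (divr_gt0 e0 (ltr_wpDl D0 ltr01)).
set y := \sum_(n < N) _ in cb.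
have hy : normc (entry (del W y) i j) * (i.+1 * j.+1)%:R ^+ k <= 2 * (C * C').
  by apply: smoothing_norm_entries => L wL; apply: hq => //; exact: C_ge0 cC.
have -> : entry (del W b) i j = entry (del W y) i j + entry (del W (b - y)) i j.
  by rewrite -entryD -delD addrC subrK.
apply: le_trans (ler_wpM2r (exprn_ge0 _ (ler0n _ _)) (normc_triangle _ _)) _.
rewrite mulrDl lerD//.
have dn : opn (del W (b - y)) <= (opn W + opn W) * (e / (D + 1)).
  apply: le_trans (opnB _ _) _; rewrite [leRHS]mulrDl; apply: lerD.
    by apply: le_trans (opnM _ _) _; rewrite ler_wpM2l ?opn_ge0.
  by apply: le_trans (opnM _ _) _; rewrite mulrC ler_wpM2l ?opn_ge0.
apply: le_trans (ler_wpM2r (exprn_ge0 _ (ler0n _ _)) (le_trans (entry_le _ _ _) dn)) _.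
rewrite mulrAC -/D mulrA ler_pdivrMr ?ltr_wpDl// mulrC.
by rewrite ler_wpM2l ?lerDl// ltW.
Qed.

End ShiftAndDiagonal.

(** * The compact group Z/SZ and its locally constant functions *)

Section Profinite.
Context {R : realType}.

(** A closed subset of a product of finite sets. *)
Lemma compact_padic (p : prime_number) : compact [set: padic_int p].
Proof.
pose A k := [set m : nat | (m < val p ^ k)%N].
have cA : compact ([set x | forall k, A k (x k)] : set {ptws nat -> nat}).
  apply: (@tychonoff nat (fun=> nat) A) => k; apply: finite_compact.
  exact: (finite_II (val p ^ k)).
have near_coord (x : {ptws nat -> nat}) k : \forall y \near x, y k = x k.
  have h : nbhs (x k) [set x k] by exact: discrete_set1.
  exact: (@proj_continuous nat (fun=> nat) k x _ h).
have clP : closed (padic_set p).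
  rewrite -[padic_set p]setCK; apply: open_closedC; rewrite openE => x /= nx.
  have [k nk] : exists k, ~ ((x k < val p ^ k)%N /\ x k.+1 = x k %[mod val p ^ k]).
    by apply: contrapT => h; apply: nx => k; apply: contrapT => hk; apply: h; exists k.
  rewrite /interior; near=> y => /(_ k).
  have -> : y k = x k by near: y; exact: near_coord.
  have -> : y k.+1 = x k.+1 by near: y; exact: near_coord.
  exact: nk.
have cP : compact (padic_set p).
  by apply: (subclosed_compact clP cA) => x hx k; have [] := hx k.
move=> F PF _.
have [] := cP (@sval _ _ @ F) _ _.
  have h : [set: padic_int p] `<=` @sval _ _ @^-1` (padic_set p).
    by move=> [x xP] _; exact: (set_mem xP).
  exact: (filterS h filterT).
move=> x [Px clx].
exists (exist _ x (mem_set Px)); split=> // B C FB.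
case=> _ /= [] [W oW <- /= Wx sWC].
have [y [[z Bz <-] Wy]] : (@sval _ _ @` B `&` W) !=set0.
  apply: clx; last exact: open_nbhs_nbhs.
  have sB : B `<=` @sval _ _ @^-1` (@sval _ _ @` B) by move=> z Bz; exists z.
  exact: (filterS sB FB).
by exists z; split=> //; exact: sWC.
Unshelve. all: by end_near. Qed.

Lemma compact_ZmodS (S : supernatural) : compact [set: ZmodS S].
Proof.
have -> : [set: ZmodS S] = [set x | forall p, [set: Zmod_pe p (S p)] (x p)].
  by apply/seteqP; split.
apply: (@tychonoff prime_number (fun p => Zmod_pe p (S p)) (fun p => setT)) => p.
case: (S p) => [n|]; last exact: compact_padic.
apply: finite_compact; exact: (@finite_finset 'I_(val p ^ n)).
Qed.

Lemma continuous_ZmodS_bounded (S : supernatural) (f : ZmodS S -> R[i]) :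
  continuous_ZmodS f -> exists2 M : R, 0 <= M & forall x, normc (f x) <= M.
Proof.
move=> cf.
have /compact_near_coveringP cov := @compact_ZmodS S.
have [N _ hN] : \forall n \near \oo, [set: ZmodS S] `<=` (fun x => normc (f x) <= n%:R).
  apply: cov => x _.
  have h1 : \forall y \near x, normc (f y) <= normc (f x) + 1.
    have /cvgrPdist_lt /(_ 1 ltr01) hb := cf x.
    apply: (filterS _ hb) => y /=; rewrite normc_def -[1 : R[i]]/(1%:C) ltcR => h.
    have {}h : normc (f x - f y) < 1 by move: h; case: (f x - f y).
    have -> : f y = f x - (f x - f y) by rewrite opprB addrC subrK.
    apply: le_trans (normc_triangle _ _) _; rewrite normcNr lerD2l ltW//.
  have h2 : \forall n \near \oo, normc (f x) + 1 <= n%:R.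
    exists (Num.truncn (normc (f x) + 1)).+1 => // n /= hn.
    apply: le_trans (ltW (Num.Theory.truncnS_gt _)) _; by rewrite ler_nat.
  exists ([set y | normc (f y) <= normc (f x) + 1], [set n : nat | normc (f x) + 1 <= n%:R]).
    by split.
  by move=> [y n] /= [hy hn]; apply: le_trans hy hn.
by exists N%:R => // x; apply: (hN N) => //=.
Qed.

Lemma near_const_continuous (S : supernatural) (f : ZmodS S -> R[i]) :
  (forall x, \forall y \near x, f y = f x) -> continuous_ZmodS f.
Proof.
move=> fc x A hA; apply: (filterS _ (fc x)) => y /= ->; exact: nbhs_singleton hA.
Qed.

(** For [k <= e] this is the residue modulo [p ^ k] of an element of Z/p^eZ. *)
Definition coord_residue (p : prime_number) (e : option nat) (k : nat) :
    Zmod_pe p e -> nat :=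
  match e as e0 return Zmod_pe p e0 -> nat with
  | Some n => fun x => (nat_of_ord x %% val p ^ k)%N
  | None => fun x => (sval x : {ptws nat -> nat}) k
  end.

Lemma near_coord_residue (p : prime_number) (e : option nat) k (x : Zmod_pe p e) :
  \forall y \near x, coord_residue k y = coord_residue k x.
Proof.
case: e x => [n|] x.
  have h : nbhs x [set x] by exact: discrete_set1.
  by apply: (filterS _ h) => y ->.
have h1 : nbhs ((sval x : {ptws nat -> nat}) k) [set (sval x : {ptws nat -> nat}) k].
  exact: discrete_set1.
have h2 := @proj_continuous nat (fun=> nat) k (sval x) _ h1.
exact: (@initial_continuous (padic_int p) {ptws nat -> nat} (@sval _ _) x _ h2).
Qed.

Variable S : supernatural.

Definition prime_divisors (l : nat) : seq prime_number := pmap insub (primes l).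

(** Being congruent to [r] modulo [l], tested at the prime powers that divide [l]
    exactly. *)
Definition in_class (l r : nat) (x : ZmodS S) : bool :=
  all (fun p : prime_number => coord_residue (logn (val p) l) (x p) ==
     (r %% val p ^ logn (val p) l)%N) (prime_divisors l).

Lemma near_in_class l (x : ZmodS S) :
  \forall y \near x, forall r, in_class l r y = in_class l r x.
Proof.
have h (s : seq prime_number) : \forall y \near x, forall p, p \in s ->
    coord_residue (logn (val p) l) (y p) = coord_residue (logn (val p) l) (x p).
  elim: s => [|p s IH]; first by apply: (filterS _ (@filterT _ _ (nbhs_filter x))) => y _ p; rewrite in_nil.
  have hp : \forall y \near x, coord_residue (logn (val p) l) (y p) =
      coord_residue (logn (val p) l) (x p).
    exact: (@proj_continuous prime_number (fun p => Zmod_pe p (S p)) p x _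
      (near_coord_residue (logn (val p) l) (x p))).
  apply: filterS2 IH hp => y hs hp q; rewrite inE => /orP[/eqP -> //|]; exact: hs.
apply: filterS (h (prime_divisors l)) => y hy r.
by apply: eq_in_all => p ps; rewrite hy.
Qed.

Lemma eq_mod_prime_powers (l m r : nat) : (0 < l)%N -> (m < l)%N -> (r < l)%N ->
  (forall p, p \in primes l -> m = r %[mod p ^ logn p l]) -> m = r.
Proof.
move=> l0; wlog rm : m r / (r <= m)%N.
  move=> hw ml rl h; have [rm|/ltnW mr] := leqP r m; first exact: hw.
  by apply/esym/hw => // p /h.
move=> ml rl h; rewrite -(modn_small ml) -(modn_small rl); apply/eqP.
rewrite eqn_mod_dvd//; apply/dvdn_partP => // p pl.
by rewrite p_part -eqn_mod_dvd//; apply/eqP/h.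
Qed.

Lemma residue_mod (p : prime_number) (e l : nat) (k : int) : (0 < l)%N ->
  (val p ^ e %| l)%N -> residue p e k = (`|(k %% l%:Z)%Z|%N %% val p ^ e)%N.
Proof.
move=> l0 pl; have l0' : l%:Z != 0 by rewrite eqz_nat -lt0n.
have nz : (val p ^ e)%N%:Z != 0 by rewrite eqz_nat -lt0n expn_gt0 prime_gt0// (valP p).
apply/eqP; rewrite -eqz_nat -modz_nat /residue !gez0_abs ?modz_ge0//.
rewrite eqz_mod_dvd; apply: (@dvdz_trans l%:Z); first exact: pl.
by apply/dvdzP; exists (k %/ l%:Z)%Z; rewrite {1}(divz_eq k l%:Z) addrK.
Qed.

Lemma in_class_int (l r : nat) (k : int) : dvd_supernatural l S -> (r < l)%N ->
  in_class l r (int_ZmodS S k) = (`|(k %% l%:Z)%Z|%N == r).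
Proof.
move=> [l0 lS] rl.
have ml : (`|(k %% l%:Z)%Z| < l)%N.
  rewrite -ltz_nat gez0_abs; first by rewrite ltz_pmod.
  by rewrite modz_ge0// eqz_nat -lt0n.
have resE (p : prime_number) : coord_residue (logn (val p) l) (int_ZmodS S k p) =
    (`|(k %% l%:Z)%Z| %% val p ^ logn (val p) l)%N.
  rewrite -(residue_mod _ l0 (pfactor_dvdnn _ _)).
  have := lS p; rewrite /int_ZmodS /coord_residue.
  case: (S p) => [n|] //= /(_ _ erefl) en.
  have pn0 : (0 < val p ^ n)%N by rewrite expn_gt0 prime_gt0// (valP p).
  rewrite (residue_mod k pn0 (dvdn_exp2l _ en)) /residue.
  by [].
rewrite /in_class; apply/allP/eqP => [h|<- p _]; last by rewrite resE.
apply: (eq_mod_prime_powers l0 ml rl) => p pl.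
have pp : prime p by move: pl; rewrite mem_primes => /and3P[].
pose p' : prime_number := Sub p pp.
have p's : p' \in prime_divisors l.
  by rewrite mem_pmap; apply/mapP; exists p => //; rewrite insubT.
by have := h p' p's; rewrite resE => /eqP.
Qed.

(** A function on the residues modulo a divisor [l] of [S], as a locally constant
    function on Z/SZ. At an integer point exactly one of the conditions holds. *)
Definition periodic_extension (l : nat) (g : nat -> R[i]) (x : ZmodS S) : R[i] :=
  \sum_(r < l) if in_class l r x then g r else 0.

Lemma periodic_extension_continuous l g : continuous_ZmodS (periodic_extension l g).
Proof.
apply: near_const_continuous => x; apply: (filterS _ (near_in_class l x)) => y hy.
by apply: eq_bigr => r _; rewrite hy.
Qed.

Lemma periodic_extension_int l g k : dvd_supernatural l S ->
  periodic_extension l g (int_ZmodS S k) = g `|(k %% l%:Z)%Z|%N.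
Proof.
move=> lS; have [l0 _] := lS.
have ml : (`|(k %% l%:Z)%Z| < l)%N.
  rewrite -ltz_nat gez0_abs; first by rewrite ltz_pmod.
  by rewrite modz_ge0// eqz_nat -lt0n.
rewrite /periodic_extension (bigD1 (Ordinal ml)) //= in_class_int// eqxx big1 ?addr0//.
move=> r rm; rewrite in_class_int// ifN// eq_sym; apply: contraNneq rm => h.
by apply/eqP/val_inj.
Qed.

Lemma periodic_extension_bound l g x :
  normc (periodic_extension l g x) <= \sum_(r < l) normc (g r).
Proof.
apply: le_trans (normc_sum _ _ _) _; apply: ler_sum => r _.
by case: ifP => // _; rewrite normc0 normc_ge0.
Qed.

End Profinite.

(** * Matrices of Bunce-Deddens operators and of smooth compact operators *)

Section BunceDeddensMatrices.
Context {R : realType} {S : supernatural}.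
Local Notation H := (l2 R int).
Local Notation Hp := (l2 R nat).

Lemma l2_subE (I : choiceType) (x y : l2 R I) i : (x - y) i = x i - y i.
Proof. by []. Qed.

Lemma div_succ_le (c e : R) (n : nat) : 0 < e -> (Num.truncn (c / e) <= n)%N ->
  c / n.+1%:R <= e.
Proof.
move=> e0 hn; rewrite ler_pdivrMr ?ltr0n// [leRHS]mulrC -ler_pdivrMr//.
by apply: le_trans (ltW (Num.Theory.truncnS_gt _)) _; rewrite ler_nat.
Qed.

Lemma fun_sum_app (I J : choiceType) (s : seq nat) (F : nat -> l2 R I -> l2 R J) v :
  (\sum_(k <- s) F k) v = \sum_(k <- s) F k v.
Proof. by elim/big_rec2: _ => // k x y _ <-. Qed.

Lemma bounded_op_sum_fun (I J : choiceType) (s : seq nat) (F : nat -> l2 R I -> l2 R J) :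
  (forall k, bounded_op (F k)) -> bounded_op (\sum_(k <- s) F k).
Proof.
move=> bF; elim: s => [|k s IH]; first by rewrite big_nil; exact: bounded_op_zero.
by rewrite big_cons; exact: bounded_op_add.
Qed.

Lemma m_op_bounded (f : ZmodS S -> R[i]) (M : R) : 0 <= M ->
  (forall x, normc (f x) <= M) -> bounded_op (m_op f) /\ opnorm_le (m_op f) M.
Proof. by move=> M0 fM; apply: mul_op_bounded. Qed.

Lemma m_op_basis (f : ZmodS S -> R[i]) (M : R) (j : int) :
  (forall x, normc (f x) <= M) -> m_op f (basis j) = f (int_ZmodS S j) *: basis j.
Proof. by move=> fM; apply: mul_op_basis. Qed.

Section Symbol.
Variable F : int -> ZmodS S -> R[i].
Hypothesis F_cont : forall n, continuous_ZmodS (F n).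

Let term (n : int) : H -> H := Vpow n \o m_op (F n).

Lemma symbol_bounded n : exists2 M, 0 <= M & forall x, normc (F n x) <= M.
Proof. exact: continuous_ZmodS_bounded. Qed.

Lemma term_bounded n : bounded_op (term n).
Proof.
have [M M0 hM] := symbol_bounded n.
exact: bounded_op_comp (Vpow_bounded n).1 (m_op_bounded M0 hM).1.
Qed.

Lemma term_opnorm n (M : R) : 0 <= M -> (forall x, normc (F n x) <= M) ->
  opnorm_le (term n) M.
Proof.
move=> M0 hM; rewrite -[M]mul1r.
exact: opnorm_le_comp ler01 (Vpow_bounded n).2 (m_op_bounded M0 hM).2.
Qed.

Lemma term_basis n j : term n (basis j) = F n (int_ZmodS S j) *: basis (j + n).
Proof.
have [M M0 hM] := symbol_bounded n.
rewrite /term /= (m_op_basis j hM) (bounded_opZ _ _ (Vpow_bounded n).1).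
by rewrite Vpow_basis.
Qed.

Lemma BD_partial_sum_bounded N : bounded_op (BD_partial_sum F N).
Proof.
by apply: (@bounded_op_sum_fun _ _ _ (fun j : nat => term (j%:Z - N%:Z))) => k; exact: term_bounded.
Qed.

Lemma BD_partial_sum_entry N (i j : int) :
  BD_partial_sum F N (basis j) i =
  if (`|i - j| <= N)%N then F (i - j) (int_ZmodS S j) else 0.
Proof.
rewrite /BD_partial_sum (fun_sum_app _ (fun k => term (k%:Z - N%:Z))) l2_coord_sum.
have termE (k : nat) : term (k%:Z - N%:Z) (basis j) i =
    if k%:Z == i - j + N%:Z then F (i - j) (int_ZmodS S j) else 0.
  rewrite term_basis -[LHS]/(F (k%:Z - N%:Z) (int_ZmodS S j) * (i == j + (k%:Z - N%:Z))%:R).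
  case: (eqVneq k%:Z (i - j + N%:Z)) => [->|ne].
    by rewrite addrK (_ : i == _) ?mulr1//; apply/eqP; lia.
  rewrite (_ : (i == _) = false) ?mulr0//; apply/negbTE; move: ne;
  by apply: contra => /eqP ->; apply/eqP; lia.
under eq_bigr do rewrite termE.
rewrite big_mkord; case: ifP => [le|nle].
  have lt : (`|(i - j + N%:Z)%R| < N.*2.+1)%N by lia.
  rewrite (bigD1 (Ordinal lt)) //= [in LHS](_ : _ == _); last by apply/eqP; lia.
  rewrite big1 ?addr0// => k /eqP kn; rewrite ifN//.
  by apply/eqP => kE; apply: kn; apply: val_inj; rewrite /=; lia.
rewrite big1// => k _; rewrite ifN//; apply/eqP => kE.
by have := ltn_ord k; lia.
Qed.

Lemma BD_limit_entry b : op_cvg (BD_partial_sum F) b -> forall i j : int,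
  b (basis j) i = F (i - j) (int_ZmodS S j).
Proof.
move=> /op_cvgP hb i j; apply/eqP; rewrite -subr_eq0 -normc_eq0.
rewrite eq_le normc_ge0 andbT; apply/ler_addgt0Pr => e e0; rewrite add0r.
have [N hN] := hb e e0.
set m := maxn N `|(i - j)%R|.
have := hN m (leq_maxl _ _) (basis j).
rewrite l2norm_basis mulr1; apply: le_trans.
apply: le_trans (coord_le_l2norm (BD_partial_sum F m (basis j) - b (basis j)) i).
by rewrite l2_subE BD_partial_sum_entry leq_maxr normcBr.
Qed.

(** The partial sums are Cauchy in norm since [sum 1 / n^2] converges; its tails are
    bounded by telescoping. *)
Lemma BD_limit_exists (C : R) :
  (forall n x, normc (F n x) * `|n|.+1%:R ^+ 2 <= C) ->
  exists b, bounded_op b /\ op_cvg (BD_partial_sum F) b.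
Proof.
move=> hF.
have C0 : 0 <= C.
  by apply: le_trans (hF 0 (int_ZmodS S 0)); rewrite mulr_ge0 ?normc_ge0// exprn_ge0.
have step N : opnorm_le (BD_partial_sum F N.+1 - BD_partial_sum F N)
    (2 * C / (N.+2%:R ^+ 2)).
  have -> : BD_partial_sum F N.+1 - BD_partial_sum F N = term (- N.+1%:Z) + term N.+1%:Z.
    rewrite /BD_partial_sum doubleS big_nat_recr//= big_nat_recl//=.
    have -> : \sum_(0 <= i < N.*2.+1) (Vpow (i.+1%:Z - N.+1%:Z) \o m_op (F (i.+1%:Z - N.+1%:Z))) =
        \sum_(0 <= i < N.*2.+1) (Vpow (i%:Z - N%:Z) \o m_op (F (i%:Z - N%:Z))).
      by apply: eq_bigr => i _; rewrite (_ : i.+1%:Z - N.+1%:Z = i%:Z - N%:Z)//; lia.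
    rewrite sub0r (_ : N.*2.+2%:Z - N.+1%:Z = N.+1%:Z); last by lia.
    by rewrite addrAC addrK.
  have tb n : `|n|%N = N.+1 -> opnorm_le (term n) (C / (N.+2%:R ^+ 2)).
    move=> nN; apply: term_opnorm; first by rewrite divr_ge0// exprn_ge0.
    by move=> x; have := hF n x; rewrite nN ler_pdivlMr ?exprn_gt0 ?ltr0n.
  have -> : 2 * C / (N.+2%:R ^+ 2) = C / (N.+2%:R ^+ 2) + C / (N.+2%:R ^+ 2).
    by rewrite -mulrA mulr_natl mulr2n.
  by apply: opnorm_leD; apply: tb; lia.
pose eps (N : nat) : R := 2 * C / N.+1%:R.
have [||b [bb hb]] := operator_cauchy_limit (eps := eps) BD_partial_sum_bounded.
- move=> m n mn.
  suff h d : opnorm_le (BD_partial_sum F (m + d) - BD_partial_sum F m)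
      (2 * C * ((m.+1%:R)^-1 - ((m + d).+1%:R)^-1)).
    have := h (n - m)%N; rewrite subnKC//; apply: opnorm_leW.
    by rewrite /eps ler_wpM2l ?mulr_ge0// gerBl invr_ge0.
  elim: d => [|d IH]; first by rewrite addn0 !subrr mulr0; exact: opnorm_le0.
  have hs := opnorm_le_triangle (step (m + d)%N) IH.
  rewrite addnS; apply: opnorm_leW hs.
  rewrite -mulrDr ler_wpM2l ?mulr_ge0// addrC -lerBrDl.
  have u0 : 0 < (m + d).+1%:R :> R by rewrite ltr0n.
  rewrite -[(m + d).+2%:R]natr1; move: ((m + d).+1%:R : R) u0 => u u0.
  have v0 : 0 < u + 1 by lra.
  have -> : m.+1%:R^-1 - (u + 1)^-1 - (m.+1%:R^-1 - u^-1) = u^-1 * (u + 1)^-1 :> R.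
    by move: (m.+1%:R^-1 : R) => w; field; rewrite !gt_eqF.
  rewrite -invfM lef_pV2 ?posrE ?exprn_gt0 ?mulr_gt0//.
  by rewrite expr2 ler_wpM2r; lra.
- move=> e e0; exists (Num.truncn (2 * C / e)).
  exact: div_succ_le.
exists b; split=> //; apply/op_cvgP => e e0.
exists (Num.truncn (2 * C / e)) => n hn.
apply: opnorm_le_distC; apply: opnorm_leW (hb n).
exact: div_succ_le.
Qed.

End Symbol.

Lemma supnorm_ge (f : ZmodS S -> R[i]) x : continuous_ZmodS f -> normc (f x) <= supnorm f.
Proof.
move=> /continuous_ZmodS_bounded[M M0 hM]; apply: ub_le_sup; last by exists x.
by exists M => _ [y _ <-].
Qed.

Lemma supnorm_le (f : ZmodS S -> R[i]) (M : R) : (forall x, normc (f x) <= M) ->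
  supnorm f <= M.
Proof.
move=> hM; apply: ge_sup; last by move=> _ [y _ <-].
by exists (normc (f (int_ZmodS S 0))); exists (int_ZmodS S 0).
Qed.

Lemma RD_int_succ (u : int -> R) :
  (forall N : nat, exists K : R, forall n : int, u n * `|n|.+1%:R ^+ N <= K) <-> RD_int u.
Proof.
have E (n : int) : 1 + `|n|%:~R = `|n|%N.+1%:R :> R.
  by rewrite -natr1 addrC -abszE.
by split=> h N; have [K hK] := h N; exists K => n; have := hK n; rewrite E mulrC.
Qed.

(** Commutation with the bilateral shift [V^l] says that the matrix is periodic along
    its diagonals, and rapid decay of the symbols that it decays away from the main
    diagonal. *)
Lemma BD_smooth_entries (b : H -> H) : BD_smooth S b -> exists l : nat,
  [/\ dvd_supernatural l S, bounded_op b,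
   forall i j : int, b (basis (j + l%:Z)) (i + l%:Z) = b (basis j) i &
   forall N : nat, exists K : R, forall i j : int,
     normc (b (basis j) i) * `|i - j|.+1%:R ^+ N <= K].
Proof.
case=> bb [F [Fc FRD Fb]] [l [lS lb]]; exists l; split=> //.
  move=> i j; rewrite -{1}lb /= Vpow_basis addrK.
  by rewrite -[LHS]/(b (basis j) (i + l%:Z - l%:Z)) addrK.
move=> N; have /RD_int_succ/(_ N)[K hK] := FRD; exists K => i j.
apply: le_trans (hK (i - j)); rewrite ler_wpM2r ?exprn_ge0//.
by rewrite (BD_limit_entry Fc Fb) supnorm_ge.
Qed.

Lemma finite_matrix_entry (c : nat -> nat -> R[i]) n (i j : nat) :
  (\sum_(k < n) \sum_(s < n) c k s *: matrix_unit k s) (basis j : Hp) i =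
  if (i < n)%N && (j < n)%N then c i j else 0.
Proof.
have inner (k : nat) : (\sum_(s < n) c k s *: matrix_unit k s) (basis j : Hp) i =
    if (i == k) && (j < n)%N then c i j else 0.
  rewrite -(big_mkord xpredT (fun s => c k s *: matrix_unit k s)).
  rewrite (fun_sum_app _ (fun s => c k s *: matrix_unit k s)) l2_coord_sum big_mkord.
  have tE (s : nat) : (c k s *: matrix_unit k s) (basis j : Hp) i =
      if s == j then (if i == k then c i j else 0) else 0.
    rewrite -[LHS]/(c k s * ((s == j)%:R * (i == k)%:R)).
    case: (eqVneq s j) => [->|]; last by rewrite mul0r mulr0.
    by case: eqVneq => [->|]; rewrite ?mul1r ?mulr1// !mulr0.
  under eq_bigr do rewrite tE.
  case: (ltnP j n) => jn; last first.
    by rewrite andbF big1// => s _; rewrite ifN// neq_ltn (leq_trans (ltn_ord s) jn).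
  rewrite andbT (bigD1 (Ordinal jn)) //= eqxx big1 ?addr0// => s sj.
  by rewrite ifN//; apply: contra sj => /eqP h; apply/eqP/val_inj.
rewrite -(big_mkord xpredT (fun k => \sum_(s < n) c k s *: matrix_unit k s)).
rewrite (fun_sum_app _ (fun k => \sum_(s < n) c k s *: matrix_unit k s)) l2_coord_sum big_mkord.
under eq_bigr do rewrite inner.
case: (ltnP i n) => i_n /=; last first.
  by rewrite big1// => k _; rewrite ifN// negb_and neq_ltn (leq_trans (ltn_ord k) i_n) orbT.
rewrite (bigD1 (Ordinal i_n)) //= eqxx /= big1 ?addr0// => k ki.
by rewrite ifN// negb_and; apply/orP; left; apply: contra ki => /eqP h; apply/eqP/val_inj.
Qed.

Lemma matrix_unit_bounded k s : bounded_op (matrix_unit k s : Hp -> Hp).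
Proof.
split; last first.
  by exists 1 => v; rewrite /matrix_unit l2normZ l2norm_basis mulr1 mul1r coord_le_l2norm.
move=> c u v; apply: l2P => i.
rewrite -[RHS]/(c * (u s * (i == k)%:R) + v s * (i == k)%:R).
by rewrite -[LHS]/((c * u s + v s) * (i == k)%:R) mulrDl mulrA.
Qed.

Lemma finite_matrix_bounded (c : nat -> nat -> R[i]) n :
  bounded_op (\sum_(k < n) \sum_(s < n) c k s *: matrix_unit k s : Hp -> Hp).
Proof.
rewrite -(big_mkord xpredT (fun k => \sum_(s < n) c k s *: matrix_unit k s)).
apply: (@bounded_op_sum_fun _ _ _ (fun k => \sum_(s < n) c k s *: matrix_unit k s)) => k.
rewrite -(big_mkord xpredT (fun s => c k s *: matrix_unit k s)).
apply: (@bounded_op_sum_fun _ _ _ (fun s => c k s *: matrix_unit k s)) => s.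
exact/bounded_op_scale/matrix_unit_bounded.
Qed.

(** Cutting off a matrix of rapid decay leaves a remainder that is small in norm by
    Schur's test. *)
Lemma K_smooth_entries (c : bop R) : K_smooth c <-> entries_RD c.
Proof.
split.
  case=> _ [c_ cRD /op_cvgP ccvg] p.
  have [K hK] := cRD p p; exists K => i j.
  have -> : entry c i j = c_ i j.
    apply/eqP; rewrite -subr_eq0 -normc_eq0.
    rewrite eq_le normc_ge0 andbT; apply/ler_addgt0Pr => e e0; rewrite add0r.
    have [N hN] := ccvg e e0; set n := maxn N (maxn i j).+1.
    have := hN n (leq_maxl _ _) (basis j); rewrite l2norm_basis mulr1; apply: le_trans.
    set T := \sum_(k < n) _.
    apply: le_trans (coord_le_l2norm (T (basis j) - c (basis j)) i).
    rewrite l2_subE finite_matrix_entry.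
    have ni : (i < n)%N by rewrite /n leq_max ltnS leq_maxl orbT.
    have nj : (j < n)%N by rewrite /n leq_max ltnS leq_maxr orbT.
    by rewrite ni nj /= normcBr; exact: lexx.
  by apply: le_trans (hK i j); rewrite mulrC natrM exprMn -[i.+1%:R]nat1r -[j.+1%:R]nat1r.
move=> cRD; split; first exact: bopP.
exists (entry c).
  move=> M N; have [K hK] := cRD (M + N)%N; exists K => i j.
  apply: le_trans (hK i j); rewrite mulrC ler_wpM2l ?normc_ge0// exprD.
  rewrite !nat1r; apply: ler_pM; rewrite ?exprn_ge0//.
    by rewrite lerXn2r ?nnegrE// ler_nat leq_pmulr.
  by rewrite lerXn2r ?nnegrE// ler_nat leq_pmull.
apply/op_cvgP => e e0.
(* Two powers are for Schur's test, the third makes the remainder small. *)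
have [K hK] := cRD 3%N.
have K0 : 0 <= K by apply: le_trans (hK 0%N 0%N); rewrite mulr_ge0 ?normc_ge0// exprn_ge0.
exists (Num.truncn (4 * K / e)) => n hn.
pose T := mk_bop (finite_matrix_bounded (entry c) n).
apply/(opn_leP (T - c) (ltW e0)).
have n0 : 0 < n.+1%:R :> R by rewrite ltr0n.
apply: le_trans (_ : 4 * (K / n.+1%:R) <= _); last first.
  by rewrite mulrA; exact: div_succ_le.
apply: schur_decay => i j; rewrite entryB.
have -> : entry T i j = if (i < n)%N && (j < n)%N then entry c i j else 0.
  exact: finite_matrix_entry.
case: ifPn => [_|]; first by rewrite subrr normc0 mul0r divr_ge0.
rewrite negb_and -!leqNgt => nij; rewrite sub0r normcNr ler_pdivlMr//.
apply: le_trans (hK i j); rewrite -mulrA ler_wpM2l ?normc_ge0//.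
rewrite [leRHS]exprSr; apply: ler_pM; rewrite ?exprn_ge0//.
  by rewrite lerXn2r ?nnegrE// ler_nat /ndist; nia.
by rewrite ler_nat; case/orP: nij => h; nia.
Qed.

End BunceDeddensMatrices.

(** * Matrix characterization of the smooth Toeplitz algebra *)

Section SmoothMatrices.
Context {R : realType} (S : supernatural).
Local Notation H := (l2 R int).
Local Notation Hp := (l2 R nat).

Lemma toeplitz_entry (b : H -> H) (i j : nat) :
  toeplitz b (basis j : Hp) i = b (basis (Posz j)) (Posz i).
Proof. by rewrite toeplitzE incl_basis. Qed.

Lemma ndist_absz (i j : nat) : `|(i%:Z - j%:Z)%R|%N = ndist i j.
Proof. by rewrite /ndist; lia. Qed.

(** The commutator of the Toeplitz part with [U^l] is supported in the first [l]
    rows, where decay away from the diagonal is decay of all entries; the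
    commutator of the compact part is again of rapid decay. *)
Lemma BDT_smooth_entries (a : Hp -> Hp) : BDT_smooth S a ->
  exists (x : bop R) (l : nat), [/\ a = x, dvd_supernatural l S, off_diag_RD x &
    entries_RD (del (shift_bop ^+ l) x)].
Proof.
case=> b /BD_smooth_entries[l [lS bb bper bRD]] [c cK <-].
have cb : bounded_op c by case: cK.
pose c' := mk_bop cb; have cRD : entries_RD c' by apply/K_smooth_entries.
pose x := mk_bop (bounded_op_add (toeplitz_bounded bb) cb).
have [l0 _] := lS.
have xE i j : entry x i j = b (basis (Posz j)) (Posz i) + entry c' i j.
  by rewrite -toeplitz_entry.
have xOD : off_diag_RD x.
  move=> k; have [K hK] := bRD k; have [K' hK'] := cRD k; exists (K + K') => i j.
  rewrite xE; apply: le_trans (ler_wpM2r (exprn_ge0 _ (ler0n _ _)) (normc_triangle _ _)) _.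
  rewrite mulrDl; apply: lerD.
    apply: le_trans (hK i%:Z j%:Z); rewrite ler_wpM2l ?normc_ge0// ndist_absz.
    by rewrite lerXn2r ?nnegrE// ler_nat.
  apply: le_trans (hK' i j); rewrite ler_wpM2l ?normc_ge0//.
  by rewrite lerXn2r ?nnegrE// ler_nat /ndist; nia.
exists x, l; split=> // p.
have [K hK] := off_diag_RD_succ xOD p; have [K' hK'] := cRD p.
have K0 : 0 <= K by apply: le_trans (hK 0%N 0%N); rewrite mulr_ge0 ?normc_ge0// exprn_ge0.
have K'0 : 0 <= K' by apply: le_trans (hK' 0%N 0%N); rewrite mulr_ge0 ?normc_ge0// exprn_ge0.
exists (l.+1%:R ^+ p * (K' + K') + l%:R ^+ p * K) => i j.
rewrite entry_del_shift; case: ifP => il.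
  (* Below the first l rows the Toeplitz part cancels. *)
  have -> : entry x (i - l)%N j - entry x i (j + l)%N =
      entry c' (i - l)%N j - entry c' i (j + l)%N.
    rewrite !xE -(bper (Posz (i - l)) (Posz j)) -!PoszD subnK//.
    by rewrite opprD addrACA subrr add0r.
  apply: le_trans (_ : l.+1%:R ^+ p * (K' + K') <= _); last first.
    by rewrite lerDl mulr_ge0// exprn_ge0.
  apply: le_trans (ler_wpM2r (exprn_ge0 _ (ler0n _ _)) (normc_triangle _ _)) _.
  rewrite normcNr mulrDl mulrDr; apply: lerD.
    apply: le_trans (ler_wpM2l (exprn_ge0 _ (ler0n _ _)) (hK' (i - l)%N j)).
    rewrite mulrCA ler_wpM2l ?normc_ge0// -exprMn -natrM.
    by rewrite lerXn2r ?nnegrE// ler_nat; nia.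
  apply: le_trans (ler_wpM2l (exprn_ge0 _ (ler0n _ _)) (hK' i (j + l)%N)).
  rewrite mulrCA ler_wpM2l ?normc_ge0// -exprMn -natrM.
  by rewrite lerXn2r ?nnegrE// ler_nat; nia.
rewrite sub0r normcNr; apply: le_trans (_ : l%:R ^+ p * K <= _); last first.
  by rewrite lerDr mulr_ge0 ?exprn_ge0// addr_ge0.
apply: le_trans (ler_wpM2l (exprn_ge0 _ (ler0n _ _)) (hK i (j + l)%N)).
rewrite mulrCA ler_wpM2l ?normc_ge0// -exprMn -natrM.
by rewrite lerXn2r ?nnegrE// ler_nat /ndist; nia.
Qed.

Section Converse.
Variables (x : bop R) (l : nat).
Hypotheses (lS : dvd_supernatural l S) (xOD : off_diag_RD x)
           (xW : entries_RD (del (shift_bop ^+ l) x)).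

Let l0 : (0 < l)%N. Proof. by case: lS. Qed.

Let diag i j (t : nat) : R[i] := entry x (i + t * l)%N (j + t * l)%N.

(** The commutator with [U^l] has as entries the differences of consecutive entries
    of [x] along a diagonal in steps of [l], so their rapid decay makes these
    entries converge down the diagonal. *)
Lemma diag_cauchy (q : nat) : exists2 C : R, 0 <= C & forall i j s t, (s <= t)%N ->
  normc (diag i j t - diag i j s) * (i.+1 * j.+1)%:R ^+ q <= C / s.+1%:R.
Proof.
(* The two additional powers make the differences summable along a diagonal. *)
have [C hC] := xW (q + 2)%N.
have C0 : 0 <= C by apply: le_trans (hC 0%N 0%N); rewrite mulr_ge0 ?normc_ge0// exprn_ge0.
have step i j t : normc (diag i j t.+1 - diag i j t) * (i.+1 * j.+1)%:R ^+ q <=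
    C / t.+1%:R ^+ 2.
  rewrite ler_pdivlMr ?exprn_gt0 ?ltr0n//.
  have := hC (i + t * l + l)%N (j + t * l)%N.
  rewrite entry_del_shift leq_addl addnK.
  have -> : entry x (i + t * l)%N (j + t * l)%N - entry x (i + t * l + l)%N (j + t * l + l)%N =
      diag i j t - diag i j t.+1.
    by rewrite /diag mulSn (addnC l) !addnA.
  rewrite normcBr => h; apply: le_trans h; rewrite -mulrA ler_wpM2l ?normc_ge0//.
  rewrite [leRHS]exprD; apply: ler_pM; rewrite ?exprn_ge0//.
    by rewrite lerXn2r ?nnegrE// ler_nat; nia.
  by rewrite lerXn2r ?nnegrE// ler_nat; nia.
exists (2 * C); first by rewrite mulr_ge0.
move=> i j s t st; set X := _%:R ^+ q.
have X0 : 0 <= X by rewrite exprn_ge0.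
suff h d : normc (diag i j (s + d)%N - diag i j s) * X <=
    2 * C * ((s.+1%:R)^-1 - ((s + d).+1%:R)^-1).
  have := h (t - s)%N; rewrite subnKC// => /le_trans; apply.
  by rewrite ler_wpM2l ?mulr_ge0// gerBl invr_ge0.
elim: d => [|d IH]; first by rewrite addn0 !subrr normc0 mul0r mulr0.
rewrite addnS.
have -> : diag i j (s + d).+1 - diag i j s =
    (diag i j (s + d).+1 - diag i j (s + d)%N) + (diag i j (s + d)%N - diag i j s).
  by rewrite addrA subrK.
apply: le_trans (ler_wpM2r X0 (normc_triangle _ _)) _.
rewrite mulrDl; apply: le_trans (lerD (step i j (s + d)%N) IH) _.
have u0 : 1 <= (s + d).+1%:R :> R by rewrite ler1n.
rewrite -[(s + d).+2%:R]natr1; move: ((s + d).+1%:R : R) (s.+1%:R^-1 : R) u0 => u w u0.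
have key : (u ^+ 2)^-1 <= 2 * (u^-1 - (u + 1)^-1).
  have -> : u^-1 - (u + 1)^-1 = (u * (u + 1))^-1 by field; rewrite !gt_eqF; lra.
  rewrite -[leRHS]invrK lef_pV2 ?posrE ?exprn_gt0 ?invr_gt0 ?mulr_gt0 ?invr_gt0 ?mulr_gt0; try lra.
  by rewrite invfM invrK mulrC ler_pdivrMr//; nra.
have := ler_wpM2l C0 key; lra.
Qed.

(** The limits along the diagonals form a matrix that is periodic in steps of [l],
    still decays away from the diagonal, and differs from the matrix of [x] by a
    matrix of rapid decay. *)
Lemma symbol_exists : exists Phi : nat -> nat -> R[i],
  [/\ forall i j, Phi (i + l)%N (j + l)%N = Phi i j,
      forall q, exists C : R, forall i j,
        normc (entry x i j - Phi i j) * (i.+1 * j.+1)%:R ^+ q <= C &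
      forall k, exists C : R, forall i j,
        normc (Phi i j) * (ndist i j).+1%:R ^+ k <= C].
Proof.
have [C C0 hC] := diag_cauchy 0%N.
have small (D e : R) : 0 < e -> exists s : nat, D / s.+1%:R <= e.
  by move=> e0; exists (Num.truncn (D / e)); exact: div_succ_le.
have /choice[Phi hPhi] : forall ij : nat * nat, exists w, forall s,
    normc (w - diag ij.1 ij.2 s) <= C / s.+1%:R.
  move=> [i j]; apply: complex_cauchy_limit; last exact: small.
  by move=> s t st; have := hC i j s t st; rewrite expr0 mulr1.
exists (fun i j => Phi (i, j)); split.
- move=> i j; apply/eqP; rewrite -subr_eq0 -normc_eq0 eq_le normc_ge0 andbT.
  apply/ler_addgt0Pr => e e0; rewrite add0r.
  have [s hs] := small (2 * C) e e0.
  have h1 := hPhi (i + l, j + l)%N s; have h2 := hPhi (i, j) s.+1.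
  have E : diag (i + l)%N (j + l)%N s = diag i j s.+1 by rewrite /diag mulSn !addnA.
  rewrite /= E in h1; rewrite /= in h2.
  have -> : Phi (i + l, j + l)%N - Phi (i, j) =
     (Phi (i + l, j + l)%N - diag i j s.+1) - (Phi (i, j) - diag i j s.+1).
    by rewrite opprB addrA subrK.
  apply: le_trans (normc_triangle _ _) _; rewrite normcNr.
  apply: le_trans (lerD h1 h2) _; apply: le_trans hs.
  have : C / s.+2%:R <= C / s.+1%:R.
    by rewrite ler_wpM2l// lef_pV2 ?posrE ?ltr0n// ler_nat.
  rewrite -mulrA mulr_natl [X in _ -> _ <= X]mulr2n => h; exact: lerD.
- move=> q; have [D D0 hD] := diag_cauchy q; exists D => i j.
  set X := _%:R ^+ q; have X0 : 0 <= X by rewrite exprn_ge0.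
  apply/ler_addgt0Pr => e e0.
  have [s hs] := small C (e / (X + 1)) (divr_gt0 e0 (ltr_wpDl X0 ltr01)).
  have -> : entry x i j - Phi (i, j) =
      - (diag i j s - diag i j 0%N) - (Phi (i, j) - diag i j s).
    by rewrite !opprB addrA subrK /diag mul0n !addn0.
  apply: le_trans (ler_wpM2r X0 (normc_triangle _ _)) _; rewrite !normcNr mulrDl.
  apply: lerD; first by have := hD i j 0%N s (leq0n _); rewrite divr1.
  apply: le_trans (ler_wpM2r X0 (le_trans (hPhi (i, j) s) hs)) _.
  by rewrite mulrAC ler_pdivrMr ?ltr_wpDl// ler_wpM2l ?lerDl// ltW.
- move=> k; have [D hD] := off_diag_RD_succ xOD k; exists D => i j.
  set X := _%:R ^+ k; have X0 : 0 <= X by rewrite exprn_ge0.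
  apply/ler_addgt0Pr => e e0.
  have [s hs] := small C (e / (X + 1)) (divr_gt0 e0 (ltr_wpDl X0 ltr01)).
  have -> : Phi (i, j) = diag i j s + (Phi (i, j) - diag i j s) by rewrite addrC subrK.
  apply: le_trans (ler_wpM2r X0 (normc_triangle _ _)) _; rewrite mulrDl.
  apply: lerD.
    have := hD (i + s * l)%N (j + s * l)%N.
    by rewrite (_ : ndist (i + s * l)%N _ = ndist i j)// /ndist !subnDr.
  apply: le_trans (ler_wpM2r X0 (le_trans (hPhi (i, j) s) hs)) _.
  by rewrite mulrAC ler_pdivrMr ?ltr_wpDl// ler_wpM2l ?lerDl// ltW.
Qed.

(** The periodic matrix of [symbol_exists] is the matrix of [T(b)] for the symbols
    [F n] extending its diagonals to Z/SZ, and [x - T(b)] is smooth compact. *)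
Lemma BDT_smooth_of_entries : BDT_smooth S x.
Proof.
have [Phi [Phi_per xPhi PhiRD]] := symbol_exists.
have Phi_perX u i j : Phi (i + u * l)%N (j + u * l)%N = Phi i j.
  elim: u => [|u IH]; first by rewrite mul0n !addn0.
  by rewrite mulSn !addnA addnAC (addnAC j) Phi_per.
(* The diagonal [n] is read off [|n|] periods further down, where the row index is
   nonnegative also for negative [n]. *)
pose g (n : int) (r : nat) := Phi `|(n + (r + `|n| * l)%N%:Z)%R|%N (r + `|n| * l)%N.
pose F n := periodic_extension (S := S) l (g n).
have F_cont n : continuous_ZmodS (F n) by exact: periodic_extension_continuous.
have gdist n r : ndist `|(n + (r + `|n| * l)%N%:Z)%R|%N (r + `|n| * l)%N = `|n|%N.
  have : (`|n| <= `|n| * l)%N by rewrite leq_pmulr.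
  by move: (`|n| * l)%N => m; rewrite /ndist; lia.
have F_RD k : exists C : R, forall n y, normc (F n y) * `|n|.+1%:R ^+ k <= C.
  have [C hC] := PhiRD k; exists (l%:R * C) => n y.
  apply: le_trans (ler_wpM2r (exprn_ge0 _ (ler0n _ _)) (periodic_extension_bound _ _ _)) _.
  rewrite mulr_suml; apply: le_trans (_ : \sum_(r < l) C <= _).
    by apply: ler_sum => r _; have := hC _ _ : normc (g n r) * _ <= C; rewrite gdist.
  by rewrite big_const_ord iter_addr_0 mulr_natl.
have [C2 hC2] := F_RD 2.
have [b [bb bcvg]] := BD_limit_exists F_cont hC2.
have bE := BD_limit_entry F_cont bcvg.
have F_per n (k : int) : F n (int_ZmodS S (k - l%:Z)) = F n (int_ZmodS S k).
  rewrite /F !periodic_extension_int//; congr (g n `|_|%N).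
  by rewrite -[in RHS](subrK l%:Z k) modzDr.
have bS : BD_smooth S b.
  split=> //.
    exists F; split=> //; apply/RD_int_succ => k.
    have [C hC] := F_RD k; exists C => n.
    rewrite -ler_pdivlMr ?exprn_gt0 ?ltr0n//; apply: supnorm_le => y.
    by rewrite ler_pdivlMr ?exprn_gt0 ?ltr0n.
  exists l; split=> //.
  apply: bounded_op_basisP => //.
    apply: bounded_op_comp (Vpow_bounded _).1.
    exact: bounded_op_comp (Vpow_bounded _).1 bb.
  move=> j; apply: l2P => i; rewrite /= Vpow_basis.
  rewrite -[LHS]/(b (basis (j - l%:Z)) (i - l%:Z)) !bE.
  by rewrite (_ : i - l%:Z - (j - l%:Z) = i - j) ?F_per//; lia.
have TE i j : toeplitz b (basis j : Hp) i = Phi i j.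
  rewrite toeplitz_entry bE /F periodic_extension_int// modz_nat absz_nat /g.
  set n := (i%:Z - j%:Z)%R; set r := (j %% l)%N.
  rewrite -(Phi_perX `|n|%N i j) -(Phi_perX (j %/ l)%N).
  have jE := divn_eq j l; congr Phi.
    have : (`|n| <= `|n| * l)%N by rewrite leq_pmulr.
    by move: jE; rewrite -/r /n; move: (`|_| * l)%N (_ %/ _ * l)%N => u v; lia.
  by move: jE; rewrite -/r; move: (`|_| * l)%N (_ %/ _ * l)%N => u v; lia.
pose T := mk_bop (toeplitz_bounded bb).
exists b => //; exists (x - T); last by rewrite /= addrC subrK.
apply/K_smooth_entries => q; have [C hC] := xPhi q; exists C => i j.
by rewrite entryB (_ : entry T i j = Phi i j)//; exact: TE.
Qed.

End Converse.
End SmoothMatrices.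

(** * The smooth elements lie in the Toeplitz algebra *)

Section GeneratedAlgebra.
Context {R : realType}.

(** It makes the intersection that defines a generated algebra one of bounded
    operators, as soon as the generators are bounded. *)
Lemma bounded_Cstar_subalgebra (I : choiceType) :
  Cstar_subalgebra (bounded_op : set (l2 R I -> l2 R I)).
Proof.
split=> //; split=> *; by [exact: bounded_op_zero | exact: bounded_op_add |
  exact: bounded_op_scale | exact: bounded_op_comp].
Qed.

Lemma Cstar_generated_sub (I : choiceType) (G : set (l2 R I -> l2 R I)) T :
  G T -> Cstar_generated G T.
Proof. by move=> GT A [_]; exact. Qed.

Lemma Cstar_generatedP (I : choiceType) (G : set (l2 R I -> l2 R I)) :
  G `<=` bounded_op -> Cstar_subalgebra (Cstar_generated G).
Proof.
move=> Gb; split.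
- by move=> T; apply; split=> //; exact: bounded_Cstar_subalgebra.
- split; first by move=> A [[_ [h _] _ _ _] _].
  move=> S T GS GT A AP; have [[_ [_ h] _ _ _] _] := AP.
  by apply: h; [exact: GS | exact: GT].
- split=> [c T GT|S T GS GT] A AP; have [[_ _ [h h'] _ _] _] := AP.
    by apply: h; exact: GT.
  by apply: h'; [exact: GS | exact: GT].
- move=> T T' GT bT' adj A AP; have [[_ _ _ h _] _] := AP.
  by apply: h adj => //; exact: GT.
- move=> T_ T GT bT cv A AP; have [[_ _ _ _ h] _] := AP.
  by apply: h cv => // n; exact: GT.
Qed.

End GeneratedAlgebra.

Section ToeplitzAlgebra.
Context {R : realType} (S : supernatural).
Local Notation H := (l2 R int).
Local Notation Hp := (l2 R nat).
Local Notation A := (BDT_algebra S : set (Hp -> Hp)).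

Lemma M_op_bounded (f : ZmodS S -> R[i]) : continuous_ZmodS f -> bounded_op (M_op f).
Proof.
move=> /continuous_ZmodS_bounded[M M0 fM].
by apply: (proj1 (mul_op_bounded M0 _)) => k; exact: fM.
Qed.

Lemma BDT_algebra_cstar : Cstar_subalgebra A.
Proof.
apply: Cstar_generatedP => T [->|[f fc <-]]; first exact: U_op_bounded.
exact: M_op_bounded.
Qed.

Lemma BDT_algebra_M (f : ZmodS S -> R[i]) : continuous_ZmodS f -> A (M_op f).
Proof. by move=> fc; apply: Cstar_generated_sub; right; exists f. Qed.

Lemma BDT_algebra_id : A id.
Proof.
have -> : id = M_op (fun _ : ZmodS S => 1) :> (Hp -> Hp).
  apply/funext => v; apply: l2P => i; rewrite (@mul_opE _ _ _ 1) ?mul1r// => j.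
  by rewrite normc1.
by apply: BDT_algebra_M => x; exact: cst_continuous.
Qed.

(** The backward shift, adjoint of [shift_bop]. *)
Definition down_bop : bop R := mk_bop (pull_bounded down_inj).1.

Lemma BDT_algebra_shift : A (shift_bop : bop R).
Proof. by apply: Cstar_generated_sub; left. Qed.

Lemma BDT_algebra_down : A down_bop.
Proof.
case: BDT_algebra_cstar => _ _ _ h _; apply: h BDT_algebra_shift (bopP down_bop) _.
exact: U_op_adjoint.
Qed.

Lemma down_bopX m v i : (down_bop ^+ m) v i = v (i + m)%N.
Proof.
elim: m i => [|m IH] i; first by rewrite expr0 addn0.
by rewrite exprS bop_mulE addnS -addSn -IH.
Qed.

Lemma M_op_basis (f : ZmodS S -> R[i]) (j : nat) : continuous_ZmodS f ->
  M_op f (basis j) = f (int_ZmodS S j%:Z) *: basis j.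
Proof. by move=> /continuous_ZmodS_bounded[M M0 fM]; apply: mul_op_basis. Qed.

(** Compression to the half-line turns [V^n] into a power of the shift or, for
    negative [n], of the backward shift. *)
Lemma toeplitz_monomial (F : int -> ZmodS S -> R[i]) n :
  (forall n, continuous_ZmodS (F n)) -> A (toeplitz (Vpow n \o m_op (F n))).
Proof.
move=> Fc; pose W := if n is Posz m then shift_bop ^+ m else down_bop ^+ `|n|%N.
have AW : A W.
  have AC := BDT_algebra_cstar; have A1 := BDT_algebra_id.
  rewrite /W; clear W; case: n => m. exact: (cstarX AC A1 m BDT_algebra_shift).
  exact: (cstarX AC A1 _ BDT_algebra_down).
pose T := mk_bop (toeplitz_bounded (term_bounded Fc n)).
pose D := mk_bop (M_op_bounded (Fc n)).
have AD : A D by exact: BDT_algebra_M.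
suff -> : toeplitz (Vpow n \o m_op (F n)) = (W * D : bop R) :> (Hp -> Hp).
  exact: (cstarM (BDT_algebra_cstar) AW AD).
apply: (congr1 (@bop_fun R) (_ : T = W * D)).
apply: entryP => i j.
have DE i' : entry D i' j = F n (int_ZmodS S j%:Z) * (i' == j)%:R.
  by rewrite /entry /= M_op_basis.
have -> : entry T i j = F n (int_ZmodS S j%:Z) * (i%:Z == j%:Z + n)%:R.
  by rewrite -[LHS]/(toeplitz _ _ _) toeplitz_entry term_basis.
rewrite /W; case: (n) DE => m DE.
  rewrite entry_shiftXl DE; case: ifP => mi.
    by congr (_ * (_ : bool)%:R); lia.
  by rewrite (_ : (_ == _) = false) ?mulr0//; lia.
by rewrite -[RHS]/((down_bop ^+ _) _ _) down_bopX -[RHS]/(entry D _ j) DE; congr (_ * (_ : bool)%:R); lia.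
Qed.

Lemma toeplitz_sum (s : seq nat) (G : nat -> H -> H) :
  (forall k, A (toeplitz (G k))) -> A (toeplitz (\sum_(k <- s) G k)).
Proof.
move=> AG; case: (@BDT_algebra_cstar) => _ [A0 AD] _ _ _; elim: s => [|k s IH].
  rewrite big_nil (_ : toeplitz 0 = 0)//.
  by apply/funext => v; apply: l2P => i; rewrite toeplitzE.
rewrite big_cons (_ : toeplitz _ = toeplitz (G k) + toeplitz (\sum_(k <- s) G k)).
  exact: AD.
by apply/funext => v; apply: l2P => i; rewrite toeplitzE.
Qed.

Lemma toeplitz_BD_smooth (b : H -> H) : BD_smooth S b -> A (toeplitz b).
Proof.
case=> bb [F [Fc _ bcvg]] _; case: BDT_algebra_cstar => _ _ _ _ closedA.
apply: (closedA (fun N => toeplitz (BD_partial_sum F N))).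
- move=> N; apply: (@toeplitz_sum _ (fun k : nat => Vpow (k%:Z - N%:Z) \o m_op (F (k%:Z - N%:Z)))) => k.
  exact: toeplitz_monomial.
- exact: toeplitz_bounded.
- move=> e e0; apply: filterS (bcvg e e0) => N hN.
  suff -> : toeplitz (BD_partial_sum F N) - toeplitz b = toeplitz (BD_partial_sum F N - b).
    exact: toeplitz_opnorm (ltW e0) hN.
  by apply/funext => v; apply: l2P => i; rewrite toeplitzE.
Qed.

(** [1 - U U^*] is the projection onto the first basis vector. *)
Lemma matrix_unit_shifts k s : matrix_unit k s =
  (shift_bop ^+ k * (1 - shift_bop * down_bop) * down_bop ^+ s : bop R) :> (Hp -> Hp).
Proof.
apply/funext => v; rewrite !bop_mulE.
have -> : (1 - shift_bop * down_bop) ((down_bop ^+ s) v) = v s *: (basis 0%N : Hp).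
  move: ((down_bop ^+ s) v) (down_bopX s v 0%N) => w w0.
  rewrite -[v s]w0; apply: l2P => i; rewrite bop_subE l2_subE -[RHS]/(w 0%N * (i == 0%N)%:R).
  case: i => [|i]; first by rewrite -[X in _ - X]/(0) subr0 mulr1.
  by rewrite -[X in _ - X]/(w i.+1) subrr mulr0.
rewrite (bounded_opZ _ _ (bopP _)); congr (_ *: _).
by elim: k => [|k IH]; rewrite ?expr0// exprS bop_mulE -IH /= U_op_basis.
Qed.

Lemma BDT_algebra_matrix_unit k s : A (matrix_unit k s).
Proof.
have AC := BDT_algebra_cstar; have A1 := BDT_algebra_id.
have AU := BDT_algebra_shift; have AD := BDT_algebra_down.
rewrite matrix_unit_shifts; apply: (cstarM AC); last exact: (cstarX AC).
apply: (cstarM AC); first exact: (cstarX AC).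
by apply: (cstarB AC) => //; exact: (cstarM AC).
Qed.

Lemma BDT_smooth_sub_algebra : BDT_smooth S `<=` A.
Proof.
have [_ [A0 AD] [AZ _] _ closedA] := BDT_algebra_cstar.
have Asum (n : nat) (G : nat -> Hp -> Hp) : (forall k, A (G k)) -> A (\sum_(k < n) G k).
  by move=> AG; apply: (big_ind (fun T : Hp -> Hp => A T)).
move=> _ [b bS [c [bc [c_ _ ccvg]]] <-]; apply: AD; first exact: toeplitz_BD_smooth.
apply: closedA bc ccvg => n.
apply: (Asum n (fun k => \sum_(s < n) c_ k s *: matrix_unit k s)) => k.
by apply: (Asum n (fun s => c_ k s *: matrix_unit k s)) => s; apply: AZ; exact: BDT_algebra_matrix_unit.
Qed.

End ToeplitzAlgebra.

(** * The smooth functional calculus *)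

Section ComplexApproximation.
Context {R : realType}.

Lemma sum_pad (c : nat -> R) (u : nat -> R) N M : (N <= M)%N ->
  \sum_(n < M) (if (n < N)%N then c n else 0) * u n = \sum_(n < N) c n * u n.
Proof.
move=> NM; rewrite [RHS](big_ord_widen M (fun n => c n * u n))// [RHS]big_mkcond /=.
by apply: eq_bigr => n _; case: ifP; rewrite ?mul0r.
Qed.

(** Apply [chebyshev_approximation] to the real and the imaginary part; the two sums
    are brought to the same length by padding with zeros. *)
Lemma complex_chebyshev_approximation (f : R -> R[i]) (sigma O : set R) (lam : R) :
  compact sigma -> open O -> sigma `<=` O -> 0 < lam ->
  (forall t, sigma t -> `|t| <= lam / 2) -> smooth_on O f ->
  forall K : nat, exists C : R, forall e : R, 0 < e -> exists N (c : nat -> R[i]),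
    (forall n, normc (c n) * n.+1%:R ^+ K <= C) /\
    forall t, sigma t ->
      normc (f t - \sum_(n < N) c n * (chebU (t / lam) n)%:C) <= e.
Proof.
move=> csig oO sO lam0 s2 fO K.
have [C1 h1] := chebyshev_approximation csig oO sO lam0 s2 (fun k x Ox => (fO k x Ox).1) K.
have [C2 h2] := chebyshev_approximation csig oO sO lam0 s2 (fun k x Ox => (fO k x Ox).2) K.
pose I : R[i] := 0 +i* 1.
have nI : normc I = 1 by rewrite /I /normc expr0n expr1n add0r sqrtr1.
exists (C1 + C2) => e e0.
have [N1 [c1 [b1 a1]]] := h1 _ (divr_gt0 e0 (ltr0Sn R 1)).
have [N2 [c2 [b2 a2]]] := h2 _ (divr_gt0 e0 (ltr0Sn R 1)).
pose pad N (c : nat -> R) n := if (n < N)%N then c n else 0.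
have pad_le N c n : `|pad N c n| <= `|c n|.
  by rewrite /pad; case: ifP => // _; rewrite normr0.
exists (N1 + N2)%N, (fun n => (pad N1 c1 n)%:C + I * (pad N2 c2 n)%:C); split.
  move=> n; apply: le_trans (ler_wpM2r (exprn_ge0 _ (ler0n _ _)) (normc_triangle _ _)) _.
  rewrite mulrDl normcM nI mul1r !normc_real; apply: lerD.
    exact: le_trans (ler_wpM2r (exprn_ge0 _ (ler0n _ _)) (pad_le _ _ _)) (b1 n).
  exact: le_trans (ler_wpM2r (exprn_ge0 _ (ler0n _ _)) (pad_le _ _ _)) (b2 n).
move=> t st; pose u := chebU (t / lam).
have -> : \sum_(n < N1 + N2) ((pad N1 c1 n)%:C + I * (pad N2 c2 n)%:C) * (chebU (t / lam) n)%:C =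
    (\sum_(n < N1) c1 n * u n)%:C + I * (\sum_(n < N2) c2 n * u n)%:C.
  rewrite -(sum_pad c1 u (leq_addr N2 N1)) -(sum_pad c2 u (leq_addl N1 N2)).
  rewrite !rmorph_sum mulr_sumr -big_split /=; apply: eq_bigr => n _.
  by rewrite !rmorphM mulrDl mulrA.
have -> : f t = (complex.Re (f t))%:C + I * (complex.Im (f t))%:C.
  by case: (f t) => a b; rewrite /I; simpc.
rewrite opprD addrACA -mulrN -mulrDr -!rmorphB.
apply: le_trans (normc_triangle _ _) _; rewrite normcM nI mul1r !normc_real.
by rewrite [leRHS]splitr; apply: lerD; [exact: a1 | exact: a2].
Qed.

(** Chebyshev polynomials commute with both evaluation morphisms, so the witness is
    [\sum_n c n U_n(X / lam)]. *)
Lemma chebyshev_polynomial (c : nat -> R[i]) N (lam : R) :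
  exists p : {poly R[i]},
    (forall t : R, p.[t%:C] = \sum_(n < N) c n * (chebU (t / lam) n)%:C) /\
    forall x : bop R, horner_alg x p = \sum_(n < N) c n *: chebU ((lam^-1)%:C *: x) n.
Proof.
exists (\sum_(n < N) c n *: chebU ((lam^-1)%:C *: 'X) n); split=> [t|x].
  rewrite horner_sum; apply: eq_bigr => n _; rewrite hornerZ; congr (_ * _).
  rewrite -[LHS]/(horner_eval t%:C _) !chebU_rmorph; congr (chebU _ _).
  by rewrite /= /horner_eval hornerZ hornerX mulrC rmorphM.
rewrite rmorph_sum; apply: eq_bigr => n _ /=; rewrite horner_algZ; congr (_ *: _).
by rewrite chebU_rmorph; congr (chebU _ _); rewrite /= horner_algZ horner_algX.
Qed.

End ComplexApproximation.

Section ScaledDecay.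
Context {R : realType}.
Implicit Types x : bop R.

Lemma off_diag_RDZ z x : off_diag_RD x -> off_diag_RD (z *: x).
Proof.
move=> h k; have [C hC] := h k; exists (normc z * C) => i j.
by rewrite entryZ normcM -mulrA ler_wpM2l ?normc_ge0.
Qed.

Lemma entries_RDZ z x : entries_RD x -> entries_RD (z *: x).
Proof.
move=> h k; have [C hC] := h k; exists (normc z * C) => i j.
by rewrite entryZ normcM -mulrA ler_wpM2l ?normc_ge0.
Qed.

End ScaledDecay.

Theorem theorem4p4 (R : realType) (S : supernatural)
  (S_infinite : infinite_supernatural R S)
  (a : l2 R nat -> l2 R nat)
  (a_smooth : BDT_smooth S a) (a_selfadjoint : self_adjoint a)
  (O : set R) (O_open : open O)
  (spectrum_O : forall r : R, spectrum (BDT_algebra S) a r%:C -> O r)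
  (f : R -> R[i]) (f_smooth : smooth_on O f) :
  exists2 b : l2 R nat -> l2 R nat,
    unique (is_cfc (BDT_algebra S) a f) b & BDT_smooth S b.
Proof.
have [x [l [aE lS xOD xW]]] := BDT_smooth_entries a_smooth.
have AC := @BDT_algebra_cstar R S; have A1 := @BDT_algebra_id R S.
have Ax : BDT_algebra S x by rewrite -aE; exact: BDT_smooth_sub_algebra.
rewrite {}aE in a_smooth a_selfadjoint spectrum_O *.
pose sigma := [set t : R | spectrum (BDT_algebra S) x t%:C].
have sigma_le t : sigma t -> `|t| <= opn x by exact: (spectrum_bounded AC A1 Ax).
have csigma : compact sigma.
  apply: (subclosed_compact _ (@segment_compact _ (- opn x) (opn x))).
    exact: (spectrum_closed AC A1 Ax).
  by move=> t /sigma_le; rewrite ler_norml /= in_itv.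
(* The spectrum of [x / lam] lies in the half interval, where [chebU_bound]
   applies. *)
pose lam := 2 * opn x + 1.
have lam0 : 0 < lam by rewrite ltr_wpDl// mulr_ge0// opn_ge0.
have s2 t : sigma t -> `|t| <= lam / 2.
  by move=> /sigma_le h; rewrite ler_pdivlMr// mulrC /lam; lra.
have app := complex_chebyshev_approximation csigma O_open spectrum_O lam0 s2 f_smooth.
have papp K : exists C : R, forall e : R, 0 < e -> exists N (c : nat -> R[i]),
    (forall n, normc (c n) * n.+1%:R ^+ K <= C) /\
    exists p : {poly R[i]}, (forall t, sigma t -> normc (f t - p.[t%:C]) <= e) /\
      horner_alg x p = \sum_(n < N) c n *: chebU ((lam^-1)%:C *: x) n.
  have [C hC] := app K; exists C => e e0; have [N [c [cb ca]]] := hC e e0.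
  exists N, c; split=> //; have [p [pt px]] := chebyshev_polynomial c N lam.
  by exists p; split=> // t st; rewrite pt; exact: ca.
have [b [b_cfc b_dist]] : exists b : bop R, unique (is_cfc (BDT_algebra S) x f) b /\
    forall (p : {poly R[i]}) (M : R),
      (forall t, sigma t -> normc (f t - p.[t%:C]) <= M) -> opn (b - horner_alg x p) <= M.
  apply: (functional_calculus AC A1 Ax a_selfadjoint) => e e0.
  by have [C hC] := papp 0%N; have [N [c [_ [p [ph _]]]]] := hC e e0; exists p.
exists b => //.
have [] := @chebyshev_limit_RD R ((lam^-1)%:C *: x) b l.
- (* The single polynomial [U_n] is a Chebyshev sum too. *)
  move=> n; have [p [pt px]] := chebyshev_polynomial (fun k => (k == n)%:R) n.+1 lam.
  have -> : chebU ((lam^-1)%:C *: x) n = horner_alg x p.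
    rewrite px big_ord_recr /= eqxx scale1r big1 ?add0r// => k _.
    by rewrite ltn_eqF// scale0r.
  apply: (polynomial_norm_le AC A1 Ax a_selfadjoint) => t st.
  rewrite pt big_ord_recr /= eqxx mul1r big1 ?add0r ?normc_real.
    apply: chebU_bound; rewrite normrM normfV (gtr0_norm lam0) ler_pdivrMr// mulrC.
    exact: s2.
  by move=> k _; rewrite ltn_eqF// mul0r.
- exact: off_diag_RDZ.
- by rewrite delZ; exact: entries_RDZ.
- move=> K; have [C hC] := papp K; exists C => e e0.
  have [N [c [cb [p [ph px]]]]] := hC e e0; exists N, c; split=> //.
  by rewrite -px; exact: b_dist.
by move=> bOD bW; exact: BDT_smooth_of_entries lS bOD bW.
Qed.
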